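(* Let $S\subset\mathbb{P}^3$ be a cubic surface as in the context, with six pairwise skew lines $E_1,\dots,E_6$ and the resulting lines $F_{ij}$, $G_i$, and let $\pi:S\to\mathbb{P}^2$ be the morphism that contracts $E_1,\dots,E_6$ to points, specified uniquely by requiring $$\pi(E_1)=(1:0:0),\quad \pi(E_2)=(0:1:0),\quad \pi(E_3)=(0:0:1),\quad \pi(E_4)=(1:1:1).$$ Let $U_{ij}=S\setminus(G_i\cup G_j\cup F_{ij})$. Then $S=U_{12}\cup U_{13}\cup U_{23}$, and the blow-down map $\pi:S\to\mathbb{P}^2$ is given on each chart by a quadratic map as follows: $$\begin{aligned} \pi|_{U_{12}}(q)&=\bigl(u_{12}\cdot h_{12}(q)h_{23}(q)\,:\,v_{12}\cdot h_{21}(q)h_{13}(q)\,:\,w_{12}\cdot h_{12}(q)h_{21}(q)\bigr),\\ \pi|_{U_{13}}(q)&=\bigl(u_{13}\cdot h_{13}(q)h_{32}(q)\,:\,v_{13}\cdot h_{13}(q)h_{31}(q)\,:\,w_{13}\cdot h_{31}(q)h_{12}(q)\bigr),\\ \pi|_{U_{23}}(q)&=\bigl(u_{23}\cdot h_{23}(q)h_{32}(q)\,:\,v_{23}\cdot h_{23}(q)h_{31}(q)\,:\,w_{23}\cdot h_{32}(q)h_{21}(q)\bigr). \end{aligned}$$ Here $u_{ij},v_{ij},w_{ij}$ are nonzero constants that are determined by $\pi(E_4)=(1:1:1)$.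
   Context: $S\subset\mathbb{P}^3$ is a smooth cubic surface over the $p$-adic field $\mathbb{Q}_p$, defined by a polynomial with full support (all $20$ cubic monomials in $x,y,z,w$) and general coefficients, so that none of its $27$ lines meets any of the six coordinate lines of $\mathbb{P}^3$; its $27$ lines are taken over $\mathbb{Q}_p$. Fix six pairwise skew lines $E_1,\dots,E_6\subset S$. The other $21$ lines on $S$ are labeled as follows: the line $F_{ij}$ intersects $E_i$ and $E_j$ but no other $E_k$, and $G_i$ intersects $E_j$ for $j\in\{1,\dots,6\}\setminus\{i\}$. For $i\neq j$, $H_{ij}$ is the plane in $\mathbb{P}^3$ spanned by $G_i$ and $E_j$, and $h_{ij}$ is a linear form defining $H_{ij}$. *)

(* Defs.v *)
From HB Require Import structures.
From mathcomp Require Import all_boot all_order all_algebra boolp.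
From mathcomp Require Export mpoly.

Set Implicit Arguments.
Unset Strict Implicit.
Unset Printing Implicit Defensive.

Import GRing.Theory Num.Theory.

Local Open Scope ring_scope.

(* The ring of p-adic integers, as the inverse limit of the rings Z/p^n:
   an element is its compatible family of residues in [0, p^n). *)

Record padic_int (p : nat) (p_pr : prime p) := PadicInt {
  residue : nat -> int;
  residueP : forall n, (residue n.+1 %% (p%:Z ^+ n))%Z = residue n
}.

Section PadicInt.

Variables (p : nat) (p_pr : prime p).
Local Notation Zp := (padic_int p_pr).
Local Notation q n := (p%:Z ^+ n).
Implicit Types (a b c : Zp) (f g : nat -> int).

HB.instance Definition _ := gen_eqMixin Zp.
HB.instance Definition _ := gen_choiceMixin Zp.

Lemma padic_eq a b : (forall n, residue a n = residue b n) -> a = b.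
Proof.
case: a b => [f fP] [g gP] /= /funext efg; case: _ / efg in gP *.
by congr PadicInt; apply: Prop_irrelevance.
Qed.

Lemma modz_pow (m : int) n k : ((m %% q (n + k))%Z %% q n)%Z = (m %% q n)%Z.
Proof.
by rewrite {2}(divz_eq m (q (n + k))) addnC exprD mulrA modzMDl.
Qed.

Lemma residue_mod a n : (residue a n %% q n)%Z = residue a n.
Proof. by rewrite -(residueP a n) modz_mod. Qed.

Definition coherent f := forall n, (f n.+1 = f n %[mod q n])%Z.

Definition padic_of f (fP : coherent f) : Zp.
Proof.
exists (fun n => (f n %% q n)%Z) => n.
by rewrite -addn1 modz_pow addn1 fP.
Defined.

Lemma coherent_residue a : coherent (residue a).
Proof. by move=> n; rewrite residueP residue_mod. Qed.

Lemma coherent_const (m : int) : coherent (fun=> m).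
Proof. by []. Qed.

Lemma coherentN a : coherent (fun n => - residue a n).
Proof. by move=> n; rewrite -modzNm residueP. Qed.

Lemma coherentD a b : coherent (fun n => residue a n + residue b n).
Proof. by move=> n; rewrite -modzDm !residueP. Qed.

Lemma coherentM a b : coherent (fun n => residue a n * residue b n).
Proof. by move=> n; rewrite -modzMm !residueP. Qed.

Definition padic0 := padic_of (coherent_const 0).
Definition padic1 := padic_of (coherent_const 1).
Definition padic_opp a := padic_of (coherentN a).
Definition padic_add a b := padic_of (coherentD a b).
Definition padic_mul a b := padic_of (coherentM a b).

Fact padic_addA : associative padic_add.
Proof. by move=> a b c; apply: padic_eq => n /=; rewrite modzDml modzDmr addrA. Qed.

Fact padic_addC : commutative padic_add.
Proof. by move=> a b; apply: padic_eq => n /=; rewrite addrC. Qed.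

Fact padic_add0 : left_id padic0 padic_add.
Proof. by move=> a; apply: padic_eq => n /=; rewrite modzDml add0r residue_mod. Qed.

Fact padic_addN : left_inverse padic0 padic_opp padic_add.
Proof. by move=> a; apply: padic_eq => n /=; rewrite modzDml addNr. Qed.

HB.instance Definition _ :=
  GRing.isZmodule.Build Zp padic_addA padic_addC padic_add0 padic_addN.

Fact padic_mulA : associative padic_mul.
Proof. by move=> a b c; apply: padic_eq => n /=; rewrite modzMml modzMmr mulrA. Qed.

Fact padic_mulC : commutative padic_mul.
Proof. by move=> a b; apply: padic_eq => n /=; rewrite mulrC. Qed.

Fact padic_mul1 : left_id padic1 padic_mul.
Proof. by move=> a; apply: padic_eq => n /=; rewrite modzMml mul1r residue_mod. Qed.

Fact padic_mulD : left_distributive padic_mul padic_add.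
Proof.
move=> a b c; apply: padic_eq => n /=.
by rewrite modzMml modzDm mulrDl.
Qed.

Fact padic_1neq0 : padic1 != 0.
Proof.
apply/eqP => /(congr1 (fun a => residue a 1)) /=.
by rewrite expr1 !modz_nat mod0n modn_small // prime_gt1.
Qed.

HB.instance Definition _ := GRing.Zmodule_isComNzRing.Build Zp
  padic_mulA padic_mulC padic_mul1 padic_mulD padic_1neq0.

Definition padic_unit : {pred Zp} := fun a => `[< exists b, b * a = 1 >].

Definition padic_inv a : Zp :=
  if pselect (exists b, b * a = 1) is left ex then projT1 (cid ex) else a.

Fact padic_mulV : {in padic_unit, left_inverse 1 padic_inv *%R}.
Proof.
move=> a /asboolP ua; rewrite /padic_inv.
by case: pselect => // ex; case: (cid ex).
Qed.

Fact padic_unitP a b : b * a = 1 -> padic_unit a.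
Proof. by move=> ba1; apply/asboolP; exists b. Qed.

Fact padic_inv_out : {in [predC padic_unit], padic_inv =1 id}.
Proof.
move=> a /asboolPn nua; rewrite /padic_inv.
by case: pselect.
Qed.

HB.instance Definition _ := GRing.ComNzRing_hasMulInverse.Build Zp
  padic_mulV padic_unitP padic_inv_out.

Lemma residue_addn a n k : (residue a (n + k) %% q n)%Z = residue a n.
Proof.
elim: k => [|k IHk]; first by rewrite addn0 residue_mod.
by rewrite -{}IHk -[residue a (n + k)]residueP addnS modz_pow.
Qed.

Fact padic_integral : GRing.integral_domain_axiom Zp.
Proof.
move=> a b ab0; apply: contrapT => /negP; rewrite negb_or => /andP[a0 b0].
have nz c : c != 0 -> exists n, forall k, ~~ (q n %| residue c (n + k))%Z.
  move=> c0; have [n cn] : exists n, residue c n <> 0.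
    apply: contrapT => /forallNP h; case/eqP: c0.
    by apply: padic_eq => n /=; rewrite mod0z; apply: contrapT.
  by exists n => k; apply/dvdz_mod0P; rewrite residue_addn.
have [[m am] [n bn]] := (nz a a0, nz b b0).
have := congr1 (fun c => residue c (m + n)) ab0; rewrite /= mod0z.
move/dvdz_mod0P; have := bn m; have := am n; rewrite [(n + m)%N]addnC.
set x := residue a _; set y := residue b _.
rewrite !dvdzE !abszX abszM !absz_nat => xm yn.
have x0 : (0 < `|x|)%N by rewrite lt0n; apply: contraNneq xm => ->.
have y0 : (0 < `|y|)%N by rewrite lt0n; apply: contraNneq yn => ->.
move: xm yn; rewrite !pfactor_dvdn ?muln_gt0 ?x0 // lognM // -!ltnNge => xm yn.
by rewrite leqNgt -addnS leq_add // ltnW.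
Qed.

HB.instance Definition _ := GRing.ComUnitRing_isIntegral.Build Zp padic_integral.

End PadicInt.

Definition Qp (p : nat) (p_pr : prime p) : fieldType := {fraction padic_int p_pr}.

(* Points of P^n are represented by nonzero row vectors up to scaling.  A
   subvariety of P^n over K, and a map between such varieties, is given by its
   action on the L-points for all field extensions L of K; this sees all
   geometric points although K is not algebraically closed. *)

Definition proj_eq (L : fieldType) n (x y : 'rV[L]_n) : Prop :=
  x != 0 /\ exists2 a, a != 0 & y = a *: x.

Definition proj_set (K : fieldType) (n : nat) : Type :=
  forall L : fieldType, {rmorphism K -> L} -> 'rV[L]_n.+1 -> Prop.

Definition proj_map (K : fieldType) (n m : nat) : Type :=
  forall L : fieldType, {rmorphism K -> L} -> 'rV[L]_n.+1 -> 'rV[L]_m.+1.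

Section Projective.

Variable K : fieldType.

Definition evalp n (P : {mpoly K[n]}) (L : fieldType) (s : {rmorphism K -> L})
  (x : 'rV[L]_n) : L := mmap s (x 0) P.

Definition evalv n m (P : 'I_m -> {mpoly K[n]}) (L : fieldType)
  (s : {rmorphism K -> L}) (x : 'rV[L]_n) : 'rV[L]_m :=
  \row_k evalp (P k) s x.

Definition sub_proj n (X Y : proj_set K n) : Prop :=
  forall (L : fieldType) (s : {rmorphism K -> L}) x, X L s x -> Y L s x.

Definition eq_on n m (X : proj_set K n) (phi psi : proj_map K n m) : Prop :=
  forall (L : fieldType) (s : {rmorphism K -> L}) x,
    X L s x -> proj_eq (phi L s x) (psi L s x).

(* Locally in the Zariski topology phi is given by forms of the same degree,
   with coefficients in K and without common zero; the neighbourhood of x is the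
   set of points of X at which the forms P k do not all vanish. *)
Definition regular n m (X : proj_set K n) (phi : proj_map K n m) : Prop :=
  forall (L : fieldType) (s : {rmorphism K -> L}) x, X L s x ->
    exists d (P : 'I_m.+1 -> {mpoly K[n.+1]}),
      [/\ forall k, P k \is d.-homog,
          evalv P s x != 0
        & forall (L' : fieldType) (s' : {rmorphism K -> L'}) y, X L' s' y ->
            evalv P s' y != 0 -> proj_eq (phi L' s' y) (evalv P s' y)].

Definition morphism n m (X : proj_set K n) (Y : proj_set K m)
    (phi : proj_map K n m) : Prop :=
  regular X phi /\
  forall (L : fieldType) (s : {rmorphism K -> L}) x, X L s x -> Y L s (phi L s x).

Definition isomorphism n m (X : proj_set K n) (Y : proj_set K m)
    (phi : proj_map K n m) : Prop :=
  morphism X Y phi /\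
  exists psi : proj_map K m n,
    [/\ morphism Y X psi,
        eq_on X (fun L s x => psi L s (phi L s x)) (fun L s x => x)
      & eq_on Y (fun L s y => phi L s (psi L s y)) (fun L s y => y)].

Definition proj_space n : proj_set K n := fun L s x => x != 0.

(* A line of P^3 is the row space of a 2 x 4 matrix of rank 2. *)
Definition on_line (l : 'M[K]_(2, 4)) : proj_set K 3 :=
  fun L s x => x != 0 /\ (x <= map_mx s l)%MS.

Definition skew (l l' : 'M[K]_(2, 4)) : bool := (l :&: l' == (0 : 'M_4))%MS.

Definition meets (l l' : 'M[K]_(2, 4)) : bool := ~~ skew l l'.

Definition coord_line (i j : 'I_4) : 'M[K]_(2, 4) :=
  col_mx (delta_mx (0 : 'I_1) i) (delta_mx (0 : 'I_1) j).

Definition surface (f : {mpoly K[4]}) : proj_set K 3 :=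
  fun L s x => x != 0 /\ evalp f s x = 0.

Definition smooth (f : {mpoly K[4]}) : Prop :=
  forall (L : fieldType) (s : {rmorphism K -> L}) x, surface f s x ->
    exists i, evalp f^`M(i) s x != 0.

Definition full_support (f : {mpoly K[4]}) : Prop :=
  forall m : 'X_{1..4}, mdeg m = 3%N -> f@_m != 0.

Definition line_on (f : {mpoly K[4]}) (l : 'M[K]_(2, 4)) : Prop :=
  \rank l = 2%N /\ sub_proj (on_line l) (surface f).

Definition avoids_coord_lines (l : 'M[K]_(2, 4)) : Prop :=
  forall i j, i != j -> skew l (coord_line i j).

Definition lin (h : 'cV[K]_4) (L : fieldType) (s : {rmorphism K -> L})
  (x : 'rV[L]_4) : L := (x *m map_mx s h) 0 0.

Definition defines_plane (h : 'cV[K]_4) (H : 'M[K]_4) : Prop :=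
  (kermx h == H)%MS.

Definition contracts_to (phi : proj_map K 3 2) (l : 'M[K]_(2, 4))
    (c : 'rV[K]_3) : Prop :=
  eq_on (on_line l) phi (fun L s x => map_mx s c).

Definition vec3 (L : fieldType) (a b c : L) : 'rV[L]_3 :=
  \row_k [:: a; b; c]`_k.

End Projective.

(* All 27 lines of S are defined over K: every line contained in S after any
   field extension is one of E_i, G_i, F_ij (i != j).  F i i is unused, and F i j
   and F j i are the same line. *)
Definition lines27 (K : fieldType) (f : {mpoly K[4]})
    (E G : 'I_6 -> 'M[K]_(2, 4)) (F : 'I_6 -> 'I_6 -> 'M[K]_(2, 4)) : Prop :=
  [/\ [/\ forall i, line_on f (E i), forall i, line_on f (G i)
        & forall i j, i != j -> line_on f (F i j)],
      forall i j, i != j -> skew (E i) (E j),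
      forall i j, i != j -> (F i j == F j i)%MS
        /\ forall k, meets (F i j) (E k) = (k == i) || (k == j),
      forall i j, meets (G i) (E j) = (j != i)
    & forall (L : fieldType) (s : {rmorphism K -> L}) (l : 'M[L]_(2, 4)),
        line_on (map_mpoly s f) l ->
        [\/ exists i, (l == map_mx s (E i))%MS,
            exists i, (l == map_mx s (G i))%MS
          | exists i j, i != j /\ (l == map_mx s (F i j))%MS]].

Section BlowDown.

Variables (K : fieldType) (f : {mpoly K[4]}).
Variables (E G : 'I_6 -> 'M[K]_(2, 4)) (F : 'I_6 -> 'I_6 -> 'M[K]_(2, 4)).
Variable h : 'I_6 -> 'I_6 -> 'cV[K]_4.

Definition i1 : 'I_6 := @Ordinal 6 0 isT.
Definition i2 : 'I_6 := @Ordinal 6 1 isT.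
Definition i3 : 'I_6 := @Ordinal 6 2 isT.
Definition i4 : 'I_6 := @Ordinal 6 3 isT.

Definition surface_minus_E : proj_set K 3 :=
  fun L s x => surface f s x /\ forall i, ~ on_line (E i) s x.

Definition plane_minus (c : 'I_6 -> 'rV[K]_3) : proj_set K 2 :=
  fun L s x => x != 0 /\ forall i, ~ proj_eq (map_mx s (c i)) x.

(* phi contracts the lines E_i, and nothing else: each E_i is mapped to a point,
   and phi is an isomorphism between the complements of these lines and points. *)
Definition blow_down (phi : proj_map K 3 2) : Prop :=
  morphism (surface f) (@proj_space K 2) phi /\
  exists c : 'I_6 -> 'rV[K]_3,
    (forall i, contracts_to phi (E i) (c i)) /\
    isomorphism surface_minus_E (plane_minus c) phi.

Definition normalized_blow_down (phi : proj_map K 3 2) : Prop :=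
  [/\ blow_down phi,
      contracts_to phi (E i1) (vec3 1 0 0),
      contracts_to phi (E i2) (vec3 0 1 0),
      contracts_to phi (E i3) (vec3 0 0 1)
    & contracts_to phi (E i4) (vec3 1 1 1)].

Definition U (i j : 'I_6) : proj_set K 3 :=
  fun L s x => [/\ surface f s x, ~ on_line (G i) s x, ~ on_line (G j) s x
                 & ~ on_line (F i j) s x].

Definition chart12 (u v w : K) : proj_map K 3 2 := fun L s q =>
  vec3 (s u * (lin (h i1 i2) s q * lin (h i2 i3) s q))
       (s v * (lin (h i2 i1) s q * lin (h i1 i3) s q))
       (s w * (lin (h i1 i2) s q * lin (h i2 i1) s q)).

Definition chart13 (u v w : K) : proj_map K 3 2 := fun L s q =>
  vec3 (s u * (lin (h i1 i3) s q * lin (h i3 i2) s q))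
       (s v * (lin (h i1 i3) s q * lin (h i3 i1) s q))
       (s w * (lin (h i3 i1) s q * lin (h i1 i2) s q)).

Definition chart23 (u v w : K) : proj_map K 3 2 := fun L s q =>
  vec3 (s u * (lin (h i2 i3) s q * lin (h i3 i2) s q))
       (s v * (lin (h i2 i3) s q * lin (h i3 i1) s q))
       (s w * (lin (h i3 i2) s q * lin (h i2 i1) s q)).

(* On U_ij the map phi is chart u v w for nonzero constants u, v, w, and
   these are the only constants, up to a common factor, for which chart u v w
   sends E_4 to (1:1:1). *)
Definition given_on (phi : proj_map K 3 2) (i j : 'I_6)
    (chart : K -> K -> K -> proj_map K 3 2) : Prop :=
  exists u v w : K,
    [/\ [/\ u != 0, v != 0 & w != 0],
        eq_on (U i j) phi (chart u v w)
      & forall u' v' w' : K,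
          eq_on (fun L s q => on_line (E i4) s q /\ U i j s q)
            (chart u' v' w') (fun L s q => vec3 1 1 1) ->
          proj_eq (vec3 u v w) (vec3 u' v' w')].

End BlowDown.

(* Main.v *)
From mathcomp Require Import all_boot all_order all_algebra all_field.
From mathcomp Require Import boolp perm ring.
Require Import Defs.

(** The surface S is determinantal, and this gives the blow-down, its inverse and
    the three charts at once.

    The plane H_ij meets S in G_i, E_j and F_ij.  Comparing the sections by the
    six planes with indices in {1, 2, 3} gives the Cayley-Salmon equation
    (cayley_salmon): f is a combination of h_12 h_23 h_31 and h_13 h_32 h_21.
    After scaling (determinantal_constants) f is, up to a constant, the
    determinant of the matrix M(x) with rows (h_21, 0, - a h_23),
    (0, h_12, - b h_13) and (h_31, - d h_32, 0), and M(x) kills (1, 1, 1) for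
    x on E_4.  The map x |-> ker M(x) is the contraction: a kernel vector is the
    vector product of two rows, and the three choices of rows are the three
    charts, which vanish together with two linear forms and so exactly on the
    lines removed from S.  On E_1, E_2 and E_3 a column of M(x) vanishes and on
    the other E_i its rows have constant directions, so that each E_i is
    contracted to a point, its centre (E_centre).

    The equations M(x) y = 0 are also linear in x: x N(y) = 0 for a 4 x 3 matrix
    N(y), whose maximal minors are cubic forms that invert the contraction where
    N(y) has rank 3.  If two points x satisfy x N(y) = 0, the line through them
    lies on S and is contracted to y; as the only lines of S are the 27 given
    ones, and each G_k or F_kl meets two of the E_i, whose centres differ, the
    line is one of the E_i (incident_two_points).  So the contraction is an
    isomorphism between the complements of the six lines and of the six centres.

    For uniqueness, two contractions differ by an isomorphism tau between
    complements of six points in the plane, and tau has to be linear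
    (plane_iso_linear).  On a line avoiding the six points, write the forms P
    that define tau as g T with T coprime.  At each point of the line, the
    Jacobian of P differs from g^3 by a unit, because P is a multiple of local
    coordinates of tau, whose Jacobian does not vanish; comparing degrees, T is
    linear.  So tau maps such lines linearly to lines, and evaluating on a frame
    shows that it is linear.  By continuity along the lines G_j it takes centres
    to centres (centre_linear); with four of them fixed it is the identity. *)

Set Implicit Arguments.
Unset Strict Implicit.
Unset Printing Implicit Defensive.

Import GRing.Theory.

Local Open Scope ring_scope.

(** * Polynomials over a field of characteristic zero *)

Section CharZero.

Variable K : fieldType.
Hypothesis charK : [pchar K] =i pred0.

Lemma exists_nonroot (p : {poly K}) : p != 0 -> exists t, p.[t] != 0.
Proof.
move=> p0; pose s := [seq (i%:R : K) | i <- iota 0 (size p)].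
have us : uniq s.
  rewrite map_inj_uniq ?iota_uniq // => i j /eqP.
  by move: charK => /pcharf0P ch; wlog le : i j / (i <= j)%N => [hw|];
    [have [/hw//|/ltnW/hw h] := leqP i j; rewrite eq_sym => /h |
     rewrite eq_sym -subr_eq0 -natrB // ch subn_eq0 => le'; apply/eqP; rewrite eqn_leq le].
have [/(max_poly_roots p0)/(_ us)|] := boolP (all (root p) s).
  by rewrite size_map size_iota ltnn.
by case/allPn => t _ rt; exists t.
Qed.

(** Seen as a polynomial in the last variable, P has for coefficients the
    polynomials that collect its monomials with the same last exponent. *)
Lemma muni_coef n (P : {mpoly K[n.+1]}) k (m : 'X_{1..n}) :
  ((muni P)`_k)@_m = P@_[multinom (rcons m k)].
Proof.
rewrite muniE coef_sum raddf_sum /=.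
pose m' : 'X_{1..n.+1} := [multinom rcons m k].
have m'w i : m' (widen_ord (leqnSn n) i) = m i.
  by rewrite multinomE (tnth_nth 0%N) nth_rcons size_tuple /= ltn_ord (mnm_nth 0%N).
have m'k : m' ord_max = k.
  by rewrite multinomE (tnth_nth 0%N) nth_rcons size_tuple /= ltnn eqxx.
rewrite [in RHS](mpolyE P) raddf_sum /=; apply: eq_bigr => /= m1 _.
rewrite !coefZ coefXn mcoeffZ mcoeffX.
have -> : (m1 == m') = ([multinom m1 (widen_ord (leqnSn n) i) | i < n] == m)
      && (k == m1 ord_max).
  apply/eqP/andP => [->|[/eqP/mnmP e /eqP ek]].
    by split; apply/eqP => //; apply/mnmP => i; rewrite mnmE m'w.
  apply/mnmP => i; have [j ->|->] := unliftP ord_max i; last by rewrite m'k.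
  have -> : lift ord_max j = widen_ord (leqnSn n) j.
    by apply: val_inj => /=; rewrite /bump leqNgt ltn_ord.
  by rewrite m'w -e mnmE.
case: (k == _); rewrite ?andbT ?andbF /= ?mulr1 ?mulr0 ?mcoeff0 //.
  by rewrite mcoeffZ mcoeffX.
Qed.

(** Induction on the number of variables: choose a point where the leading
    coefficient in the last variable does not vanish. *)
Lemma mpoly_nonvanishing n (P : {mpoly K[n]}) : P != 0 -> exists v, P.@[v] != 0.
Proof.
elim: n P => [|n IHn] P P0.
  exists (fun=> 0); apply: contra P0 => /eqP P0.
  have e : P = (P@_0%MM)%:MP.
    apply/mpolyP => m; have -> : m = 0%MM by apply/mnmP => -[].
    by rewrite mcoeffC eqxx mulr1.
  by move: P0; rewrite e mevalC => ->.
have mu0 : muni P != 0.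
  apply: contra P0 => /eqP P0; apply/eqP/mpolyP => m.
  pose m1 : 'X_{1..n} := [multinom m (widen_ord (leqnSn n) i) | i < n].
  have := muni_coef P (m ord_max) m1; rewrite P0 coef0 !mcoeff0 => ->.
  congr (P@_ _); apply/mnmP => i; rewrite multinomE (tnth_nth 0%N) nth_rcons size_tuple.
  have [j ->|->] := unliftP ord_max i; last by rewrite /= ltnn eqxx.
  have ej : lift ord_max j = widen_ord (leqnSn n) j.
    by apply: val_inj => /=; rewrite /bump leqNgt ltn_ord.
  rewrite ej /= ltn_ord; have := mnm_nth 0%N m1 j; rewrite mnmE => e1; by rewrite e1.
have [|v vP] := IHn (lead_coef (muni P)); first by rewrite lead_coef_eq0.
have : map_poly (meval v) (muni P) != 0.
  apply: contra vP => /eqP e.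
  by rewrite lead_coefE -(coef_map (meval v)) e coef0.
case/exists_nonroot => t tP.
exists (fun i => if unlift ord_max i is Some j then v j else t).
apply: contraNneq tP => e; rewrite -{}e muniE rmorph_sum horner_sum mevalE.
apply/eqP/eq_bigr => /= m _.
rewrite -mul_polyC rmorphM /= map_polyC /= map_polyXn mevalZ.
rewrite !hornerE mevalX big_ord_recr /= unlift_none -mulrA; congr (_ * (_ * _)).
apply: eq_bigr => i _; rewrite mnmE.
have -> : widen_ord (leqnSn n) i = lift ord_max i.
  by apply: val_inj => /=; rewrite /bump leqNgt ltn_ord.
by rewrite liftK.
Qed.

Lemma poly_eq0_dense (Z P : {poly K}) : Z != 0 ->
  (forall t, Z.[t] != 0 -> P.[t] = 0) -> P = 0.
Proof.
move=> Z0 h; apply/eqP; apply: contraT => P0.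
have [|t] := @exists_nonroot (Z * P); first by rewrite mulf_neq0.
by rewrite hornerM mulf_eq0 negb_or => /andP[/h ->]; rewrite eqxx.
Qed.

End CharZero.

(** An irreducible factor of smallest degree has a root in the field obtained
    by adjoining one. *)
Lemma root_in_extension (F : fieldType) (p : {poly F}) : (1 < size p)%N ->
  exists (L : fieldType) (s : {rmorphism F -> L}) (z : L), root (map_poly s p) z.
Proof.
have [n] := ubnP (size p); elim: n p => // n IHn p le_p p_gt1.
have [irr|nirr] := pselect (irreducible_poly p).
  case: (irredp_FAdjoin irr) => L _ [z rz _].
  by exists L, (in_alg L), z.
have : exists q : {poly F}, [/\ size q != 1, q %| p & ~~ (q %= p)].
  apply: contrapT => h; apply: nirr; split=> // q q1 qp.
  by apply: contrapT => /negP nqp; apply: h; exists q.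
case=> q [q1 qp nqp].
have p0 : p != 0 by rewrite -size_poly_gt0 (leq_trans _ p_gt1).
have q0 : q != 0 by apply: contraTneq qp => ->; rewrite dvd0p.
have q_gt1 : (1 < size q)%N.
  by move: q1 q0; rewrite -size_poly_eq0; case: (size q) => [|[]].
have lt_qp : (size q < size p)%N.
  by rewrite ltn_neqAle dvdp_leq // andbT dvdp_size_eqp.
have [|//|L [s [z rz]]] := IHn q; first exact: leq_trans lt_qp _.
exists L, s, z; case/dvdpP: qp => r ->.
by rewrite rmorphM rootM rz orbT.
Qed.

(** * Evaluation, composition and derivation of forms *)

Lemma mpoly_alg_ind (R : comNzRingType) n (Pr : {mpoly R[n]} -> Prop) :
  (forall c, Pr c%:MP) -> (forall i, Pr 'X_i) ->
  (forall p q, Pr p -> Pr q -> Pr (p + q)) ->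
  (forall p q, Pr p -> Pr q -> Pr (p * q)) -> forall p, Pr p.
Proof.
move=> hC hX hD hM p; elim/mpolyind: p => [|c m p _ _ IH].
  by rewrite -mpolyC0; apply: hC.
apply: (hD) => //; rewrite -mul_mpolyC; apply: (hM) => //; rewrite mpolyXE_id.
elim/big_ind: _ => [|p1 p2|i _]; [by rewrite -mpolyC1; apply: hC|exact: hM|].
by elim: (m i) => [|k IHk]; rewrite ?expr0 -?mpolyC1 ?exprS; [apply: (hC)|apply: (hM)].
Qed.

Lemma dhomog_monomial (R : nzRingType) n d (m : 'X_{1..n}) :
  (('X_[m] : {mpoly R[n]}) \is d.-homog) = (mdeg m == d).
Proof. exact: dhomogX. Qed.

Lemma mderiv_var (R : nzRingType) n i j : ('X_j : {mpoly R[n]})^`M(i) = (j == i)%:R%:MP.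
Proof.
rewrite mderivX mnm1E; have [->|_] := eqVneq j i; last by rewrite scale0r mpolyC0.
have -> : (U_(i) - U_(i))%MM = 0%MM :> 'X_{1..n}.
  by apply/mnmP => z; rewrite mnmBE subnn mnm0E.
by rewrite scale1r mpolyX0 mpolyC1.
Qed.

Section Forms.

Variable K : fieldType.

Definition mlin n (h : 'cV[K]_n) : {mpoly K[n]} := \sum_i h i 0 *: 'X_i.

Definition mcomp n m (P : {mpoly K[m]}) (Q : 'I_m -> {mpoly K[n]}) : {mpoly K[n]} :=
  P \mPo [tuple Q i | i < m].

Section Eval.

Variables (L : fieldType) (s : {rmorphism K -> L}) (n : nat).
Implicit Types (x : 'rV[L]_n) (P Q : {mpoly K[n]}).

Lemma evalpC c x : evalp c%:MP s x = s c. Proof. exact: mmapC. Qed.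
Lemma evalp0 x : evalp 0 s x = 0. Proof. exact: mmap0. Qed.
Lemma evalpX i x : evalp 'X_i s x = x 0 i.
Proof. by rewrite /evalp mmapX mmap1U. Qed.
Lemma evalpD P Q x : evalp (P + Q) s x = evalp P s x + evalp Q s x.
Proof. exact: mmapD. Qed.
Lemma evalpN P x : evalp (- P) s x = - evalp P s x.
Proof. exact: mmapN. Qed.
Lemma evalpB P Q x : evalp (P - Q) s x = evalp P s x - evalp Q s x.
Proof. exact: mmapB. Qed.
Lemma evalpM P Q x : evalp (P * Q) s x = evalp P s x * evalp Q s x.
Proof. exact: (rmorphM (mmap s (x 0))). Qed.
Lemma evalpZ c P x : evalp (c *: P) s x = s c * evalp P s x.
Proof. exact: mmapZ. Qed.
Lemma evalpXn P k x : evalp (P ^+ k) s x = evalp P s x ^+ k.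
Proof. exact: (rmorphXn (mmap s (x 0))). Qed.
Lemma evalpMn P k x : evalp (P *+ k) s x = evalp P s x *+ k.
Proof. exact: mmapMn. Qed.
Lemma evalp_sum (I : Type) (r : seq I) (F : I -> {mpoly K[n]}) x :
  evalp (\sum_(i <- r) F i) s x = \sum_(i <- r) evalp (F i) s x.
Proof. exact: (rmorph_sum (mmap s (x 0))). Qed.

Definition evalpE := (evalp0, evalpC, evalpX, evalpD, evalpN, evalpB, evalpM, evalpZ,
  evalpXn, evalpMn).

Lemma evalp_mlin (h : 'cV[K]_n) x : evalp (mlin h) s x = (x *m map_mx s h) 0 0.
Proof.
rewrite /mlin evalp_sum mxE; apply: eq_bigr => i _.
by rewrite !evalpE mxE mulrC.
Qed.

End Eval.

Section EvalComp.

Variables (L : fieldType) (s : {rmorphism K -> L}) (n : nat).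
Implicit Types (x : 'rV[L]_n) (P Q : {mpoly K[n]}).

Lemma evalp_mcomp m (P : {mpoly K[m]}) (Q : 'I_m -> {mpoly K[n]}) x :
  evalp (mcomp P Q) s x = evalp P s (evalv Q s x).
Proof.
rewrite /mcomp; elim/mpoly_alg_ind: P => [c|i|p q IHp IHq|p q IHp IHq].
- by rewrite comp_mpolyC !evalpC.
- by rewrite comp_mpolyXU -tnth_nth tnth_mktuple evalpX mxE.
- by rewrite comp_mpolyD !evalpD IHp IHq.
- by rewrite rmorphM !evalpM IHp IHq.
Qed.

Lemma evalp_homogZ d P a x : P \is d.-homog ->
  evalp P s (a *: x) = a ^+ d * evalp P s x.
Proof.
move=> /dhomogP hP; rewrite /evalp /mmap big_distrr /=.
rewrite big_seq [RHS]big_seq; apply: eq_bigr => m /hP dm.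
rewrite mulrCA; congr (_ * _); rewrite /mmap1.
rewrite (eq_bigr (fun i => a ^+ m i * x 0 i ^+ m i)); last first.
  by move=> i _; rewrite mxE exprMn.
by rewrite big_split /= prodrXr -(dm : mdeg m = d) mdegE.
Qed.

Lemma evalv_mcomp m k (P : 'I_k -> {mpoly K[m]}) (Q : 'I_m -> {mpoly K[n]}) x :
  evalv (fun i => mcomp (P i) Q) s x = evalv P s (evalv Q s x).
Proof. by apply/rowP => i; rewrite !mxE evalp_mcomp. Qed.

Lemma evalv_homogZ m d (P : 'I_m -> {mpoly K[n]}) a x :
  (forall i, P i \is d.-homog) -> evalv P s (a *: x) = a ^+ d *: evalv P s x.
Proof. by move=> hP; apply/rowP => i; rewrite !mxE (evalp_homogZ _ _ (hP i)). Qed.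

End EvalComp.

Section Homog.
Variable n : nat.
Implicit Types (P Q : {mpoly K[n]}).

Lemma dhomog_mlin (h : 'cV[K]_n) : mlin h \is 1.-homog.
Proof. by apply: rpred_sum => i _; apply: rpredZ; rewrite dhomog_monomial mdeg1. Qed.

Lemma dhomog_bigprod (I : Type) (r : seq I) (F : I -> {mpoly K[n]}) (d : I -> nat) :
  (forall i, F i \is (d i).-homog) -> \prod_(i <- r) F i \is (\sum_(i <- r) d i).-homog.
Proof.
move=> hF; elim/big_ind2: _ => [|? ? ? ? |i _]; [exact: dhomog1 | exact: dhomogM | exact: hF].
Qed.

Lemma dhomog_mcomp m d e (P : {mpoly K[m]}) (Q : 'I_m -> {mpoly K[n]}) :
  P \is d.-homog -> (forall i, Q i \is e.-homog) -> mcomp P Q \is (e * d).-homog.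
Proof.
move=> /dhomogP hP hQ; rewrite /mcomp comp_mpolyEX big_seq.
apply: rpred_sum => M /hP dM; apply: rpredZ.
rewrite comp_mpolyX -(dM : mdeg M = d) mdegE big_distrr /=.
by apply: dhomog_bigprod => i; rewrite tnth_mktuple; apply: dhomogMn.
Qed.

Lemma dhomog_deriv d P i : P \is d.+1.-homog -> P^`M(i) \is d.-homog.
Proof.
move=> /dhomogP hP; rewrite /mderiv big_seq; apply: rpred_sum => m /hP dm.
have [->|mi] := eqVneq (m i) 0%N; first by rewrite mul0r scale0r rpred0.
apply: rpredZ; rewrite dhomog_monomial.
by have := mdegD (m - U_(i)) U_(i); rewrite submK ?lep1mP // mdeg1 addn1 (dm : mdeg m = _) => -[<-].
Qed.

Lemma euler d P : P \is d.-homog -> \sum_i 'X_i * P^`M(i) = P *+ d.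
Proof.
move=> /dhomogP hP.
rewrite [in RHS](mpolyE P) -sumrMnl.
rewrite (eq_bigr (fun i => \sum_(m <- msupp P) (P@_m *+ m i) *: 'X_[m])) => [|i _].
  rewrite exchange_big /= big_seq [RHS]big_seq; apply: eq_bigr => m /hP dm.
  rewrite -(dm : mdeg m = d).
  by rewrite mdegE -scaler_suml sumrMnr scalerMnl.
rewrite [X in X^`M(i)](mpolyE P) raddf_sum big_distrr /=; apply: eq_bigr => m _.
rewrite mderivZ mderivX scalerA -scalerAr mulr_natr.
have [->|mi] := eqVneq (m i) 0%N; first by rewrite mulr0n !scale0r.
by rewrite -mpolyXD addmC submK // lep1mP.
Qed.

Lemma chain_rule m (P : {mpoly K[m]}) (Q : 'I_m -> {mpoly K[n]}) j :
  (mcomp P Q)^`M(j) = \sum_k mcomp P^`M(k) Q * (Q k)^`M(j).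
Proof.
rewrite /mcomp; elim/mpoly_alg_ind: P => [c|i|p q IHp IHq|p q IHp IHq].
- rewrite comp_mpolyC mderivC big1 // => k _; rewrite mderivC comp_mpoly0 mul0r //.
- rewrite comp_mpolyXU -tnth_nth tnth_mktuple (bigD1 i) //= big1 => [|k ki].
    by rewrite mderiv_var eqxx comp_mpolyC mul1r addr0.
  by rewrite mderiv_var eq_sym (negPf ki) comp_mpolyC mul0r.
- rewrite comp_mpolyD mderivD IHp IHq -big_split; apply: eq_bigr => k _ /=.
  by rewrite mderivD comp_mpolyD mulrDl.
- rewrite rmorphM mderivM IHp IHq big_distrl big_distrr -big_split /=.
  by apply: eq_bigr => k _; rewrite mderivM comp_mpolyD !rmorphM /=; ring.
Qed.

Lemma dhomog0_const P : P \is 0.-homog -> P = (P@_0%MM)%:MP.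
Proof.
move=> /dhomogP hP; apply/mpolyP => m; rewrite mcoeffC.
have [->|m0] := eqVneq m 0%MM; first by rewrite mulr1.
rewrite mulr0; apply: memN_msupp_eq0; apply: contra m0 => /hP/eqP.
by rewrite mdeg_eq0.
Qed.

Lemma dhomog1_mlin P : P \is 1.-homog -> exists h, P = mlin h.
Proof.
move=> hP; exists (\col_i P@_U_(i)).
have hi i : P^`M(i) = (P@_U_(i))%:MP.
  by rewrite (dhomog0_const (dhomog_deriv i hP)) mcoeff_mderiv mnm0E add0m.
rewrite -[LHS]mulr1n -(euler hP) /mlin; apply: eq_bigr => i _.
by rewrite hi mxE mulrC mul_mpolyC.
Qed.

Lemma pihomog_linM d P Q : P \is 1.-homog ->
  pihomog mdeg d.+1 (P * Q) = P * pihomog mdeg d Q.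
Proof.
move=> hP; rewrite {1}(pihomog_partitionE (leqnn (mmeasure mdeg Q))).
set k := mmeasure _ _.
have hj j : P * pihomog mdeg j Q \is j.+1.-homog.
  by rewrite -add1n; apply: dhomogM => //; apply: pihomogP.
rewrite mulr_sumr raddf_sum /=; have [lt_dk|le_kd] := ltnP d k.
  rewrite (bigD1 (Ordinal lt_dk)) //= big1 ?addr0 => [|j jd].
    by rewrite pihomog_dE.
  by rewrite (@pihomog_ne0 _ _ _ j.+1) // eqSS.
have -> : pihomog mdeg d Q = 0.
  rewrite (pihomog_partitionE (leqnn (mmeasure mdeg Q))) -/k raddf_sum big1 // => j _ /=.
  apply: (@pihomog_ne0 _ _ _ j); last exact: pihomogP.
  by rewrite neq_ltn (leq_trans (ltn_ord j) le_kd).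
rewrite mulr0 big1 // => j _; rewrite (@pihomog_ne0 _ _ _ j.+1) // eqSS.
by rewrite neq_ltn (leq_trans (ltn_ord j) le_kd).
Qed.

(** When h(e) = 1 the substitution is the projection along e onto the plane
    h = 0, so that division by h reduces to composition. *)
Lemma mlin_projection (h : 'cV[K]_n) (e : 'rV[K]_n) P : exists Q,
  P = mlin h * Q + mcomp P (fun i => 'X_i - e 0 i *: mlin h).
Proof.
rewrite /mcomp; elim/mpoly_alg_ind: P => [c|i|p q [Q1 IHp] [Q2 IHq]|p q [Q1 IHp] [Q2 IHq]].
- by exists 0; rewrite mulr0 add0r comp_mpolyC.
- exists (e 0 i)%:MP; rewrite comp_mpolyXU -tnth_nth tnth_mktuple.
  by rewrite mulrC mul_mpolyC addrC subrK.
- by exists (Q1 + Q2); rewrite {1}IHp {1}IHq comp_mpolyD; ring.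
- exists (Q1 * q + Q2 * (p \mPo [tuple 'X_i - e 0 i *: mlin h | i < n])).
  rewrite rmorphM {1}IHp /=.
  set a := (p \mPo _); set b := (q \mPo _) in IHq *.
  rewrite mulrDl; rewrite [X in a * X]IHq -/b; ring.
Qed.

End Homog.

End Forms.

Lemma evalp_map_mpoly (K L L' : fieldType) (s : {rmorphism K -> L})
    (s' : {rmorphism L -> L'}) n (P : {mpoly K[n]}) x :
  evalp (map_mpoly s P) s' x = evalp P (s' \o s) x.
Proof.
elim/mpoly_alg_ind: P => [c|i|p q IHp IHq|p q IHp IHq].
- by rewrite map_mpolyC !evalpC.
- by rewrite map_mpolyX !evalpX.
- by rewrite rmorphD !evalpD IHp IHq.
- by rewrite rmorphM !evalpM IHp IHq.
Qed.

Lemma evalv_neq0 (K : fieldType) n m (P : 'I_m -> {mpoly K[n]}) (L : fieldType)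
    (s : {rmorphism K -> L}) x : evalv P s x != 0 ->
  exists2 k, P k != 0 & evalp (P k) s x != 0.
Proof.
case/rV0Pn => k; rewrite mxE => Pk; exists k => //.
by apply: contraNneq Pk => ->; rewrite evalp0.
Qed.

Lemma evalv0 (K : fieldType) n k e (P : 'I_k -> {mpoly K[n]}) (L : fieldType)
    (s : {rmorphism K -> L}) :
  (0 < e)%N -> (forall i, P i \is e.-homog) -> evalv P s 0 = 0.
Proof.
move=> e0 hP; rewrite -[0 in LHS](scale0r 0) (evalv_homogZ _ _ _ hP).
by rewrite expr0n eqn0Ngt e0 scale0r.
Qed.

(** * Forms vanishing on linear subspaces *)

Definition idm (K : fieldType) : {rmorphism K -> K} := @idfun K.

Lemma map_mx_idm (K : fieldType) m n (A : 'M[K]_(m, n)) : map_mx (idm K) A = A.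
Proof. exact: map_mx_id. Qed.

Section Vanishing.

Variable K : fieldType.
Hypothesis charK : [pchar K] =i pred0.

Lemma row_nonvanishing n (P : {mpoly K[n]}) :
  P != 0 -> exists x : 'rV[K]_n, P.@[x 0] != 0.
Proof.
case/(mpoly_nonvanishing charK) => v vP; exists (\row_i v i).
by rewrite (@meval_eq _ _ _ v) // => i; rewrite mxE.
Qed.

(** Identities between forms are checked at general rational points. *)
Lemma row_eq0_dense n (Z P : {mpoly K[n]}) : Z != 0 ->
  (forall x : 'rV[K]_n, Z.@[x 0] != 0 -> P.@[x 0] = 0) -> P = 0.
Proof.
move=> Z0 h; apply/eqP; apply: contraT => P0.
have [|x] := @row_nonvanishing _ (Z * P); first by rewrite mulf_neq0.
by rewrite mevalM mulf_eq0 negb_or => /andP[/h ->]; rewrite eqxx.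
Qed.

Lemma meval_evalp n (P : {mpoly K[n]}) (x : 'rV[K]_n) :
  P.@[x 0] = evalp P (idm K) x.
Proof. by []. Qed.

Lemma meval_mlin n (h : 'cV[K]_n) (x : 'rV[K]_n) : (mlin h).@[x 0] = (x *m h) 0 0.
Proof. by rewrite meval_evalp evalp_mlin map_mx_idm. Qed.

Lemma mlin_eq0 n (h : 'cV[K]_n) : (mlin h == 0) = (h == 0).
Proof.
apply/eqP/eqP => [h0|->]; last by rewrite /mlin big1 // => i _; rewrite mxE scale0r.
apply/colP => i; have := meval_mlin h (delta_mx 0 i).
by rewrite h0 meval0 -rowE !mxE.
Qed.

Definition vanish_on m n (B : 'M[K]_(m, n)) (P : {mpoly K[n]}) : Prop :=
  forall x : 'rV[K]_n, (x <= B)%MS -> P.@[x 0] = 0.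

Lemma evalv_mlin_col (L : fieldType) (s : {rmorphism K -> L}) m n (B : 'M[K]_(m, n)) y :
  evalv (fun i => mlin (col i B)) s y = y *m map_mx s B.
Proof.
apply/rowP => i; rewrite mxE evalp_mlin !mxE.
by apply: eq_bigr => j _; rewrite !mxE.
Qed.

Lemma vanish_onP m n (B : 'M[K]_(m, n)) P :
  vanish_on B P <-> mcomp P (fun i => mlin (col i B)) = 0.
Proof.
split=> [h|h x /submxP[y ->]].
  apply: (@row_eq0_dense _ 1) => [|y _]; first exact: oner_neq0.
  by rewrite meval_evalp evalp_mcomp evalv_mlin_col map_mx_idm; apply: h; apply: submxMl.
have := congr1 (fun Q => Q.@[y 0]) h.
by rewrite /= meval_evalp evalp_mcomp evalv_mlin_col map_mx_idm meval0.
Qed.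

(** Restricted to a linear subspace, polynomials become polynomials in its
    parameters, which form an integral domain. *)
Lemma vanish_prime m n (B : 'M[K]_(m, n)) P Q :
  vanish_on B (P * Q) -> vanish_on B P \/ vanish_on B Q.
Proof.
rewrite !vanish_onP /mcomp rmorphM => /eqP; rewrite mulf_eq0.
by case/orP => /eqP; [left | right].
Qed.

Lemma vanish_extension m n (B : 'M[K]_(m, n)) P (L : fieldType)
    (s : {rmorphism K -> L}) x :
  vanish_on B P -> (x <= map_mx s B)%MS -> evalp P s x = 0.
Proof.
move=> /vanish_onP h /submxP[y ->].
by rewrite -evalv_mlin_col -evalp_mcomp h evalp0.
Qed.

Lemma vanish_mlin m n (B : 'M[K]_(m, n)) h : vanish_on B (mlin h) <-> B *m h = 0.
Proof.
split=> [van|Bh x /submxP[y ->]]; last by rewrite meval_mlin -mulmxA Bh mulmx0 mxE.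
apply/row_matrixP => i; rewrite row0 row_mul; apply/rowP => j; rewrite ord1.
by rewrite -meval_mlin van ?mxE // row_sub.
Qed.

Lemma mulmx_neq0_row m n (B : 'M[K]_(m, n)) (h : 'cV[K]_n) : B *m h != 0 ->
  exists2 x : 'rV[K]_n, (x <= B)%MS & (x *m h) 0 0 != 0.
Proof.
move=> Bh; apply: contrapT => no; case/eqP: Bh; apply/row_matrixP => i.
rewrite row_mul row0; apply/rowP => j; rewrite ord1 [RHS]mxE; apply/eqP.
by apply: contraT => nz; case: no; exists (row i B); rewrite ?row_sub.
Qed.

Lemma ratio_at m n (B : 'M[K]_(m, n)) (x : 'rV[K]_n) (y z : 'cV[K]_n) r :
  (x <= B)%MS -> B *m y = r *: (B *m z) -> (x *m y) 0 0 = r * (x *m z) 0 0.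
Proof. by case/submxP => D -> yz; rewrite -!mulmxA yz -scalemxAr mxE. Qed.

Lemma exists_dual n (h : 'cV[K]_n) : h != 0 -> exists e : 'rV[K]_n, e *m h = 1%:M.
Proof.
move=> h0; have [i hi] : exists i, h i 0 != 0.
  apply/existsP; apply: contraT; rewrite negb_exists => /forallP a; case/eqP: h0.
  by apply/colP => i; move: (a i); rewrite negbK mxE => /eqP.
exists ((h i 0)^-1 *: delta_mx 0 i); rewrite -scalemxAl -rowE.
by apply/rowP => j; rewrite !ord1 !mxE mulVf.
Qed.

(** The projection onto the plane kills P, so that mlin_projection gives a
    quotient; its component of degree d is a quotient too. *)
Lemma plane_dvd n d (h : 'cV[K]_n) P : P \is d.+1.-homog ->
  vanish_on (kermx h) P -> exists2 Q, Q \is d.-homog & P = mlin h * Q.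
Proof.
move=> hP van; have [h0|/exists_dual[e eh]] := eqVneq h 0.
  exists 0; first exact: rpred0.
  rewrite mulr0; apply: (@row_eq0_dense _ 1) => [|x _]; first exact: oner_neq0.
  by apply: van; rewrite sub_kermx h0 mulmx0.
have [Q eP] := mlin_projection h e P.
have e0 : mcomp P (fun i => 'X_i - e 0 i *: mlin h) = 0.
  apply: (@row_eq0_dense _ 1) => [|x _]; first exact: oner_neq0.
  rewrite meval_evalp evalp_mcomp.
  set y := evalv _ _ _; have -> : y = x - (x *m h) 0 0 *: e.
    by apply/rowP => i; rewrite !mxE !evalpE evalp_mlin map_mx_idm mulrC !mxE.
  apply: van; rewrite sub_kermx mulmxBl -scalemxAl eh; apply/eqP/rowP => i.
  by rewrite !ord1 !mxE mulr1 subrr.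
exists (pihomog mdeg d Q); first exact: pihomogP.
by rewrite -pihomog_linM ?dhomog_mlin // -[LHS](pihomog_dE hP) {1}eP e0 addr0.
Qed.

(** Composing P with the projection along e, where h(e) = 1, gives a form that
    vanishes on the whole plane m - m(e) h = 0. *)
Lemma plane_dvd_on n d (h m : 'cV[K]_n) P : P \is d.+1.-homog ->
  (forall x : 'rV[K]_n, x *m h = 0 -> x *m m = 0 -> P.@[x 0] = 0) ->
  exists2 Q, Q \is d.-homog & vanish_on (kermx h) (P - mlin m * Q).
Proof.
move=> hP van; have [h0|/exists_dual[e eh]] := eqVneq h 0.
  have [|Q hQ ->] := @plane_dvd _ d m P hP; last first.
    by exists Q; rewrite // subrr => x _; rewrite meval0.
  by move=> x; rewrite sub_kermx => /eqP; apply: van; rewrite h0 mulmx0.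
pose sg (i : 'I_n) : {mpoly K[n]} := 'X_i - e 0 i *: mlin h.
have evs (x : 'rV[K]_n) : evalv sg (idm K) x
     = x - (x *m h) 0 0 *: e.
  by apply/rowP => i; rewrite !mxE !evalpE evalp_mlin map_mx_idm mulrC !mxE.
have hsg i : sg i \is 1.-homog.
  by rewrite rpredB ?rpredZ ?dhomog_mlin // dhomog_monomial mdeg1.
have hPs : mcomp P sg \is d.+1.-homog.
  by rewrite -[d.+1]mul1n; apply: dhomog_mcomp.
have ker x : (x - (x *m h) 0 0 *: e) *m h = 0.
  rewrite mulmxBl -scalemxAl eh; apply/rowP => i.
  by rewrite !ord1 !mxE mulr1 subrr.
have [x|Q hQ eQ] := plane_dvd (h := m - h *m (e *m m)) hPs.
  rewrite sub_kermx => /eqP xm; rewrite meval_evalp evalp_mcomp evs.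
  apply: van; first exact: ker.
  move/eqP: xm; rewrite mulmxBl mulmxBr mulmxA subr_eq0 => /eqP ->.
  by rewrite -scalemxAl -mul_scalar_mx -mx11_scalar !mulmxA subrr.
exists Q => // x; rewrite sub_kermx => /eqP xh.
rewrite mevalB mevalM meval_mlin.
have -> : P.@[x 0] = (mcomp P sg).@[x 0].
  by rewrite [RHS]meval_evalp evalp_mcomp evs xh mxE scale0r subr0.
by rewrite eQ mevalM meval_mlin mulmxBr !mulmxA xh !mul0mx subr0 subrr.
Qed.

(** The product of Z and of the linear forms does not vanish identically on
    the subspace, by vanish_prime. *)
Lemma generic_point n m (B : 'M[K]_(m, n)) (s : seq 'cV[K]_n) (Z : {mpoly K[n]}) :
  (forall h, h \in s -> B *m h != 0) -> ~ vanish_on B Z ->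
  exists x : 'rV[K]_n, [/\ (x <= B)%MS, Z.@[x 0] != 0 & forall h, h \in s -> x *m h != 0].
Proof.
move=> hs hZ.
have nv : ~ vanish_on B (Z * \prod_(h <- s) mlin h).
  case/vanish_prime => //; elim: s hs => [_ /(_ 0)|h s IHs hs].
    by rewrite big_nil meval1 sub0mx => /(_ isT)/eqP; rewrite oner_eq0.
  rewrite big_cons => /vanish_prime[/vanish_mlin/eqP|].
    by apply/negP/hs; rewrite mem_head.
  by apply: IHs => k ks; apply: hs; rewrite inE ks orbT.
have [x [xB]] : exists x : 'rV[K]_n, (x <= B)%MS /\ (Z * \prod_(h <- s) mlin h).@[x 0] != 0.
  apply: contrapT => h; apply: nv => x xB; apply/eqP; apply: contraT => nz.
  by case: h; exists x.
rewrite mevalM mulf_eq0 negb_or => /andP[Zx sx]; exists x; split=> // h hh.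
apply: contraNneq sx => xh; rewrite rmorph_prod.
by rewrite (big_rem _ hh) /= meval_mlin xh mxE mul0r.
Qed.

End Vanishing.

(** * Proportional vectors *)

(** Unlike proj_eq, this also makes sense for vectors of forms and at points
    where they vanish. *)
Definition par (R : nzRingType) n (u v : 'I_n -> R) : Prop :=
  forall i j, u i * v j = u j * v i.

Lemma par_proj_eq (L : fieldType) n (x y : 'rV[L]_n) :
  x != 0 -> y != 0 -> par (x 0) (y 0) -> proj_eq x y.
Proof.
move=> x0 y0 xy; split=> //.
have /rV0Pn[i xi] := x0.
exists (y 0 i / x 0 i).
  apply: mulf_neq0; rewrite ?invr_eq0 //; apply: contra y0 => /eqP yi.
  apply/eqP/rowP => j; rewrite mxE; have /eqP := xy i j.
  by rewrite yi mulr0 mulf_eq0 (negPf xi) => /eqP.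
by apply/rowP => j; rewrite mxE mulrAC -[y 0 i * _]mulrC -xy mulrAC mulfV // mul1r.
Qed.

Lemma proj_eq_par (L : fieldType) n (x y : 'rV[L]_n) : proj_eq x y -> par (x 0) (y 0).
Proof. by case=> _ [a _ ->] i j; rewrite !mxE; ring. Qed.

Lemma proj_eq_neq0 (L : fieldType) n (x y : 'rV[L]_n) : proj_eq x y -> x != 0 /\ y != 0.
Proof. by case=> x0 [a a0 ->]; rewrite scaler_eq0 negb_or a0 x0. Qed.

Lemma proj_eq_sym (L : fieldType) n (x y : 'rV[L]_n) : proj_eq x y -> proj_eq y x.
Proof.
move=> /[dup] /proj_eq_neq0[_ y0] [x0 [a a0 e]]; split=> //; exists a^-1.
  by rewrite invr_eq0.
by rewrite e scalerA mulVf // scale1r.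
Qed.

Lemma proj_eq_trans (L : fieldType) n (y x z : 'rV[L]_n) :
  proj_eq x y -> proj_eq y z -> proj_eq x z.
Proof.
case=> x0 [a a0 ->] [_ [b b0 ->]]; split=> //; exists (b * a); first exact: mulf_neq0.
by rewrite scalerA.
Qed.

Lemma proj_eq_refl (L : fieldType) n (x : 'rV[L]_n) : x != 0 -> proj_eq x x.
Proof. by split=> //; exists 1; rewrite ?oner_eq0 ?scale1r. Qed.

Lemma proj_eq_mulmx (L : fieldType) (A : 'M[L]_3) (x y : 'rV[L]_3) : A \in unitmx ->
  proj_eq x y -> proj_eq (x *m A) (y *m A).
Proof.
move=> uA [x0 [t t0 ->]]; split; last by exists t; rewrite // scalemxAl.
by apply: contra x0 => /eqP z; rewrite -(mulmxK uA x) z mul0mx.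
Qed.

Lemma regular_proj_eq (K : fieldType) n k (X : proj_set K n) (phi : proj_map K n k)
    (L : fieldType) (s : {rmorphism K -> L}) x x' : regular X phi -> X L s x -> X L s x' ->
  proj_eq x x' -> proj_eq (phi L s x) (phi L s x').
Proof.
move=> reg Xx Xx' [x0 [t t0 ex']]; have [e [P [hP Px eP]]] := reg L s x Xx.
have Px' : evalv P s x' = t ^+ e *: evalv P s x by rewrite ex' (evalv_homogZ _ _ _ hP).
apply: proj_eq_trans (eP _ _ _ Xx Px) _; apply: proj_eq_sym.
have nz : evalv P s x' != 0 by rewrite Px' scaler_eq0 negb_or expf_neq0.
apply: proj_eq_trans (eP _ _ _ Xx' nz) _; apply: proj_eq_sym; split=> //.
by exists (t ^+ e); rewrite ?expf_neq0.
Qed.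

Lemma plane_minus_proj_eq (K : fieldType) (c : 'I_6 -> 'rV[K]_3) (L : fieldType)
    (s : {rmorphism K -> L}) x y :
  proj_eq x y -> plane_minus c s x -> plane_minus c s y.
Proof.
move=> xy [x0 xc]; split; first by have [] := proj_eq_neq0 xy.
by move=> i cy; apply: (xc i); apply: proj_eq_trans cy (proj_eq_sym xy).
Qed.

Lemma par_trans (R : idomainType) n (u v w : 'I_n -> R) k :
  u k != 0 -> par u v -> par u w -> par v w.
Proof.
move=> uk uv uw i j; apply: (mulfI uk); apply: (mulfI uk).
have -> : u k * (u k * (v i * w j)) = (u k * v i) * (u k * w j) by ring.
have -> : u k * (u k * (v j * w i)) = (u k * v j) * (u k * w i) by ring.
by rewrite !(uv k) !(uw k); ring.
Qed.

(** * Vectors with three entries *)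

Lemma det2 (R : comNzRingType) (A : 'M[R]_2) (a := fun i j => A (inord i) (inord j)) :
  \det A = a 0%N 0%N * a 1%N 1%N - a 0%N 1%N * a 1%N 0%N.
Proof.
rewrite (expand_det_row _ 0) !big_ord_recr big_ord0 /= add0r /cofactor !det_mx11 !mxE.
have E i j : A i j = a i j by rewrite /a !inord_val.
by rewrite !E /= /bump /= expr0 expr1; ring.
Qed.

Lemma det3 (R : comNzRingType) (A : 'M[R]_3) (a := fun i j => A (inord i) (inord j)) :
  \det A = a 0%N 0%N * (a 1%N 1%N * a 2%N 2%N - a 1%N 2%N * a 2%N 1%N)
         - a 0%N 1%N * (a 1%N 0%N * a 2%N 2%N - a 1%N 2%N * a 2%N 0%N)
         + a 0%N 2%N * (a 1%N 0%N * a 2%N 1%N - a 1%N 1%N * a 2%N 0%N).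
Proof.
rewrite (expand_det_row _ 0) !big_ord_recr big_ord0 /= add0r.
rewrite /cofactor !det2 !mxE.
have E i j : A i j = a i j by rewrite /a !inord_val.
rewrite !E /= !inordK //= /bump /= !addn0 !addn1.
by rewrite expr0 expr1 sqrrN expr1n; ring.
Qed.

Lemma det_scalar_add_rank1 (R : comNzRingType) a (u : 'cV[R]_3) (v : 'rV[R]_3) :
  \det (a%:M + u *m v) = a ^+ 2 * (a + (v *m u) 0 0).
Proof.
rewrite det3 /= !mxE !big_ord1 !big_ord_recr big_ord0 /= -!val_eqE /= !inordK //=.
pose i0 : 'I_3 := inord 0; pose i1 : 'I_3 := inord 1; pose i2 : 'I_3 := inord 2.
have -> : widen_ord (leqnSn 2) (widen_ord (leqnSn 1) ord_max) = i0.
  by apply: val_inj; rewrite /= inordK.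
have -> : widen_ord (leqnSn 2) ord_max = i1 by apply: val_inj; rewrite /= inordK.
have -> : ord_max = i2 by apply: val_inj; rewrite /= inordK.
rewrite -/i0 -/i1 -/i2.
ring.
Qed.

Lemma vec3_0 (L : fieldType) (x y z : L) : vec3 x y z 0 0 = x. Proof. by rewrite mxE. Qed.
Lemma vec3_1 (L : fieldType) (x y z : L) : vec3 x y z 0 1 = y. Proof. by rewrite mxE. Qed.
Lemma vec3_2 (L : fieldType) (x y z : L) : vec3 x y z 0 (inord 2) = z.
Proof. by rewrite mxE inordK. Qed.
Definition vec3E := (vec3_0, vec3_1, vec3_2).

Lemma ord3P (Pr : 'I_3 -> Prop) : Pr 0 -> Pr 1 -> Pr (inord 2) -> forall i, Pr i.
Proof.
move=> h0 h1 h2 [[|[|[|//]]] q].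
- by rewrite (_ : Ordinal q = 0) //; apply: val_inj.
- by rewrite (_ : Ordinal q = 1) //; apply: val_inj.
- by rewrite (_ : Ordinal q = inord 2) //; apply: val_inj; rewrite /= inordK.
Qed.

Lemma vec3_eta (L : fieldType) (u : 'rV[L]_3) : u = vec3 (u 0 0) (u 0 1) (u 0 (inord 2)).
Proof. by apply/rowP; apply: ord3P; rewrite vec3E. Qed.

Lemma sum3 (R : nzRingType) (g : 'I_3 -> R) : \sum_i g i = g 0 + g 1 + g (inord 2).
Proof.
rewrite !big_ord_recr big_ord0 /= add0r; congr (g _ + g _ + g _); apply: val_inj => //=.
by rewrite inordK.
Qed.

Definition rows3 n (L : fieldType) (a b d : 'rV[L]_n) : 'M[L]_(3, n) :=
  \matrix_(i, j) vec3 (a 0 j) (b 0 j) (d 0 j) 0 i.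

Lemma vec3_rows3 n (L : fieldType) x y z (a b d : 'rV[L]_n) :
  vec3 x y z *m rows3 a b d = x *: a + y *: b + z *: d.
Proof.
apply/rowP => j; rewrite mxE sum3 !vec3E [rows3 _ _ _ 0 _]mxE [rows3 _ _ _ 1 _]mxE.
by rewrite [rows3 _ _ _ (inord 2) _]mxE !vec3E !mxE.
Qed.

Lemma row_rows3 n (L : fieldType) (a b d : 'rV[L]_n) :
  [/\ row 0 (rows3 a b d) = a, row 1 (rows3 a b d) = b & row (inord 2) (rows3 a b d) = d].
Proof. by split; apply/rowP => j; rewrite mxE [LHS]mxE vec3E. Qed.

Lemma rows3_mul n m (L : fieldType) (a b d : 'rV[L]_n) (B : 'M[L]_(n, m)) :
  rows3 a b d *m B = rows3 (a *m B) (b *m B) (d *m B).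
Proof.
have [r0 r1 r2] := row_rows3 a b d.
have [q0 q1 q2] := row_rows3 (a *m B) (b *m B) (d *m B).
by apply/row_matrixP; apply: ord3P; rewrite row_mul ?(r0, r1, r2) ?(q0, q1, q2).
Qed.

Lemma vec3_neq0 (K : fieldType) (x y z : K) : x != 0 \/ y != 0 \/ z != 0 -> vec3 x y z != 0.
Proof.
case=> [nz|[nz|nz]]; apply: contra nz => /eqP/rowP e.
- by have := e 0; rewrite vec3E mxE => ->.
- by have := e 1; rewrite vec3E mxE => ->.
- by have := e (inord 2); rewrite vec3E mxE => ->.
Qed.

Lemma col_mulmx m n p (R : pzSemiRingType) (A : 'M[R]_(m, n)) (B : 'M[R]_(n, p)) i :
  col i (A *m B) = A *m col i B.
Proof. by rewrite !colE mulmxA. Qed.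

(** Both triples of constants are proportional to (1/p, 1/q, 1/r). *)
Lemma constants_unique (K : fieldType) (u v w u' v' w' p q r : K) :
  proj_eq (vec3 (u * p) (v * q) (w * r)) (vec3 1 1 1) ->
  proj_eq (vec3 (u' * p) (v' * q) (w' * r)) (vec3 1 1 1) ->
  proj_eq (vec3 u v w) (vec3 u' v' w').
Proof.
move=> /proj_eq_sym[_ [t t0 e]] /proj_eq_sym[_ [t' t0' e']].
have comp k (x : K) : (x *: vec3 1 1 1) 0 k = x.
  by move: k; apply: ord3P; rewrite mxE vec3E mulr1.
have entries (x y z r0 : K) : vec3 x y z = r0 *: vec3 1 1 1 -> [/\ x = r0, y = r0 & z = r0].
  move=> /rowP exyz.
  by split; [have := exyz 0 | have := exyz 1 | have := exyz (inord 2)]; rewrite comp vec3E.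
have [e1 e2 e3] := entries _ _ _ _ e; have [e1' e2' e3'] := entries _ _ _ _ e'.
have nz x y : x * y = t -> x != 0 /\ y != 0.
  by move=> xy; apply/andP; rewrite -negb_or -mulf_eq0 xy.
have [u0 p0] := nz _ _ e1; have [v0 q0] := nz _ _ e2; have [w0 r0] := nz _ _ e3.
split; first by apply: vec3_neq0; left.
exists (t' / t); first by rewrite mulf_neq0 ?invr_eq0.
apply/rowP; apply: ord3P; rewrite [RHS]mxE !vec3E.
- by apply: (mulIf p0); rewrite /= e1' -(mulrA _ u) e1 divfK.
- by apply: (mulIf q0); rewrite /= e2' -(mulrA _ v) e2 divfK.
- by apply: (mulIf r0); rewrite /= e3' -(mulrA _ w) e3 divfK.
Qed.

(** * Jacobians *)

Section Jacobian.

Variable K : fieldType.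
Hypothesis charK : [pchar K] =i pred0.

Lemma natr_mpoly_neq0 n d : (0 < d)%N -> d%:R != 0 :> {mpoly K[n]}.
Proof.
move=> d0; rewrite -mpolyC_nat mpolyC_eq0.
by move: charK => /pcharf0P ->; rewrite -lt0n.
Qed.

Definition jac n (P : 'I_n -> {mpoly K[n]}) : 'M[{mpoly K[n]}]_n :=
  \matrix_(i, j) (P j)^`M(i).

Definition jacdet (P : 'I_3 -> {mpoly K[3]}) : {mpoly K[3]} := \det (jac P).

Lemma dhomog_jacdet d P : (forall k, P k \is d.+1.-homog) ->
  jacdet P \is (d * 3).-homog.
Proof.
move=> hP; apply: rpred_sum => s _; rewrite rpredMsign.
have -> : (d * 3)%N = (\sum_(i < 3) d)%N by rewrite sum_nat_const card_ord mulnC.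
by apply: dhomog_bigprod => i; rewrite mxE; apply: dhomog_deriv.
Qed.

(** By Euler's relation for P, the Jacobian matrix of d H P is that of P
    multiplied by the scalar matrix d H plus a matrix of rank one built from the
    gradient of H, whose determinant Euler's relation for H computes. *)
Lemma jacdet_scale d e (P : 'I_3 -> {mpoly K[3]}) H : (0 < d)%N ->
  (forall k, P k \is d.-homog) -> H \is e.-homog ->
  d%:R * jacdet (fun k => H * P k) = (d + e)%:R * (H ^+ 3 * jacdet P).
Proof.
move=> d0 hP hH; have d0' := natr_mpoly_neq0 3 d0.
apply: (mulfI (mulf_neq0 d0' d0')).
pose u : 'cV[{mpoly K[3]}]_3 := \col_i H^`M(i).
pose v : 'rV[{mpoly K[3]}]_3 := \row_i 'X_i.
have vP k : (v *m jac P) 0 k = d%:R * P k.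
  rewrite mxE mulr_natl -(euler (hP k)); apply: eq_bigr => i _; by rewrite !mxE.
have vu : (v *m u) 0 0 = e%:R * H.
  rewrite mxE mulr_natl -(euler hH); apply: eq_bigr => i _; by rewrite !mxE.
have e1 : d%:R *: jac (fun k => H * P k) = ((d%:R * H)%:M + u *m v) *m jac P.
  apply/matrixP => i j; rewrite mulmxDl mul_scalar_mx -mulmxA !mxE big_ord1.
  by rewrite vP !mxE mderivM; ring.
have := congr1 determinant e1.
rewrite detZ det_mulmx det_scalar_add_rank1 vu -/(jacdet _) -/(jacdet P) => e2.
have -> : d%:R * d%:R * (d%:R * jacdet (fun k => H * P k)) =
   d%:R ^+ 3 * jacdet (fun k => H * P k) by ring.
by rewrite e2 natrD; ring.
Qed.

(** The triples Q_j P and P_j Q coincide, and jacdet_scale computes the Jacobian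
    of either. *)
Lemma jacdet_par d e (P Q : 'I_3 -> {mpoly K[3]}) j : (0 < d)%N -> (0 < e)%N ->
  (forall k, P k \is d.-homog) -> (forall k, Q k \is e.-homog) -> par P Q ->
  e%:R * (Q j ^+ 3 * jacdet P) = d%:R * (P j ^+ 3 * jacdet Q).
Proof.
move=> d0 e0 hP hQ PQ.
have de0 : (d + e)%:R != 0 :> {mpoly K[3]} by apply: natr_mpoly_neq0; rewrite addn_gt0 d0.
apply: (mulfI de0).
have h1 := jacdet_scale d0 hP (hQ j).
have h2 := jacdet_scale e0 hQ (hP j).
have e1 : jacdet (fun k => Q j * P k) = jacdet (fun k => P j * Q k).
  congr (\det _); apply/matrixP => a b; rewrite !mxE; congr (_^`M(_)).
  by rewrite mulrC PQ.
transitivity (e%:R * (d%:R * jacdet (fun k => Q j * P k))); first by rewrite h1; ring.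
transitivity (d%:R * (e%:R * jacdet (fun k => P j * Q k))); first by rewrite e1; ring.
by rewrite h2 addnC; ring.
Qed.

Lemma evalp_jacdet P (L : fieldType) (s : {rmorphism K -> L}) x :
  evalp (jacdet P) s x = \det (\matrix_(i, j) evalp (P j)^`M(i) s x).
Proof.
pose ev : {rmorphism {mpoly K[3]} -> L} := mmap s (x 0).
rewrite -[LHS]/(ev (jacdet P)) -det_map_mx; congr (\det _).
by apply/matrixP => i j; rewrite !mxE.
Qed.

Lemma pchar_extension (L : fieldType) (s : {rmorphism K -> L}) d :
  (0 < d)%N -> d%:R != 0 :> L.
Proof.
move=> d0; rewrite -(rmorph_nat s) fmorph_eq0.
by move: charK => /pcharf0P ->; rewrite -lt0n.
Qed.

Lemma dhomog0_evalp n (P : {mpoly K[n]}) (L : fieldType) (s : {rmorphism K -> L}) x y :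
  P \is 0.-homog -> evalp P s x = evalp P s y.
Proof. by move/dhomog0_const => ->; rewrite !evalpC. Qed.

(** A vector killed by the differential of P at x is proportional to x: this
    follows by differentiating the proportionality of Q(P(x)) and x along it.
    But Euler's relation shows that x itself is not killed. *)
Lemma jacdet_inverse d (P Q : 'I_3 -> {mpoly K[3]}) (L : fieldType)
    (s : {rmorphism K -> L}) (x : 'rV[L]_3) :
  (forall k, P k \is d.-homog) -> x != 0 -> evalv P s x != 0 ->
  evalv Q s (evalv P s x) != 0 ->
  par (fun i => mcomp (Q i) P) (fun i => 'X_i) ->
  (0 < d)%N /\ evalp (jacdet P) s x != 0.
Proof.
move=> hP x0 Px Qx VX; set V := fun i => mcomp (Q i) P in VX.
have Vx k : evalp (V k) s x = evalv Q s (evalv P s x) 0 k by rewrite evalp_mcomp mxE.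
have /rV0Pn[a Va] := Qx; rewrite -Vx in Va.
have d0 : (0 < d)%N.
  rewrite lt0n; apply: contra Va => /eqP dd; move: hP; rewrite dd => hP.
  have [b ba] : exists b : 'I_3, b != a.
    by case: (eqVneq a 0) => [->|a0]; [exists 1 | exists 0; rewrite eq_sym].
  pose y : 'rV[L]_3 := delta_mx 0 b.
  have Py : evalv P s y = evalv P s x.
    by apply/rowP => k; rewrite !mxE; apply: dhomog0_evalp.
  have := congr1 (fun T => evalp T s y) (VX a b).
  rewrite /= !evalpM !evalpX !mxE !eqxx (eq_sym a) (negPf ba) /= mulr1 mulr0.
  by rewrite !Vx /V evalp_mcomp Py mxE => /eqP.
split=> //; rewrite evalp_jacdet; apply/negP => /det0P[v v0 vJ].
have vP k : \sum_i v 0 i * evalp (P k)^`M(i) s x = 0.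
  have := congr1 (fun T : 'rV_3 => T 0 k) vJ; rewrite !mxE => e; rewrite -[RHS]e.
  by apply: eq_bigr => i _; rewrite mxE.
have vV k : \sum_i v 0 i * evalp (V k)^`M(i) s x = 0.
  rewrite (eq_bigr (fun i => \sum_j evalp (mcomp (Q k)^`M(j) P) s x *
      (v 0 i * evalp (P j)^`M(i) s x))).
    by rewrite exchange_big big1 // => j _ /=; rewrite -mulr_sumr vP mulr0.
  move=> i _; rewrite /V chain_rule evalp_sum mulr_sumr; apply: eq_bigr => j _.
  by rewrite evalpM; ring.
have parV i j : evalp (V i) s x * v 0 j = evalp (V j) s x * v 0 i.
  have D k i' : \sum_l v 0 l * evalp (V k * 'X_i')^`M(l) s x = evalp (V k) s x * v 0 i'.
    rewrite (eq_bigr (fun l => v 0 l * evalp (V k)^`M(l) s x * x 0 i' +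
        evalp (V k) s x * (v 0 l * (l == i')%:R))).
      rewrite big_split /= -mulr_suml vV mul0r add0r -mulr_sumr; congr (_ * _).
      rewrite (bigD1 i') //= eqxx mulr1 big1 ?addr0 // => l /negPf ->.
      by rewrite mulr0.
    move=> l _; rewrite mderivM evalpD !evalpM evalpX mderiv_var evalpC.
    by rewrite rmorph_nat eq_sym; ring.
  by rewrite -!D; apply: eq_bigr => l _; rewrite VX.
have parVx i j : evalp (V i) s x * x 0 j = evalp (V j) s x * x 0 i.
  by have := congr1 (fun T => evalp T s x) (VX i j); rewrite /= !evalpM !evalpX.
have [_ [t t0 xv]] : proj_eq v x.
  apply: par_proj_eq => //.
  by apply: (@par_trans _ _ (fun i => evalp (V i) s x) _ _ a).
have /rV0Pn[k Pk] := Px.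
have : \sum_i x 0 i * evalp (P k)^`M(i) s x = 0.
  transitivity (t * \sum_i v 0 i * evalp (P k)^`M(i) s x); last by rewrite vP mulr0.
  rewrite mulr_sumr; apply: eq_bigr => i _.
  by rewrite {1}xv mxE mulrA.
have := congr1 (fun T => evalp T s x) (euler (hP k)).
rewrite /= evalp_sum evalpMn (eq_bigr (fun i => x 0 i * evalp (P k)^`M(i) s x)); last first.
  by move=> i _; rewrite evalpM evalpX.
move=> -> /eqP; rewrite -mulr_natr mulf_eq0 (negPf (pchar_extension s d0)) orbF.
by move: Pk; rewrite mxE => /negPf ->.
Qed.

End Jacobian.

(** * Restriction of forms to lines *)

Section Restriction.

Variables (K : fieldType) (n : nat) (a b : 'rV[K]_n).
Implicit Types P Q : {mpoly K[n]}.

Definition restr P : {poly K} :=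
  mmap polyC (fun i => (a 0 i)%:P + b 0 i *: 'X) P.

Lemma restrC c : restr c%:MP = c%:P. Proof. exact: mmapC. Qed.
Lemma restrX i : restr 'X_i = (a 0 i)%:P + b 0 i *: 'X.
Proof. by rewrite /restr mmapX mmap1U. Qed.
Lemma restrD P Q : restr (P + Q) = restr P + restr Q. Proof. exact: mmapD. Qed.
Lemma restrM P Q : restr (P * Q) = restr P * restr Q.
Proof. exact: (rmorphM (mmap polyC _)). Qed.
Lemma restrXn P k : restr (P ^+ k) = restr P ^+ k.
Proof. exact: (rmorphXn (mmap polyC _)). Qed.
Lemma restr_nat k : restr k%:R = k%:R.
Proof. exact: (rmorph_nat (mmap polyC _)). Qed.

Lemma restr_eval P (L : fieldType) (s : {rmorphism K -> L}) t :
  (map_poly s (restr P)).[t] = evalp P s (map_mx s a + t *: map_mx s b).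
Proof.
elim/mpoly_alg_ind: P => [c|i|p q IHp IHq|p q IHp IHq].
- by rewrite restrC map_polyC hornerC evalpC.
- by rewrite restrX rmorphD /= map_polyC map_polyZ map_polyX !hornerE evalpX !mxE mulrC.
- by rewrite restrD rmorphD hornerD IHp IHq evalpD.
- by rewrite restrM rmorphM hornerM IHp IHq evalpM.
Qed.

Lemma restr_horner P t : (restr P).[t] = P.@[(a + t *: b) 0].
Proof.
by have := restr_eval P (idm K) t; rewrite !map_mx_idm map_poly_id.
Qed.

Lemma size_coef_prod (I : Type) (r : seq I) (p : I -> {poly K}) (d : I -> nat) :
  (forall i, (size (p i) <= (d i).+1)%N) ->
  (size (\prod_(i <- r) p i)%R <= (\sum_(i <- r) d i).+1)%N /\
  (\prod_(i <- r) p i)`_(\sum_(i <- r) d i)%N = \prod_(i <- r) (p i)`_(d i).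
Proof.
move=> hp; elim: r => [|i r [IHs IHc]]; first by rewrite !big_nil size_poly1 coef1.
rewrite !big_cons; split.
  apply: leq_trans (size_polyMleq _ _) _.
  by rewrite -subn1 leq_subLR add1n -addSn -addnS leq_add.
rewrite -IHc coefM (bigD1 (inord (d i))) //= inordK ?ltnS ?leq_addr //.
rewrite addKn [X in _ + X]big1 ?addr0 // => j jd.
have {}jd : (j != d i :> nat).
  by apply: contra jd => /eqP e; apply/eqP/val_inj; rewrite /= inordK ?ltnS ?leq_addr.
have [lt|lt|e] := ltngtP j (d i); last by rewrite e eqxx in jd.
  rewrite [X in _ * X]nth_default ?mulr0 // (leq_trans IHs) // ltn_subRL.
  by rewrite ltn_add2r.
by rewrite nth_default ?mul0r // (leq_trans (hp i)).
Qed.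

(** The coefficient of t^d in P(a + t b) is the value of P at the point at
    infinity b of the line. *)
Lemma restr_homog d P : P \is d.-homog ->
  (size (restr P) <= d.+1)%N /\ (restr P)`_d = P.@[b 0].
Proof.
move=> /dhomogP hP.
have mono m : mdeg m = d ->
    (size (restr 'X_[m]) <= d.+1)%N /\ (restr 'X_[m])`_d = 'X_[m].@[b 0].
  move=> <-; rewrite /restr mmapX mevalX mdegE /mmap1.
  pose p i := ((a 0 i)%:P + b 0 i *: 'X) ^+ m i.
  have lin i k : (size (((a 0 i)%:P + b 0 i *: 'X) ^+ k)%R <= k.+1)%N /\
     (((a 0 i)%:P + b 0 i *: 'X) ^+ k)`_k = b 0 i ^+ k.
    have := @size_coef_prod _ (iota 0 k) (fun=> (a 0 i)%:P + b 0 i *: 'X) (fun=> 1%N).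
    rewrite !big_const_seq !count_predT size_iota iter_addn_0 mul1n -!Monoid.iteropE /=.
    rewrite coefD coefC coefZ coefX /= add0r mulr1; apply=> _.
    rewrite (leq_trans (size_polyD _ _)) // geq_max (leq_trans (size_polyC_leq1 _)) //.
    by rewrite (leq_trans (size_scale_leq _ _)) // size_polyX.
  have [h1 h2] := @size_coef_prod _ (index_enum 'I_n) p m (fun i => (lin i (m i)).1).
  by split; rewrite // h2; apply: eq_bigr => i _; have [_] := lin i (m i).
have e : restr P = \sum_(m <- msupp P) P@_m *: restr 'X_[m].
  rewrite {1}(mpolyE P) /restr raddf_sum /=; apply: eq_bigr => m _.
  by rewrite mmapZ mul_polyC.
rewrite e; split.
  apply: (leq_trans (size_sum _ _ _)); apply/bigmax_leqP_seq => m mP _.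
  by rewrite (leq_trans (size_scale_leq _ _)) // (mono m (hP m mP)).1.
rewrite coef_sum [in RHS](mpolyE P) raddf_sum /= big_seq [RHS]big_seq.
by apply: eq_bigr => m mP; rewrite coefZ mevalZ (mono m (hP m mP)).2.
Qed.

Lemma restr_coef1 P : (restr P)`_1 = \sum_i b 0 i * (P^`M(i)).@[a 0].
Proof.
have e0 Q : (restr Q)`_0 = Q.@[a 0].
  by rewrite -horner_coef0 restr_horner scale0r addr0.
elim/mpoly_alg_ind: P => [c|i|p q IHp IHq|p q IHp IHq].
- by rewrite restrC coefC big1 // => i _; rewrite mderivC meval0 mulr0.
- rewrite restrX coefD coefC coefZ coefX /= add0r mulr1 (bigD1 i) //= big1.
    by rewrite mderiv_var eqxx mevalC mulr1 addr0.
  by move=> j ji; rewrite mderiv_var eq_sym (negPf ji) mevalC mulr0.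
- rewrite restrD coefD IHp IHq -big_split; apply: eq_bigr => i _ /=.
  by rewrite mderivD mevalD mulrDr.
- rewrite restrM coefM !big_ord_recr big_ord0 /= add0r subn0 IHp IHq !e0.
  rewrite mulr_sumr mulr_suml -big_split; apply: eq_bigr => i _ /=.
  by rewrite mderivM mevalD !mevalM; ring.
Qed.

End Restriction.

Lemma size1_of_no_root (K : fieldType) (p : {poly K}) : p != 0 ->
  (forall (L : fieldType) (s : {rmorphism K -> L}) t, (map_poly s p).[t] != 0) ->
  size p = 1%N.
Proof.
move=> p0 nr; apply/eqP; rewrite eqn_leq size_poly_gt0 p0 andbT leqNgt.
apply/negP => /root_in_extension[L [s [z rz]]].
by move: (nr L s z); rewrite -rootE rz.
Qed.

(** Division by the greatest common divisor.  Coprimality is expressed by roots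
    in extensions, as these are the points of the line. *)
Lemma coprime_triple (K : fieldType) (p : 'I_3 -> {poly K}) : (exists k, p k != 0) ->
  exists (g : {poly K}) (T : 'I_3 -> {poly K}), [/\ g != 0, forall i, p i = g * T i &
    forall (L : fieldType) (s : {rmorphism K -> L}) t,
      exists i, (map_poly s (T i)).[t] != 0].
Proof.
case=> k pk; pose g := gcdp (gcdp (p 0) (p 1)) (p (inord 2)).
have gp i : g %| p i.
  move: i; apply: ord3P; rewrite /g ?dvdp_gcdr //;
  apply: dvdp_trans (dvdp_gcdl _ _) _; [exact: dvdp_gcdl | exact: dvdp_gcdr].
have g0 : g != 0 by apply: contraNneq pk => g0; have := gp k; rewrite g0 dvd0p.
pose T i := p i %/ g.
have eT i : p i = g * T i by rewrite mulrC divpK.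
exists g, T; split=> // L s t; apply: contrapT => h.
have rt i : root (map_poly s (T i)) t.
  by apply: contrapT => /negP nr; apply: h; exists i.
have : gcdp (gcdp (T 0) (T 1)) (T (inord 2)) %= 1.
  rewrite -(eqp_mul2l _ _ g0) mulr1.
  have eg : g = gcdp (gcdp (g * T 0) (g * T 1)) (g * T (inord 2)) by rewrite -!eT.
  rewrite eqp_sym [X in X %= _]eg.
  exact: eqp_trans (eqp_gcdl _ (gcdp_mul2l _ _ _)) (gcdp_mul2l _ _ _).
rewrite -size_poly_eq1 => /size_poly1P[u u0 eu].
have : root (map_poly s (gcdp (gcdp (T 0) (T 1)) (T (inord 2)))) t.
  by rewrite !gcdp_map !root_gcd !rt.
by rewrite eu map_polyC rootC fmorph_eq0 (negPf u0).
Qed.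

Lemma exists_annihilator (K : fieldType) n (v : 'I_n -> 'rV[K]_n.+1) : exists w : 'cV[K]_n.+1,
  w != 0 /\ forall i, v i *m w = 0.
Proof.
pose A : 'M[K]_(n, n.+1) := \matrix_i v i.
have : kermx A^T != 0.
  by rewrite -mxrank_eq0 mxrank_ker subn_eq0 -ltnNge ltnS mxrank_tr rank_leq_row.
rewrite -nz_row_eq0 => w0; exists (nz_row (kermx A^T))^T; split.
  by rewrite -(inj_eq (@trmx_inj _ _ _)) trmx0 trmxK.
move=> i; apply: (@trmx_inj _ _ _); rewrite trmx_mul trmxK trmx0.
have /sub_kermxP z := nz_row_sub (kermx A^T).
have -> : v i = row i A by rewrite rowK.
by rewrite tr_row colE mulmxA z mul0mx.
Qed.

(** * Isomorphisms between complements of finite sets in the plane *)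

Section PlaneIso.

Variable K : fieldType.
Hypothesis charK : [pchar K] =i pred0.
Variable c : 'I_6 -> 'rV[K]_3.
Hypothesis c_neq0 : forall i, c i != 0.
Variable tau : proj_map K 2 2.

(** Local coordinates of an isomorphism tau and of its inverse: the forms P give
    tau, and Q undoes P, wherever neither P nor Q(P) vanishes. *)
Definition local_rep d (P : 'I_3 -> {mpoly K[3]}) e (Q : 'I_3 -> {mpoly K[3]}) : Prop :=
  [/\ forall k, P k \is d.-homog, forall k, Q k \is e.-homog
    & forall (L : fieldType) (s : {rmorphism K -> L}) y, plane_minus c s y ->
      evalv P s y != 0 -> proj_eq (tau s y) (evalv P s y) /\
      (evalv Q s (evalv P s y) != 0 -> proj_eq y (evalv Q s (evalv P s y)))].

Hypothesis tau_local : forall (L : fieldType) (s : {rmorphism K -> L}) x,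
  plane_minus c s x -> exists d P e Q,
  [/\ local_rep d P e Q, evalv P s x != 0 & evalv Q s (evalv P s x) != 0].

Lemma generic_plane_minus : exists2 Z : {mpoly K[3]}, Z != 0 &
  forall x : 'rV[K]_3, Z.@[x 0] != 0 -> plane_minus c (idm K) x.
Proof.
have /choice[w hw] : forall i, exists w : 'cV[K]_3, w != 0 /\ c i *m w = 0.
  move=> i; have [w [w0 cw]] := exists_annihilator (fun _ : 'I_2 => c i).
  by exists w; split=> //; apply: cw ord0.
exists (\prod_i mlin (w i)).
  by apply/prodf_neq0 => i _; rewrite mlin_eq0; have [] := hw i.
move=> x; rewrite rmorph_prod => /prodf_neq0 nz0.
have nz i : (mlin (w i)).@[x 0] != 0 by apply: nz0.
split; first by apply: contraTneq (nz ord0) => ->; rewrite negbK meval_mlin mul0mx mxE.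
move=> i [_ [t t0 e]]; case/eqP: (nz i).
by rewrite meval_mlin e map_mx_idm -scalemxAl (hw i).2 scaler0 mxE.
Qed.

(** Both give tau at the general rational point. *)
Lemma local_rep_par d P e Q d' P' e' Q' :
  local_rep d P e Q -> local_rep d' P' e' Q' -> par P P'.
Proof.
have [Z Z0 hZ] := generic_plane_minus => -[_ _ hP] [_ _ hP'] i j.
apply/eqP; rewrite -subr_eq0; apply/eqP.
apply: (row_eq0_dense charK Z0) => x /hZ gx; rewrite mevalB !mevalM !meval_evalp.
have [Px|Px] := eqVneq (evalv P (idm K) x) 0.
  have z k : evalp (P k) (idm K) x = 0 by have /rowP/(_ k) := Px; rewrite !mxE.
  by rewrite !z !mul0r subrr.
have [Px'|Px'] := eqVneq (evalv P' (idm K) x) 0.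
  have z k : evalp (P' k) (idm K) x = 0 by have /rowP/(_ k) := Px'; rewrite !mxE.
  by rewrite !z !mulr0 subrr.
have [h _] := hP _ _ _ gx Px; have [h' _] := hP' _ _ _ gx Px'.
have := proj_eq_par (proj_eq_trans (proj_eq_sym h) h') i j.
by rewrite !mxE => ->; rewrite subrr.
Qed.

Lemma local_rep_inverse d P e Q k : local_rep d P e Q -> P k != 0 ->
  par (fun i => mcomp (Q i) P) (fun i => 'X_i).
Proof.
have [Z Z0 hZ] := generic_plane_minus => -[_ _ hP] Pk i j.
apply/eqP; rewrite -subr_eq0; apply/eqP.
apply: (row_eq0_dense charK (mulf_neq0 Z0 Pk)) => x.
rewrite mevalM mulf_eq0 negb_or => /andP[/hZ gx Pkx].
have Px : evalv P (idm K) x != 0.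
  by apply: contra Pkx => /eqP/rowP/(_ k); rewrite !mxE => /eqP.
have [_ h] := hP _ _ _ gx Px.
rewrite mevalB !mevalM !mevalXU !meval_evalp !evalp_mcomp.
set y := evalv P _ x in h *; have [Qy|Qy] := eqVneq (evalv Q (idm K) y) 0.
  have z l : evalp (Q l) (idm K) y = 0 by have /rowP/(_ l) := Qy; rewrite !mxE.
  by rewrite !z !mul0r subrr.
have := proj_eq_par (proj_eq_sym (h Qy)) i j.
by rewrite !mxE => ->; rewrite subrr.
Qed.

(** On a line avoiding the excluded points write P = g T with T coprime.  Near
    each point of the line P is a multiple of a local representation whose
    Jacobian does not vanish there, so the Jacobian of P and g^3 have the same
    zeros with multiplicities.  Comparing degrees, 3 (deg P - 1) = 3 deg g, so
    T is linear. *)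
Lemma line_image d P e Q (a b : 'rV[K]_3) : local_rep d P e Q ->
  ~~ (a <= b)%MS -> (forall i, ~~ (c i <= a + b)%MS) ->
  evalv P (idm K) a != 0 -> (jacdet P).@[b 0] != 0 ->
  exists (k : K) (g : {poly K}), [/\ k != 0, g.[0] = 1 & forall i,
    restr a b (P i) = g * ((P i).@[a 0]%:P + (k * (P i).@[b 0]) *: 'X)].
Proof.
move=> rP ab cab Pa Jb; have [hP _ _] := rP.
have on_good (L : fieldType) (s : {rmorphism K -> L}) t :
    plane_minus c s (map_mx s a + t *: map_mx s b).
  split=> [|i [_ [u u0 eu]]].
    apply: contra ab; rewrite addr_eq0 => /eqP e0.
    by rewrite -(map_submx s) e0 eqmx_opp scalemx_sub.
  have := cab i; rewrite -(map_submx s); case/negP.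
  have -> : map_mx s (c i) = u^-1 *: (map_mx s a + t *: map_mx s b).
    by rewrite eu scalerA mulVf // scale1r.
  rewrite scalemx_sub // map_addsmx addmx_sub_adds // scalemx_sub //.
case: d => [|d] in rP hP *.
  case/eqP: Jb; rewrite /jacdet (_ : jac P = 0) ?det0 ?meval0 //.
  by apply/matrixP => i j; rewrite !mxE (dhomog0_const (hP j)) mderivC.
pose p i := restr a b (P i); pose J := restr a b (jacdet P).
have J0 : J != 0.
  have [_ Jc] := restr_homog a b (dhomog_jacdet hP).
  by apply: contraNneq Jb => e0; rewrite -Jc -/J e0 coef0.
have sJ : size J = (d * 3).+1.
  have [sJ Jc] := restr_homog a b (dhomog_jacdet hP).
  apply/eqP; rewrite eqn_leq sJ ltnNge; apply: contra Jb => le.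
  by rewrite -Jc nth_default.
have [k0 _ Pk0] := evalv_neq0 Pa.
have [|g [T [g0 eT copT]]] := @coprime_triple _ p.
  exists k0; apply: contraNneq Pk0 => e0; rewrite -meval_evalp.
  by have := restr_horner a b (P k0) 0; rewrite -/(p k0) e0 horner0 scale0r addr0 => <-.
(* J and g^3 are shown to divide each other: their cofactors have no roots. *)
pose D := gcdp J (g ^+ 3).
have g30 : g ^+ 3 != 0 by rewrite expf_neq0.
have D0 : D != 0 by rewrite gcdp_eq0 negb_and J0.
pose u := J %/ D; pose v := g ^+ 3 %/ D.
have eJ : J = D * u by rewrite mulrC divpK // dvdp_gcdl.
have eg : g ^+ 3 = D * v by rewrite mulrC divpK // dvdp_gcdr.
have u0 : u != 0 by apply: contraNneq J0 => z; rewrite eJ z mulr0.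
have v0 : v != 0 by apply: contraNneq g30 => z; rewrite eg z mulr0.
have copuv : coprimep u v by apply: coprimep_div_gcd; rewrite J0.
have uv (L : fieldType) (s : {rmorphism K -> L}) t :
    (map_poly s u).[t] != 0 /\ (map_poly s v).[t] != 0.
  have gx := on_good L s t; set x := _ + _ in gx.
  have [d' [P' [e' [Q' [rP' Px' Qx']]]]] := tau_local gx.
  have [hP' _ _] := rP'.
  have [j Pj' Pjx'] := evalv_neq0 Px'.
  have x0 : x != 0 by case: gx.
  have [d'0 Jx'] := jacdet_inverse charK hP' x0 Px' Qx' (local_rep_inverse rP' Pj').
  have PP' := local_rep_par rP rP'.
  have := congr1 (restr a b) (jacdet_par charK j (ltn0Sn d) d'0 hP hP' PP').
  have restr3 m q r : restr a b (m%:R * (q ^+ 3 * r)) = m%:R * (restr a b q ^+ 3 * restr a b r).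
    by rewrite restrM restr_nat restrM restrXn.
  rewrite !restr3 -/J -/(p j) eT exprMn eJ eg.
  set h' := restr a b (P' j); set J' := restr a b (jacdet P') => eq1.
  have eq2 : d'%:R * (h' ^+ 3 * u) = d.+1%:R * (v * T j ^+ 3 * J').
    apply: (mulfI D0); transitivity (d'%:R * (h' ^+ 3 * (D * u))); first by ring.
    by rewrite eq1; ring.
  pose ev q := (map_poly s q).[t].
  have evM q r : ev (q * r) = ev q * ev r by rewrite /ev rmorphM hornerM.
  have ev3 q : ev (q ^+ 3) = ev q ^+ 3 by rewrite /ev rmorphXn horner_exp.
  have evn m : ev m%:R = m%:R by rewrite /ev rmorph_nat -polyC_natr hornerC.
  have eq3 : d'%:R * (evalp (P' j) s x ^+ 3 * ev u)
      = d.+1%:R * (ev v * ev (T j) ^+ 3 * evalp (jacdet P') s x).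
    by rewrite -!restr_eval -/h' -/J' -!/(ev _) -(evn d') -(evn d.+1) -!ev3 -!evM eq2.
  have Tj : (map_poly s (T j)).[t] != 0.
    have [i Ti] := copT L s t; apply: contra Ti => /eqP Tj.
    have := congr1 (restr a b) (PP' j i); rewrite !restrM -/(p j) -/(p i) !eT -!mulrA.
    move/(mulfI g0)/(congr1 (fun q => (map_poly s q).[t])).
    rewrite /= !rmorphM !hornerM Tj mul0r !restr_eval -/x => /esym/eqP.
    by rewrite mulf_eq0 (negPf Pjx') orbF.
  have iff0 : ((map_poly s u).[t] == 0) = ((map_poly s v).[t] == 0).
    have nd := pchar_extension charK s (ltn0Sn d).
    have nd' := pchar_extension charK s d'0.
    have := congr1 (fun z => z == 0) eq3; rewrite /= !mulf_eq0 ?expf_eq0 /= /ev.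
    by rewrite (negPf nd) (negPf nd') (negPf Pjx') (negPf Tj) (negPf Jx') /= !orbF.
  have nuv : ~~ (((map_poly s u).[t] == 0) && ((map_poly s v).[t] == 0)).
    apply/negP; rewrite -!rootE -root_gcd.
    have : coprimep (map_poly s u) (map_poly s v) by rewrite coprimep_map.
    rewrite /coprimep => /size_poly1P[w w0 ->]; by rewrite rootC (negPf w0).
  by rewrite iff0 in nuv *; rewrite andbb in nuv.
have su : size u = 1%N by apply: size1_of_no_root => // L s t; have [] := uv L s t.
have sv : size v = 1%N by apply: size1_of_no_root => // L s t; have [] := uv L s t.
have sg : size g = d.+1.
  have := size_exp g 3; rewrite eg size_mul // sv.
  move: sJ; rewrite eJ size_mul // su !addn1 /= => ->.
  move=> /= /eqP; rewrite eqn_pmul2r // => /eqP ->.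
  by rewrite prednK // size_poly_gt0.
have sT i : (size (T i) <= 2)%N.
  have [->|Ti0] := eqVneq (T i) 0; first by rewrite size_poly0.
  have [sp _] := restr_homog a b (hP i).
  by move: sp; rewrite -/(p i) eT size_mul // sg addSn /= -[d.+2]addn2 leq_add2l.
have eTi i : T i = ((T i)`_0)%:P + (T i)`_1 *: 'X.
  apply/polyP => -[|[|l]]; rewrite !coefE /= ?mulr0 ?mulr1 ?addr0 ?add0r //.
  by rewrite nth_default // (leq_trans (sT i)).
have Pai i : (P i).@[a 0] = g.[0] * (T i)`_0.
  have := restr_horner a b (P i) 0; rewrite scale0r addr0 -/(p i) eT => <-.
  by rewrite hornerM !horner_coef0.
have Pbi i : (P i).@[b 0] = lead_coef g * (T i)`_1.
  have [_ <-] := restr_homog a b (hP i); rewrite -/(p i) eT {1}eTi mulrDr coefD.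
  rewrite coefMC -scalerAr coefZ coefMX /= nth_default ?sg // mul0r add0r.
  by rewrite lead_coefE sg mulrC.
have g00 : g.[0] != 0.
  by apply: contraNneq Pk0 => z; rewrite -meval_evalp Pai z mul0r.
have lg : lead_coef g != 0 by rewrite lead_coef_eq0.
exists (g.[0] / lead_coef g), (g.[0]^-1 *: g); split.
- by rewrite mulf_neq0 ?invr_eq0.
- by rewrite hornerZ mulVf.
move=> i; rewrite Pai Pbi -/(p i) eT {1}eTi -scalerAl scalerAr; congr (_ * _).
rewrite scalerDr scalerA -[_ *: _%:P]mul_polyC -polyCM !mulrA mulVf // mul1r.
by congr (_ + _ *: _); field; rewrite ?g00 ?lg.
Qed.

Let Pv (P : 'I_3 -> {mpoly K[3]}) (x : 'rV[K]_3) : 'rV[K]_3 := \row_i (P i).@[x 0].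

Lemma good_line (a b : 'rV[K]_3) (w : 'I_6 -> 'cV[K]_3) : plane_minus c (idm K) a ->
  (forall i, a *m w i = 0) -> (forall i, c i *m w i = 0) -> (forall i, b *m w i != 0) ->
  ~~ (a <= b)%MS /\ forall i, ~~ (c i <= a + b)%MS.
Proof.
move=> [a0 ac] aw cw bw; split.
  apply: contra a0 => /sub_rVP[t et]; have := aw 0; rewrite et -scalemxAl => /eqP.
  by rewrite scalemx_eq0 (negPf (bw 0)) orbF => /eqP ->; rewrite scale0r.
move=> i; apply/negP => /sub_addsmxP[[u v] /= ec].
rewrite [u]mx11_scalar [v]mx11_scalar !mul_scalar_mx in ec.
have := cw i; rewrite ec mulmxDl -!scalemxAl aw scaler0 add0r => /eqP.
rewrite scalemx_eq0 (negPf (bw i)) orbF => /eqP v0.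
rewrite v0 scale0r addr0 in ec.
have u0 : u 0 0 != 0 by apply: contra (c_neq0 i) => /eqP u0; rewrite ec u0 scale0r.
apply: (ac i); rewrite map_mx_idm; split=> //; exists (u 0 0)^-1; first by rewrite invr_eq0.
by rewrite ec scalerA mulVf // scale1r.
Qed.

(** Off the lines that join a0 to the excluded points, any a1 and a2 give lines
    to which line_image applies; a2 is moreover kept off the line of a0 and a1. *)
Lemma exists_frame (J : {mpoly K[3]}) : J != 0 -> exists a0 a1 a2 : 'rV[K]_3,
  [/\ [/\ J.@[a0 0] != 0, J.@[a1 0] != 0 & J.@[a2 0] != 0],
      rows3 a0 a1 a2 \in unitmx,
      ~~ (a0 <= a1)%MS /\ (forall i, ~~ (c i <= a0 + a1)%MS)
    & ~~ (a0 <= a2)%MS /\ (forall i, ~~ (c i <= a0 + a2)%MS)].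
Proof.
move=> J0; have [Z Z0 hZ] := generic_plane_minus.
have [a0] := row_nonvanishing charK (mulf_neq0 Z0 J0).
rewrite mevalM mulf_eq0 negb_or => /andP[/hZ ga0 Ja0].
have /choice[w hw] : forall i, exists w : 'cV[K]_3, [/\ w != 0, a0 *m w = 0 & c i *m w = 0].
  move=> i; have [w [w0 cw]] := exists_annihilator (fun k : 'I_2 => if k == 0 then a0 else c i).
  by exists w; split=> //; [apply: (cw 0) | apply: (cw 1)].
have w0 i : w i != 0 by have [] := hw i.
have aw i : a0 *m w i = 0 by have [] := hw i.
have cw i : c i *m w i = 0 by have [] := hw i.
have nJ : ~ vanish_on (1%:M : 'M[K]_3) J.
  move=> van; case/eqP: J0; apply: (@row_eq0_dense _ charK _ 1) => [|x _].
    exact: oner_neq0.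
  by apply: van; rewrite submx1.
pose ws := [seq w i | i <- enum 'I_6].
have inws i : w i \in ws by apply: map_f; rewrite mem_enum.
have [|a1 [_ Ja1 a1w]] := @generic_point K charK _ _ 1%:M ws J _ nJ.
  by move=> _ /mapP[i _ ->]; rewrite mul1mx.
have [v [v0 av]] := exists_annihilator (fun k : 'I_2 => if k == 0 then a0 else a1).
have a0v := av 0; have a1v := av 1; rewrite /= in a0v a1v.
have [|a2 [_ Ja2 a2w]] := @generic_point K charK _ _ 1%:M (v :: ws) J _ nJ.
  by move=> u; rewrite inE mul1mx => /orP[/eqP ->//|/mapP[i _ ->]].
exists a0, a1, a2; split=> //.
- rewrite unitmxE unitfE; apply/negP => /det0P[u u0]; rewrite [u]vec3_eta vec3_rows3.
  set x := u 0 0; set y := u 0 1; set z := u 0 (inord 2) => e.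
  have nsc (t : K) (b : 'rV[K]_3) (r : 'cV[K]_3) : b *m r != 0 -> t *: b *m r = 0 -> t = 0.
    by rewrite -scalemxAl => br /eqP; rewrite scalemx_eq0 (negPf br) orbF => /eqP.
  have z0 : z = 0.
    apply: (nsc _ a2 v); first by apply: a2w; rewrite mem_head.
    have := congr1 (mulmx^~ v) e.
    by rewrite /= !mulmxDl mul0mx -!scalemxAl a0v a1v !scaler0 !add0r.
  have y0 : y = 0.
    apply: (nsc _ a1 (w 0)); first exact: a1w.
    have := congr1 (mulmx^~ (w 0)) e.
    by rewrite /= !mulmxDl mul0mx -!scalemxAl aw z0 scale0r addr0 scaler0 add0r.
  have x0 : x = 0.
    apply/eqP; move/eqP: e; rewrite y0 z0 !scale0r !addr0 scalemx_eq0.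
    by have [/negPf -> _] := ga0; rewrite orbF.
  case/eqP: u0; rewrite [u]vec3_eta -/x -/y -/z x0 y0 z0.
  by apply/rowP; apply: ord3P; rewrite vec3E mxE.
- by apply: (@good_line a0 a1 w) => // i; apply: a1w.
- by apply: (@good_line a0 a2 w) => // i; apply: a2w; rewrite inE inws orbT.
Qed.

Lemma affine_eq0 (Z : {poly K}) (x y : K) : Z != 0 ->
  (forall t, Z.[t] != 0 -> t * x = y) -> x = 0 /\ y = 0.
Proof.
move=> Z0 h; have e : x *: 'X - y%:P = 0.
  apply: (poly_eq0_dense charK Z0) => t /h <-.
  by rewrite !hornerE mulrC subrr.
have := congr1 (fun q : {poly K} => q`_0) e; have := congr1 (fun q : {poly K} => q`_1) e.
by rewrite !coefE /= subr0 mulr1 mulr0 sub0r => -> /eqP; rewrite oppr_eq0 => /eqP.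
Qed.

Lemma evalv_Pv P x : evalv P (idm K) x = Pv P x.
Proof. by apply/rowP => i; rewrite !mxE. Qed.

Lemma Pv_line (P : 'I_3 -> {mpoly K[3]}) a b (k : K) (g : {poly K}) t :
  (forall i, restr a b (P i) = g * ((P i).@[a 0]%:P + (k * (P i).@[b 0]) *: 'X)) ->
  Pv P (a + t *: b) = g.[t] *: (Pv P a + (k * t) *: Pv P b).
Proof.
move=> h; apply/rowP => i; rewrite !mxE -restr_horner h !hornerE; ring.
Qed.

Lemma Pv_homogZ d (P : 'I_3 -> {mpoly K[3]}) t x : (forall i, P i \is d.-homog) ->
  Pv P (t *: x) = t ^+ d *: Pv P x.
Proof. by move=> hP; rewrite -!evalv_Pv (evalv_homogZ _ _ _ hP). Qed.

(** Up to an invertible triangular matrix, the differential of P at a0 maps the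
    frame to these three vectors; it is invertible because the Jacobian of P
    does not vanish at a0. *)
Lemma image_frame_unit d (P : 'I_3 -> {mpoly K[3]}) (a0 a1 a2 : 'rV[K]_3) k1 k2 g1 g2 :
  (0 < d)%N -> (forall i, P i \is d.-homog) -> (jacdet P).@[a0 0] != 0 ->
  rows3 a0 a1 a2 \in unitmx -> g1.[0] = 1 -> g2.[0] = 1 ->
  (forall i, restr a0 a1 (P i) = g1 * ((P i).@[a0 0]%:P + (k1 * (P i).@[a1 0]) *: 'X)) ->
  (forall i, restr a0 a2 (P i) = g2 * ((P i).@[a0 0]%:P + (k2 * (P i).@[a2 0]) *: 'X)) ->
  rows3 (Pv P a0) (k1 *: Pv P a1) (k2 *: Pv P a2) \in unitmx.
Proof.
move=> d0 hP Ja0 ua g10 g20 h1 h2.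
pose N : 'M[K]_3 := \matrix_(i, j) (P j)^`M(i).@[a0 0].
have dN : \det N = (jacdet P).@[a0 0].
  by rewrite meval_evalp evalp_jacdet; congr (\det _); apply/matrixP => i j; rewrite !mxE.
have line b k g : g.[0] = 1 ->
    (forall i, restr a0 b (P i) = g * ((P i).@[a0 0]%:P + (k * (P i).@[b 0]) *: 'X)) ->
    b *m N = g`_1 *: Pv P a0 + k *: Pv P b.
  rewrite horner_coef0 => g0 h; apply/rowP => j; rewrite !mxE.
  transitivity (restr a0 b (P j))`_1.
    by rewrite restr_coef1; apply: eq_bigr => i _; rewrite mxE.
  rewrite h coefM !big_ord_recr big_ord0 /= add0r.
  by rewrite !coefE /= !(mulr0, mulr1, add0r, addr0) g0 mul1r addrC.
have e0 : a0 *m N = d%:R *: Pv P a0.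
  apply/rowP => j; rewrite !mxE mulr_natl.
  have := congr1 (fun q => q.@[a0 0]) (euler (hP j)).
  rewrite /= raddf_sum mevalMn => <-; apply: eq_bigr => i _ /=.
  by rewrite mxE mevalM mevalXU.
pose A := rows3 (Pv P a0) (k1 *: Pv P a1) (k2 *: Pv P a2).
have : rows3 a0 a1 a2 *m N = rows3 (vec3 d%:R 0 0) (vec3 g1`_1 1 0) (vec3 g2`_1 0 1) *m A.
  rewrite !rows3_mul !vec3_rows3 e0 (line a1 k1 g1) // (line a2 k2 g2) //.
  by rewrite !scale0r !scale1r !addr0.
move/(congr1 determinant); rewrite !det_mulmx dN => /(congr1 (fun z => z != 0)).
rewrite /= !mulf_eq0 !negb_or Ja0 -unitfE -unitmxE ua /= => /esym/andP[_].
by rewrite -unitfE -unitmxE.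
Qed.

(** In the coordinates of the two frames, tau fixes the points (1 : s : 0) and
    (1 : 0 : r), by the normalization of g and k in line_image; since it maps
    the line that joins them to a line, it maps this line to itself.  A general
    point u lies on many such lines, so it is fixed as well. *)
Lemma frame_par d (P : 'I_3 -> {mpoly K[3]}) e Q k (a0 a1 a2 : 'rV[K]_3) k1 k2 g1 g2
    (A := rows3 (Pv P a0) (k1 *: Pv P a1) (k2 *: Pv P a2)) (M := rows3 a0 a1 a2) :
  local_rep d P e Q -> (P k).@[a0 0] != 0 -> (jacdet P).@[a0 0] != 0 ->
  M \in unitmx -> A \in unitmx ->
  (forall i, restr a0 a1 (P i) = g1 * ((P i).@[a0 0]%:P + (k1 * (P i).@[a1 0]) *: 'X)) ->
  (forall i, restr a0 a2 (P i) = g2 * ((P i).@[a0 0]%:P + (k2 * (P i).@[a2 0]) *: 'X)) ->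
  forall u : 'rV[K]_3, u 0 0 != 0 -> u 0 1 != 0 -> u 0 (inord 2) != 0 ->
  plane_minus c (idm K) (u *m M) -> exists t, Pv P (u *m M) = t *: (u *m A).
Proof.
move=> rP Pk0 Ja0 uM uA h1 h2 u u0 u1 u2 [uM0 uMc]; have [hP _ _] := rP.
pose x := u 0 0; pose y := u 0 1; pose z := u 0 (inord 2).
rewrite -/x -/y -/z in u0 u1 u2.
have eu : u = vec3 x y z by exact: vec3_eta.
case: d => [|d] in rP hP.
  case/eqP: Ja0; rewrite /jacdet (_ : jac P = 0) ?det0 ?meval0 //.
  by apply/matrixP => i j; rewrite !mxE (dhomog0_const (hP j)) mderivC.
pose w := Pv P (u *m M) *m invmx A.
have eP : Pv P (u *m M) = w *m A by rewrite /w mulmxKV.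
pose cc i := c i *m invmx M.
have ec i : c i = cc i *m M by rewrite /cc mulmxKV.
(* A line through u joins (1 : l y : 0) and (1 : 0 : l z / t), t = l x - 1.  It
   passes through c_i when l n1_i = n2_i; the roots of Z are these values of l
   and those for which the two points or their images are not general. *)
pose n1 i := cc i 0 0 * y * z - cc i 0 (inord 2) * y * x.
pose n2 i := cc i 0 1 * z - cc i 0 (inord 2) * y.
pose Z1 := restr (- a0) (x *: a0 + z *: a2) (jacdet P).
pose Z2 := restr a0 (y *: a1) (P k).
pose Z := 'X * (x *: 'X - 1) * Z1 * Z2 * \prod_i (n1 i *: 'X - (n2 i)%:P).
have Z0 : Z != 0.
  have lin0 (p q : K) : p != 0 \/ q != 0 -> p *: 'X - q%:P != 0.
    case=> [p0|q0]; apply/eqP => /polyP.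
      by move/(_ 1%N); rewrite !coefE /= subr0 mulr1; apply/eqP.
    by move/(_ 0%N); rewrite !coefE /= mulr0 sub0r; apply/eqP; rewrite oppr_eq0.
  rewrite /Z !mulf_neq0 ?polyX_eq0 //.
  - by apply: lin0; left.
  - apply: contraNneq Ja0 => e1; have := restr_horner (- a0) (x *: a0 + z *: a2) (jacdet P) 0.
    rewrite -/Z1 e1 horner0 scale0r addr0 -scaleN1r !meval_evalp.
    rewrite (evalp_homogZ _ _ _ (dhomog_jacdet hP)) => /esym/eqP.
    by rewrite mulf_eq0 expf_eq0 oppr_eq0 oner_eq0 andbF.
  - apply: contraNneq Pk0 => e1; have := restr_horner a0 (y *: a1) (P k) 0.
    by rewrite -/Z2 e1 horner0 scale0r addr0 => <-.
  apply/prodf_neq0 => i _; apply: lin0.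
  have [n10|] := eqVneq (n1 i) 0; last by left.
  have [n20|] := eqVneq (n2 i) 0; last by right.
  have cz : cc i 0 (inord 2) != 0.
    apply: contra (c_neq0 i) => /eqP c2.
    move/eqP: n10; rewrite /n1 c2 !mul0r subr0 !mulf_eq0 (negPf u1) (negPf u2) !orbF => /eqP c0.
    move/eqP: n20; rewrite /n2 c2 !mul0r subr0 !mulf_eq0 (negPf u2) !orbF => /eqP c1.
    by rewrite ec [cc i]vec3_eta c0 c1 c2 vec3_rows3 !scale0r !addr0.
  case: (uMc i); rewrite map_mx_idm; split; first exact: c_neq0.
  exists (z / cc i 0 (inord 2)); first by rewrite mulf_neq0 ?invr_eq0.
  rewrite (ec i) scalemxAl; congr (_ *m _); rewrite eu [cc i]vec3_eta; apply/rowP.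
  move/subr0_eq: n10; move/subr0_eq: n20 => n20 n10.
  have n10' : cc i 0 0 * z = cc i 0 (inord 2) * x.
    by apply: (mulIf u1); rewrite /= mulrAC n10 mulrAC.
  apply: ord3P; rewrite [RHS]mxE !vec3E.
  - by apply: (mulIf cz); rewrite /= mulrAC divfK // mulrC -n10' mulrC.
  - by apply: (mulIf cz); rewrite /= mulrAC divfK // mulrC -n20 mulrC.
  - by rewrite divfK.
have [e1 e2] : w 0 0 * y * z - w 0 (inord 2) * y * x = 0 /\ w 0 1 * z - w 0 (inord 2) * y = 0.
  apply: (affine_eq0 Z0) => l.
  rewrite /Z !hornerM hornerX horner_prod !mulf_eq0 !negb_or.
  move=> /andP[/andP[/andP[/andP[l0 t0] zl1] zl2] zl3].
  have {}t0 : l * x - 1 != 0 by move: t0; rewrite !hornerE mulrC.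
  pose t := l * x - 1; rewrite -/t in t0; pose s := l * y; pose r := l * z / t.
  pose p := vec3 1 s 0; pose q := vec3 1 0 r.
  have pM : p *m M = a0 + s *: a1 by rewrite vec3_rows3 scale1r scale0r addr0.
  have qM : q *m M = a0 + r *: a2 by rewrite vec3_rows3 scale1r scale0r addr0.
  have pq : p + t *: q = l *: u.
    rewrite eu; apply/rowP; apply: ord3P; rewrite [LHS]mxE [X in _ + X]mxE [RHS]mxE !vec3E.
    - by rewrite /t; ring.
    - by rewrite /s; ring.
    - by rewrite /r; field.
  pose v : 'cV[K]_3 := (vec3 (s * r) (- r) (- s))^T.
  have vE (b : 'rV[K]_3) : (b *m v) 0 0 = b 0 0 * (s * r) - b 0 1 * r - b 0 (inord 2) * s.
    have v3 i : v i 0 = vec3 (s * r) (- r) (- s) 0 i by rewrite /v mxE.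
    by rewrite mxE sum3 !v3 !vec3E !mulrN.
  have pv : (p *m v) 0 0 = 0 by rewrite vE !vec3E; ring.
  have qv : (q *m v) 0 0 = 0 by rewrite vE !vec3E; ring.
  have s0 : s != 0 by rewrite mulf_neq0.
  have Pp : evalv P (idm K) (p *m M) != 0.
    apply: contra zl2 => /eqP/rowP/(_ k); rewrite !mxE => Pp.
    by rewrite restr_horner meval_evalp scalerA -pM Pp.
  have Jq : (jacdet P).@[(q *m M) 0] != 0.
    apply: contra zl1 => /eqP Jq; rewrite restr_horner.
    have -> : - a0 + l *: (x *: a0 + z *: a2) = t *: (q *m M).
      rewrite qM scalerDr !scalerA scalerDr !scalerA addrA; congr (_ + _ *: _).
        by rewrite /t scalerBl scale1r addrC.
      by rewrite /r; field.
    rewrite meval_evalp (evalp_homogZ _ _ _ (dhomog_jacdet hP)) -meval_evalp Jq.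
    by rewrite mulr0.
  have pqM : ~~ (p *m M <= q *m M)%MS.
    apply/negP => /sub_rVP[b]; rewrite scalemxAl => /(can_inj (mulmxK uM)) /rowP epq.
    by have := epq 1; rewrite [RHS]mxE !vec3E mulr0; apply/eqP.
  have cpq i : ~~ (c i <= p *m M + q *m M)%MS.
    apply/negP => /sub_addsmxP[[b b'] /= ec'].
    have ecc : cc i = b *m p + b' *m q by rewrite /cc ec' mulmxDl !mulmxA !mulmxK.
    have ccv : (cc i *m v) 0 0 = 0.
      have z0 (b1 : 'rV[K]_3) : (b1 *m v) 0 0 = 0 -> b1 *m v = 0.
        by move=> bv; apply/rowP => l1; rewrite !ord1 bv mxE.
      by rewrite ecc mulmxDl -!mulmxA (z0 p pv) (z0 q qv) !mulmx0 addr0 mxE.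
    have /prodf_neq0/(_ i isT) := zl3; rewrite !hornerE.
    move/eqP; apply; move: ccv; rewrite vE /n1 /n2 /s /r => ccv.
    transitivity (t / l * (cc i 0 0 * (l * y * (l * z / t)) - cc i 0 1 * (l * z / t)
       - cc i 0 (inord 2) * (l * y))); last by rewrite ccv mulr0.
    by rewrite /t; field; rewrite -/t ?l0 ?t0.
  have [m [g [_ _ hg]]] := line_image rP pqM cpq Pp Jq.
  have := Pv_line t hg.
  rewrite scalemxAl -mulmxDl pq -scalemxAl (Pv_homogZ _ _ hP).
  have -> : Pv P (p *m M) = g1.[s] *: (p *m A).
    by rewrite pM (Pv_line s h1) vec3_rows3 scale1r scale0r addr0 scalerA (mulrC k1).
  have -> : Pv P (q *m M) = g2.[r] *: (q *m A).
    by rewrite qM (Pv_line r h2) vec3_rows3 scale1r scale0r addr0 scalerA (mulrC k2).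
  rewrite eP !scalemxAl -mulmxDl scalemxAl => /(can_inj (mulmxK uA)).
  have pv0 : p *m v = 0 by apply/rowP => l1; rewrite !ord1 pv mxE.
  have qv0 : q *m v = 0 by apply/rowP => l1; rewrite !ord1 qv mxE.
  move=> /(congr1 (mulmx^~ v)); rewrite /= -!scalemxAl mulmxDl -!scalemxAl pv0 qv0.
  rewrite !scaler0 addr0 scaler0 => /eqP; rewrite scalemx_eq0 expf_eq0 (negPf l0) andbF /=.
  move=> /eqP wv; have := vE w; rewrite wv [LHS]mxE /r /s => wv0.
  apply/eqP; rewrite -subr_eq0; apply/eqP.
  transitivity (t / l * (w 0 0 * (l * y * (l * z / t)) - w 0 1 * (l * z / t)
       - w 0 (inord 2) * (l * y))); last by rewrite -wv0 mulr0.
  by rewrite /t; field; rewrite -/t ?l0 ?t0.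
have ew : w = (w 0 (inord 2) / z) *: u.
  rewrite {1}[w]vec3_eta eu; apply/rowP; move/subr0_eq: e1; move/subr0_eq: e2 => e2 e1.
  have e1' : w 0 0 * z = w 0 (inord 2) * x.
    by apply: (mulIf u1); rewrite /= mulrAC e1 mulrAC.
  apply: ord3P; rewrite [RHS]mxE !vec3E.
  - by apply: (mulIf u2); rewrite /= e1'; field.
  - by apply: (mulIf u2); rewrite /= e2; field.
  - by field.
exists (w 0 (inord 2) / z).
by rewrite eP {1}ew -scalemxAl.
Qed.

(** By line_image, tau is linear on the lines that avoid the excluded points;
    by frame_par such a map is determined by the images of a frame. *)
Theorem plane_iso_linear : exists A : 'M[K]_3, A \in unitmx /\
  forall (L : fieldType) (s : {rmorphism K -> L}) y, plane_minus c s y ->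
    proj_eq (tau s y) (y *m map_mx s A).
Proof.
have [Z Z0 hZ] := generic_plane_minus.
have [x0 /hZ gx0] := row_nonvanishing charK Z0.
have [d [P [e [Q [rP Px0 Qx0]]]]] := tau_local gx0.
have [hP _ _] := rP; have [k Pk _] := evalv_neq0 Px0.
have [x0n0 _] := gx0.
have [d0 Jx0] := jacdet_inverse charK hP x0n0 Px0 Qx0 (local_rep_inverse rP Pk).
have J0 : jacdet P != 0 by apply: contraNneq Jx0 => ->; rewrite evalp0.
have [a0 [a1 [a2 [[Ja0 Ja1 Ja2] uM [n1 good1] [n2 good2]]]]] := exists_frame (mulf_neq0 Pk J0).
move: Ja0 Ja1 Ja2; rewrite !mevalM !mulf_eq0 !negb_or.
move=> /andP[Pk0 Ja0] /andP[Pk1 Ja1] /andP[Pk2 Ja2].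
have Pa0 : evalv P (idm K) a0 != 0.
  by apply: contra Pk0 => /eqP/rowP/(_ k); rewrite !mxE => /eqP.
have [k1 [g1 [k10 g10 h1]]] := line_image rP n1 good1 Pa0 Ja1.
have [k2 [g2 [k20 g20 h2]]] := line_image rP n2 good2 Pa0 Ja2.
pose M := rows3 a0 a1 a2; pose A := rows3 (Pv P a0) (k1 *: Pv P a1) (k2 *: Pv P a2).
have uA : A \in unitmx by apply: (image_frame_unit d0 hP Ja0 uM g10 g20 h1 h2).
pose B := invmx M *m A; have uB : B \in unitmx by rewrite unitmx_mul unitmx_inv uM.
have parB : par P (fun i => mlin (col i B)).
  move=> i j; apply/eqP; rewrite -subr_eq0; apply/eqP.
  pose l (i : 'I_3) := mlin (col i (invmx M)).
  have l0 i' : l i' != 0.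
    rewrite mlin_eq0; apply/eqP => z.
    have := congr1 (mulmx M) z; rewrite -col_mulmx mulmxV // mulmx0.
    by move/colP/(_ i'); rewrite !mxE eqxx => /eqP; rewrite oner_eq0.
  have Zl0 : Z * l 0 * l 1 * l (inord 2) != 0 by rewrite !mulf_neq0.
  apply: (row_eq0_dense charK Zl0) => x; rewrite !mevalM !mulf_eq0 !negb_or.
  move=> /andP[/andP[/andP[/hZ gx lx0] lx1] lx2].
  pose u := x *m invmx M.
  have lu i' : (l i').@[x 0] = u 0 i' by rewrite meval_mlin -col_mulmx mxE.
  have uMx : u *m M = x by rewrite mulmxKV.
  rewrite !lu in lx0 lx1 lx2.
  have [|t et] := frame_par rP Pk0 Ja0 uM uA h1 h2 lx0 lx1 lx2; first by rewrite uMx.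
  rewrite uMx in et; rewrite mevalB !mevalM !meval_mlin.
  have Pi i' : (P i').@[x 0] = t * (x *m B) 0 i'.
    have := congr1 (fun b : 'rV[K]_3 => b 0 i') et; rewrite [LHS]mxE [RHS]mxE => ->.
    by rewrite /B mulmxA.
  by rewrite -!col_mulmx ![col _ _ _ _]mxE !Pi; ring.
exists B; split=> // L s y gy.
have [d' [P' [e' [Q' [rP' Py _]]]]] := tau_local gy.
have PP' := local_rep_par rP rP'.
have parP' := par_trans Pk PP' parB.
have [_ _ hP'] := rP'; have [h _] := hP' _ _ _ gy Py.
apply: (proj_eq_trans h); apply: par_proj_eq => //.
  have uB' : map_mx s B \in unitmx by rewrite map_unitmx.
  apply/eqP => z; have [] := gy; rewrite -(mulmxK uB' y) z mul0mx eqxx //.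
move=> i j; have := congr1 (fun q => evalp q s y) (parP' i j).
rewrite /= !evalpM !evalp_mlin !map_col -!col_mulmx.
by rewrite ![col _ _ _ _]mxE ![evalv _ _ _ _ _]mxE.
Qed.

End PlaneIso.

(** * Lines and planes of projective space *)

Lemma mul_row_mx_eq0 (F : fieldType) m n p1 p2 (A : 'M[F]_(m, n)) (B : 'M_(n, p1))
    (C : 'M_(n, p2)) : A *m row_mx B C = 0 <-> A *m B = 0 /\ A *m C = 0.
Proof.
rewrite mul_mx_row; split=> [e|[-> ->]]; last exact: row_mx0.
by apply: eq_row_mx; rewrite e row_mx0.
Qed.

Section Lines.

Variable K : fieldType.
Implicit Types (l : 'M[K]_(2, 4)) (h : 'cV[K]_4).

Lemma skew_inj l l' m (A : 'M[K]_(4, m)) : \rank l = 2%N -> \rank l' = 2%N ->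
  skew l l' -> l *m A = 0 -> l' *m A = 0 -> A = 0.
Proof.
move=> rl rl' /eqmxP sk /sub_kermxP kl /sub_kermxP kl'.
have := mxrank_sum_cap l l'; rewrite rl rl' sk mxrank0 addn0 => rk.
have full : row_full (l + l')%MS by rewrite /row_full rk.
have := submx_trans (submx_full 1%:M full) (_ : (l + l' <= kermx A)%MS).
by rewrite addsmx_sub kl kl' => /(_ isT)/sub_kermxP; rewrite mul1mx.
Qed.

Lemma meetsP l l' :
  meets l l' <-> exists x : 'rV[K]_4, [/\ x != 0, (x <= l)%MS & (x <= l')%MS].
Proof.
split=> [nsk|[x [x0 xl xl']]].
  exists (nz_row (l :&: l')%MS).
  have := nz_row_sub (l :&: l')%MS; rewrite sub_capmx => /andP[-> ->].
  rewrite nz_row_eq0; split=> //; apply: contra nsk => /eqP z.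
  by rewrite /skew z; apply/eqmxP.
apply/negP => /eqmxP sk; have : (x <= l :&: l')%MS by rewrite sub_capmx xl.
by rewrite sk submx0; apply/negP.
Qed.

Lemma skewP l l' (x : 'rV[K]_4) : skew l l' -> (x <= l)%MS -> (x <= l')%MS -> x = 0.
Proof.
move=> sk xl xl'; apply/eqP; apply: contraTT sk => x0.
by apply/(meetsP l l'); exists x.
Qed.

Lemma meets_eqmx l1 l2 l : (l1 == l2)%MS -> meets l1 l = meets l2 l.
Proof.
move=> /eqmxP e; apply/idP/idP => /meetsP[x [x0 xl xl']]; apply/meetsP; exists x;
  by rewrite ?e // -?e.
Qed.

Lemma skew_extension l l' (L : fieldType) (s : {rmorphism K -> L}) (x : 'rV[L]_4) :
  skew l l' -> (x <= map_mx s l)%MS -> (x <= map_mx s l')%MS -> x = 0.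
Proof.
move=> /eqmxP sk xl xl'; apply/eqP; rewrite -submx0.
have : (x <= map_mx s (l :&: l')%MS)%MS by rewrite map_capmx sub_capmx xl.
by move/submx_trans; apply; rewrite -(map_mx0 s) map_submx sk.
Qed.

Lemma coplanar_meet l l' h : \rank l = 2%N -> \rank l' = 2%N -> h != 0 ->
  l *m h = 0 -> l' *m h = 0 -> meets l l'.
Proof. by move=> rl rl' h0 lh lh'; apply: contra h0 => sk; apply/eqP/(skew_inj rl rl' sk). Qed.

Lemma line_meets_plane l h : \rank l = 2%N ->
  exists x : 'rV[K]_4, [/\ x != 0, (x <= l)%MS & x *m h = 0].
Proof.
move=> rl; have : kermx (l *m h) != 0.
  rewrite -mxrank_eq0 mxrank_ker subn_eq0 -ltnNge.
  exact: leq_ltn_trans (rank_leq_col _) _.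
rewrite -nz_row_eq0 => v0; set v := nz_row _ in v0.
exists (v *m l); split; last by rewrite -mulmxA; apply/sub_kermxP/nz_row_sub.
  apply: contra v0 => /eqP vl; apply/eqP.
  have fl : row_free l by rewrite /row_free rl.
  by apply: (row_free_inj fl); rewrite vl mul0mx.
exact: submxMl.
Qed.

Lemma rank_ker_le h h' : (2 <= \rank (kermx (row_mx h h')))%N.
Proof.
rewrite mxrank_ker leq_subRL ?(leq_trans (rank_leq_row _)) //.
by rewrite (@leq_add2r 2 _ 2) rank_leq_col.
Qed.

Lemma rank_planes h h' m (z : 'M[K]_(m, 4)) : h != 0 -> z *m h = 0 -> z *m h' != 0 ->
  \rank (kermx (row_mx h h')) = 2%N.
Proof.
move=> h0 zh zh'; apply/eqP; rewrite eqn_leq rank_ker_le andbT -ltnS.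
have rh : \rank (kermx h) = 3%N.
  rewrite mxrank_ker; suff -> : \rank h = 1%N by [].
  by apply/eqP; rewrite eqn_leq rank_leq_col lt0n mxrank_eq0.
apply: leq_trans (_ : \rank (kermx h) <= 3)%N; last by rewrite rh.
apply: rank_ltmx; rewrite ltmxE; apply/andP; split.
  apply/sub_kermxP; have /sub_kermxP := submx_refl (kermx (row_mx h h')).
  by case/mul_row_mx_eq0.
apply: contra zh' => sub; have /sub_kermxP : (z <= kermx (row_mx h h'))%MS.
  by apply: submx_trans sub; apply/sub_kermxP.
by case/mul_row_mx_eq0 => _ ->.
Qed.

Lemma line_eqs l h h' : \rank l = 2%N -> l *m h = 0 -> l *m h' = 0 ->
  \rank (kermx (row_mx h h')) = 2%N -> (kermx (row_mx h h') == l)%MS.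
Proof.
move=> rl lh lh' rk; rewrite andbC -(mxrank_leqif_eq _).2 ?rl ?rk //.
by apply/sub_kermxP/mul_row_mx_eq0.
Qed.

Lemma on_line_eqs l h h' (L : fieldType) (s : {rmorphism K -> L}) (x : 'rV[L]_4) :
  (kermx (row_mx h h') == l)%MS ->
  (x <= map_mx s l)%MS <-> lin h s x = 0 /\ lin h' s x = 0.
Proof.
move=> e; have e' : (map_mx s l :=: kermx (row_mx (map_mx s h) (map_mx s h')))%MS.
  by rewrite -map_row_mx -map_kermx; apply/eqmxP; rewrite !map_submx andbC.
rewrite e'; split=> [/sub_kermxP/mul_row_mx_eq0[e1 e2]|[e1 e2]].
  by rewrite /lin e1 e2 mxE.
by apply/sub_kermxP/mul_row_mx_eq0; split; apply/rowP => i; rewrite !ord1 [RHS]mxE.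
Qed.

Lemma rank_points (x y : 'rV[K]_4) : x != 0 -> ~~ (y <= x)%MS -> \rank (x + y)%MS = 2%N.
Proof.
move=> x0 yx; apply/eqP; rewrite eqn_leq; apply/andP; split.
  by rewrite (leq_trans (mxrank_adds_leqif x y)) // (@leq_add _ _ 1 1) ?rank_leq_row.
have : (\rank x < \rank (x + y)%MS)%N.
  by apply: rank_ltmx; rewrite ltmxE addsmxSl addsmx_sub submx_refl.
by rewrite rank_rV x0.
Qed.

Lemma line_through l (x y : 'rV[K]_4) : \rank l = 2%N -> x != 0 -> ~~ (y <= x)%MS ->
  (x <= l)%MS -> (y <= l)%MS -> (x + y == l)%MS.
Proof.
move=> rl x0 yx xl yl; have sub : (x + y <= l)%MS by rewrite addsmx_sub xl.
by rewrite -(mxrank_leqif_eq sub).2 rank_points // rl.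
Qed.

Lemma line_of_rank m (A : 'M[K]_(m, 4)) : \rank A = 2%N ->
  exists l : 'M[K]_(2, 4), \rank l = 2%N /\ (l == A)%MS.
Proof.
move=> rA; move: (row_base A) (eq_row_base A); rewrite rA => l e.
by exists l; split; [rewrite e | apply/eqmxP].
Qed.

Lemma exists_plane l l' : meets l l' ->
  exists h, [/\ h != 0, l *m h = 0 & l' *m h = 0].
Proof.
case/meetsP => x [x0 xl xl'].
have rk : (\rank (l + l')%MS < 4)%N.
  rewrite -(ltn_add2r (\rank (l :&: l')%MS)) mxrank_sum_cap.
  rewrite (leq_ltn_trans (leq_add (rank_leq_row _) (rank_leq_row _))) //.
  rewrite -{1}[(2 + 2)%N]addn0 ltn_add2l lt0n mxrank_eq0.
  apply: contra x0 => /eqP z; rewrite -submx0 -z sub_capmx xl //.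
have : cokermx (l + l')%MS != 0.
  by rewrite -mxrank_eq0 mxrank_coker subn_eq0 -ltnNge.
case/eqP/matrixP/existsNP => i /existsNP[j ij].
have van l1 : (l1 <= l + l')%MS -> l1 *m col j (cokermx (l + l')%MS) = 0.
  by rewrite submxE => /eqP e; rewrite colE mulmxA e mul0mx.
exists (col j (cokermx (l + l')%MS)); split; rewrite ?van ?addsmxSl ?addsmxSr //.
by apply/eqP => /colP/(_ i); rewrite mxE => e; apply: ij; rewrite e !mxE.
Qed.

End Lines.

(** * Maximal minors *)

(** The maximal minors of a 4 x 3 matrix, with signs: they span its left kernel
    when this kernel is a line. *)
Definition minors (R : comNzRingType) (A : 'M[R]_(4, 3)) : 'rV[R]_4 :=
  \row_k ((-1) ^+ k * \det (row' k A)).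

Lemma minors_det (R : comNzRingType) (A : 'M[R]_(4, 3)) (v : 'cV[R]_4) :
  (minors A *m v) 0 0 = \det (row_mx v A : 'M_4).
Proof.
rewrite (expand_det_col _ 0) mxE; apply: eq_bigr => k _.
rewrite mxE /cofactor addn0 mulrC.
have -> : row_mx v A k 0 = v k 0.
  by rewrite -(row_mxEl v A); congr (row_mx v A k _); apply: val_inj.
suff -> : row' k (col' 0 (row_mx v A)) = row' k A by [].
apply/matrixP => i j; rewrite !mxE.
case: splitP => [[[|//] ?] //|j' /= e]; congr (A _ _); apply: val_inj.
by move: e; rewrite /= /bump => -[].
Qed.

Lemma minors_ker (R : comNzRingType) (A : 'M[R]_(4, 3)) : minors A *m A = 0.
Proof.
apply/rowP => j; have -> : (minors A *m A) 0 j = (minors A *m col j A) 0 0.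
  by rewrite !mxE; apply: eq_bigr => i _; rewrite !mxE.
rewrite minors_det [RHS]mxE -det_tr.
apply: (@determinant_alternate _ _ _ 0 (lift 0 j)) => // i.
rewrite [LHS]mxE [RHS]mxE.
transitivity (row_mx (col j A) A i (lshift 3 0)).
  by congr (row_mx _ _ i _); apply: val_inj.
transitivity (row_mx (col j A) A i (rshift 1 j)); first by rewrite row_mxEl row_mxEr mxE.
by congr (row_mx _ _ i _); apply: val_inj.
Qed.

(** Let x span the kernel and x v = 1.  If the minors vanished, the square
    matrix with the additional column v would be singular, giving a kernel
    vector y with y v = 0, not proportional to x. *)
Lemma minors_neq0 (L : fieldType) (A : 'M[L]_(4, 3)) :
  (forall z z' : 'rV[L]_4, z != 0 -> z *m A = 0 -> z' *m A = 0 -> (z' <= z)%MS) ->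
  minors A != 0.
Proof.
move=> ker1; have : kermx A != 0.
  by rewrite -mxrank_eq0 mxrank_ker subn_eq0 -ltnNge ltnS rank_leq_col.
rewrite -nz_row_eq0; set x := nz_row _ => x0.
have xA : x *m A = 0 by apply/sub_kermxP/nz_row_sub.
have [v xv] : exists v : 'cV[L]_4, x *m v = 1%:M.
  have [|e ex] := @exists_dual L 4 x^T.
    by rewrite -(inj_eq (@trmx_inj _ _ _)) trmxK trmx0.
  by exists e^T; apply: (@trmx_inj _ _ _); rewrite trmx_mul trmxK ex trmx1.
apply/negP => /eqP z; have := minors_det A v; rewrite z mul0mx mxE => /esym/eqP/det0P[y y0].
move=> e; have [yv yA] : y *m v = 0 /\ y *m A = 0 by apply/mul_row_mx_eq0.
have /sub_rVP[t et] := ker1 _ _ x0 xA yA.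
case/eqP: y0; move: yv; rewrite et -scalemxAl xv => /matrixP/(_ 0 0).
by rewrite !mxE mulr1 => ->; rewrite scale0r.
Qed.

(** * The configuration of lines and the Cayley-Salmon equation *)

Lemma three_others (i j : 'I_6) : exists k1 k2 k3 : 'I_6,
  [/\ (k1 != i) && (k1 != j), (k2 != i) && (k2 != j) & (k3 != i) && (k3 != j)]
  /\ [/\ k1 != k2, k1 != k3 & k2 != k3].
Proof.
pose s := [seq k <- enum 'I_6 | (k != i) && (k != j)].
have us : uniq s by apply: filter_uniq; apply: enum_uniq.
have ss : (3 <= size s)%N.
  have /= := count_predC [pred k | (k != i) && (k != j)] (enum 'I_6).
  rewrite size_enum_ord -size_filter -/s => e.
  have : (count (predC [pred k | (k != i) && (k != j)]) (enum 'I_6) <= 2)%N.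
    rewrite -size_filter; apply: (@uniq_leq_size _ _ [:: i; j]) => [|k].
      by apply: filter_uniq; apply: enum_uniq.
    by rewrite mem_filter /= negb_and !negbK !inE => /andP[].
  move: e; move: (size s) (count _ _) => a b e le2.
  by rewrite -(leq_add2r 2) ltnW // -[(3 + 2).+1]e leq_add2l.
have ps k : k \in s -> (k != i) && (k != j) by rewrite mem_filter => /andP[].
case: s us ss ps => [|k1 [|k2 [|k3 s]]] //= /and4P[].
rewrite !inE !negb_or => /and3P[n12 n13 _] /andP[n23 _] _ _ _ ps.
exists k1, k2, k3; split; split; rewrite ?n12 ?n13 ?n23 //; apply: ps;
  by rewrite !inE eqxx ?orbT.
Qed.

Lemma mx11_0 (R : nzRingType) : (0 : 'M[R]_1) 0 0 = 0.
Proof. by rewrite mxE. Qed.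

Section Configuration.

Variable K : fieldType.
Hypothesis charK : [pchar K] =i pred0.

Variables (f : {mpoly K[4]}) (E G : 'I_6 -> 'M[K]_(2, 4)) (F : 'I_6 -> 'I_6 -> 'M[K]_(2, 4)).
Variable h : 'I_6 -> 'I_6 -> 'cV[K]_4.
Hypotheses (f_cubic : f \is 3.-homog) (f_smooth : smooth f).
Hypothesis f_lines : lines27 f E G F.
Hypothesis h_def : forall i j, i != j -> defines_plane (h i j) (G i + E j)%MS.

Let rE i : \rank (E i) = 2%N. Proof. by case: f_lines => -[/(_ i)[]]. Qed.
Let rG i : \rank (G i) = 2%N. Proof. by case: f_lines => -[_ /(_ i)[]]. Qed.
Let rF i j : i != j -> \rank (F i j) = 2%N.
Proof. by case: f_lines => -[_ _ rkF] _ _ _ _ /rkF[]. Qed.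

Lemma E_skew i j : i != j -> skew (E i) (E j).
Proof. by case: f_lines => _ sk _ _ _; apply: sk. Qed.
Let FC i j : i != j -> (F i j == F j i)%MS.
Proof. by case: f_lines => _ _ fc _ _ /fc[]. Qed.
Lemma F_meets_E i j k : i != j -> meets (F i j) (E k) = (k == i) || (k == j).
Proof. by case: f_lines => _ _ fc _ _ /fc[]. Qed.
Lemma G_meets_E i j : meets (G i) (E j) = (j != i).
Proof. by case: f_lines. Qed.
Let GE_skew i : skew (G i) (E i).
Proof. by apply/negPn; rewrite -/(meets _ _) G_meets_E eqxx. Qed.

Lemma line_on_vanish l : line_on f l -> vanish_on l f.
Proof.
case=> _ sub x xl; have [->|x0] := eqVneq x 0.
  by rewrite meval_evalp -[0](scale0r 0) (evalp_homogZ _ _ _ f_cubic) exprS !mul0r.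
have [|//] := sub K (idm K) x; split=> //.
by rewrite map_mx_idm.
Qed.

Lemma vanish_line_on l : \rank l = 2%N -> vanish_on l f -> line_on f l.
Proof.
move=> rl van; split=> // L s x [x0 xl]; split=> //.
exact: (vanish_extension charK van xl).
Qed.

Lemma vanE i : vanish_on (E i) f. Proof. by apply: line_on_vanish; case: f_lines => -[]. Qed.
Lemma vanG i : vanish_on (G i) f. Proof. by apply: line_on_vanish; case: f_lines => -[]. Qed.
Lemma vanF i j : i != j -> vanish_on (F i j) f.
Proof. by move=> ij; apply: line_on_vanish; case: f_lines => -[_ _ hF] *; apply: hF. Qed.

(** If G_i and G_j met, then each of three further E_k, meeting both, would
    pass through their common point or lie in their common plane; two of the
    three would do the same and so meet. *)
Lemma G_skew i j : i != j -> skew (G i) (G j).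
Proof.
move=> ij; apply: contraT => /[dup] mt /meetsP[q [q0 qi qj]].
have [P [P0 iP jP]] := exists_plane mt.
have dich k : k != i -> k != j -> (q <= E k)%MS \/ E k *m P = 0.
  move=> ki kj.
  have /meetsP[x [x0 xi xk]] : meets (G i) (E k) by rewrite G_meets_E.
  have /meetsP[y [y0 yj yk]] : meets (G j) (E k) by rewrite G_meets_E.
  have [yx|yx] := boolP (y <= x)%MS; last first.
    right; have /eqmxP e := line_through (rE k) x0 yx xk yk.
    apply/sub_kermxP; rewrite -e addsmx_sub.
    by rewrite (submx_trans xi) ?(submx_trans yj) //; apply/sub_kermxP.
  left; have yi := submx_trans yx xi.
  have [qy|qy] := boolP (q <= y)%MS; first exact: submx_trans qy yk.
  have /eqmxP e1 := line_through (rG i) y0 qy yi qi.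
  have /eqmxP e2 := line_through (rG j) y0 qy yj qj.
  have e : (G i == G j)%MS by apply/eqmxP => //; apply: eqmx_trans e2; apply: eqmx_sym.
  by have := meets_eqmx (E j) e; rewrite !G_meets_E eqxx eq_sym ij.
have [k1 [k2 [k3 [[/andP[a1 b1] /andP[a2 b2] /andP[a3 b3]] [n12 n13 n23]]]]] := three_others i j.
have no_q a b : a != b -> (q <= E a)%MS -> (q <= E b)%MS -> False.
  by move=> ab qa qb; case/negP: q0; apply/eqP; apply: skewP (E_skew ab) qa qb.
have no_P a b : a != b -> E a *m P = 0 -> E b *m P = 0 -> False.
  move=> ab Pa Pb; case/negP: P0; apply/eqP.
  exact: skew_inj (rE a) (rE b) (E_skew ab) Pa Pb.
case: (dich _ a1 b1) (dich _ a2 b2) (dich _ a3 b3) => d1 [] d2 [] d3;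
  by [case: (no_q _ _ n12) | case: (no_q _ _ n13) | case: (no_q _ _ n23)
     |case: (no_P _ _ n12) | case: (no_P _ _ n13) | case: (no_P _ _ n23)].
Qed.

Lemma Gh i j : i != j -> G i *m h i j = 0.
Proof.
move=> ij; apply/sub_kermxP; have /eqmxP-> := h_def ij; exact: addsmxSl.
Qed.

Lemma Eh i j : i != j -> E j *m h i j = 0.
Proof.
move=> ij; apply/sub_kermxP; have /eqmxP-> := h_def ij; exact: addsmxSr.
Qed.

Lemma h_neq0 i j : i != j -> h i j != 0.
Proof.
move=> ij; have mt : meets (G i) (E j) by rewrite G_meets_E eq_sym.
have [P [P0 GP EP]] := exists_plane mt.
apply: contra P0 => /eqP h0; apply/eqP; rewrite -[P]mul1mx; apply/sub_kermxP.
have : (1%:M <= kermx (h i j))%MS by apply/sub_kermxP; rewrite h0 mulmx0.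
have /eqmxP-> := h_def ij => /submx_trans; apply.
by rewrite addsmx_sub; apply/andP; split; apply/sub_kermxP.
Qed.

Lemma Eh_neq0 i j k : i != j -> k != j -> E k *m h i j != 0.
Proof.
move=> ij kj; apply: contra (h_neq0 ij) => /eqP e; apply/eqP.
by apply: skew_inj (E_skew kj) e (Eh ij).
Qed.

Lemma Gh_neq0 i j k : i != j -> k != i -> G k *m h i j != 0.
Proof.
move=> ij ki; apply: contra (h_neq0 ij) => /eqP e; apply/eqP.
by apply: skew_inj (G_skew ki) e (Gh ij).
Qed.

Lemma G_eqs i j k : i != j -> i != k -> j != k ->
  (kermx (row_mx (h i j) (h i k)) == G i)%MS.
Proof.
move=> ij ik jk; apply: line_eqs; rewrite ?Gh //.
by apply: rank_planes (h_neq0 ij) (Eh ij) _; rewrite Eh_neq0.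
Qed.

Lemma E_eqs i j k : i != k -> j != k -> i != j ->
  (kermx (row_mx (h i k) (h j k)) == E k)%MS.
Proof.
move=> ik jk ij; apply: line_eqs; rewrite ?Eh //.
by apply: rank_planes (h_neq0 ik) (Gh ik) _; rewrite Gh_neq0.
Qed.

(** If the plane P = 0 lies in S then f = P Q, and S is singular where P and Q
    both vanish.  A line E_k not in the plane meets it, and Q vanishes on E_k. *)
Lemma no_plane (P : 'cV[K]_4) : P != 0 -> ~ vanish_on (kermx P) f.
Proof.
move=> P0 van; have [Q hQ eQ] := plane_dvd charK f_cubic van.
have [k kP] : exists k, E k *m P != 0.
  have [z|] := eqVneq (E i1 *m P) 0; last by exists i1.
  exists i2; apply: contra P0 => /eqP z2; apply/eqP.
  by apply: skew_inj z z2 => //; apply: E_skew.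
have [x [x0 xk xP]] := line_meets_plane P (rE k).
have vanQ : vanish_on (E k) Q.
  have := @vanE k; rewrite {1}eQ => /(vanish_prime charK)[|//].
  by move/vanish_mlin => z; case/eqP: kP.
have Qx := vanQ x xk.
have fx : f.@[x 0] = 0 := vanE xk.
have [|i] := f_smooth (L := K) (s := idm K) (x := x); first by split.
by rewrite -meval_evalp eQ mderivM mevalD !mevalM Qx meval_mlin xP mx11_0 mul0r mulr0 addr0 eqxx.
Qed.

(** In the plane P = 0, dividing f by the equations m1 and m2 of two lines of S
    leaves a linear form, the equation of the residual line. *)
Lemma plane_section (P m1 m2 : 'cV[K]_4) k (B : 'M[K]_(k, 4)) :
  (forall x : 'rV_4, x *m P = 0 -> x *m m1 = 0 -> f.@[x 0] = 0) ->
  (forall x : 'rV_4, x *m P = 0 -> x *m m2 = 0 -> (x <= B)%MS) ->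
  vanish_on B f -> B *m P = 0 -> B *m m1 != 0 ->
  exists m3, vanish_on (kermx P) (f - mlin m1 * (mlin m2 * mlin m3)).
Proof.
move=> van1 sub2 vanB BP Bm1.
have [Q1 hQ1 e1] := plane_dvd_on charK f_cubic van1.
have vanQ1 : vanish_on B Q1.
  have : vanish_on B (mlin m1 * Q1).
    move=> x xB; have := e1 x; rewrite mevalB (vanB x xB) sub0r.
    by move=> e; apply/eqP; rewrite -oppr_eq0 e // (submx_trans xB) //; apply/sub_kermxP.
  by case/(vanish_prime charK) => // /vanish_mlin z; case/eqP: Bm1.
have [|Q2 hQ2 e2] := plane_dvd_on (h := P) (m := m2) charK hQ1.
  by move=> x xP xm; apply: vanQ1; apply: sub2.
have [m3 em3] := dhomog1_mlin hQ2; exists m3 => x xP.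
have := e1 x xP; have := e2 x xP; rewrite em3 !mevalB !mevalM => /subr0_eq -> /subr0_eq ->.
by rewrite subrr.
Qed.

(** The planes H_ij and H_ji both contain F_ij: the residual line in H_ij
    meets E_i and E_j, and F_ij is the only line of S that does so and is
    compatible with the other incidences. *)
Lemma Fh i j : i != j -> F i j *m h i j = 0.
Proof.
move=> ij; have [k [_ [_ [[/andP[ki kj] _ _] _]]]] := three_others i j.
have ik : i != k by rewrite eq_sym.
have jk : j != k by rewrite eq_sym.
have /eqmxP eG := G_eqs ij ik jk; have /eqmxP eE := E_eqs ij kj ik.
have [|||||m3 em3] := @plane_section (h i j) (h i k) (h k j) _ (E j).
- move=> x xP xm; apply: (@vanG i); rewrite -eG.
  by apply/sub_kermxP/mul_row_mx_eq0.
- by move=> x xP xm; rewrite -eE; apply/sub_kermxP/mul_row_mx_eq0.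
- exact: vanE.
- exact: Eh.
- by apply: Eh_neq0.
have fH (x : 'rV[K]_4) : x *m h i j = 0 ->
    f.@[x 0] = (x *m h i k) 0 0 * ((x *m h k j) 0 0 * (x *m m3) 0 0).
  move=> xh; have := em3 x; rewrite mevalB !mevalM !meval_mlin => e.
  by apply: subr0_eq; apply: e; apply/sub_kermxP.
have rM : \rank (kermx (row_mx (h i j) m3)) = 2%N.
  apply: (@rank_planes _ _ _ _ (kermx (h i j))); rewrite ?h_neq0 ?mulmx_ker //.
  apply/eqP => z; apply: (no_plane (h_neq0 ij)) => x xh.
  have xm : x *m m3 = 0 by case/submxP: xh => y ->; rewrite -mulmxA z mulmx0.
  by rewrite fH ?xm ?mx11_0 ?mulr0 //; apply/sub_kermxP.
have [M [rkM /eqmxP eM]] := line_of_rank rM.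
have inM (x : 'rV[K]_4) : (x <= M)%MS <-> x *m h i j = 0 /\ x *m m3 = 0.
  by rewrite eM; split=> [/sub_kermxP/mul_row_mx_eq0|/mul_row_mx_eq0/sub_kermxP].
have Mh : M *m h i j = 0.
  apply/row_matrixP => a; rewrite row_mul row0.
  by have [] := (inM (row a M)).1 (row_sub a M).
have lM : line_on f M.
  apply: vanish_line_on => // x /inM[xh xm].
  by rewrite fH // xm mx11_0 !mulr0.
have MEj : meets M (E j) by apply: coplanar_meet (h_neq0 ij) Mh (Eh ij).
have MEi : meets M (E i).
  have [x [x0 xi xh]] := line_meets_plane (h i j) (rE i).
  apply/meetsP; exists x; split=> //; apply/inM; split=> //.
  have := vanE xi; rewrite fH // => /eqP; rewrite !mulf_eq0.
  have z0 (A : 'M[K]_1) : (A 0 0 == 0) = (A == 0).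
    apply/eqP/eqP => [e|->]; last by rewrite mxE.
    by apply/matrixP => a b; rewrite !ord1 mxE.
  rewrite !z0 => /or3P[] /eqP z //.
    suff xG : (x <= G i)%MS by rewrite (skewP (GE_skew i) xG xi) eqxx in x0.
    by rewrite -eG; apply/sub_kermxP/mul_row_mx_eq0.
  suff xE : (x <= E j)%MS by rewrite (skewP (E_skew ij) xi xE) eqxx in x0.
  by rewrite -eE; apply/sub_kermxP/mul_row_mx_eq0.
have EE a b : meets (E a) (E b) -> a = b.
  by move=> mt; apply/eqP; apply: contraLR mt => /E_skew; rewrite /meets negbK.
have fid : map_mpoly (idm K) f = f by apply/mpolyP => m; rewrite mcoeff_map_mpoly.
case: f_lines => _ _ _ _ /(_ K (idm K) M); rewrite fid => /(_ lM)[[a]|[a]|[a [b [ab]]]];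
  rewrite map_mx_idm => e.
- move: MEi MEj; rewrite !(meets_eqmx _ e) => /EE -> /EE ij'.
  by rewrite ij' eqxx in ij.
- move: MEi; rewrite (meets_eqmx _ e) G_meets_E => ia.
  have : meets M (G i) by apply: coplanar_meet (h_neq0 ij) Mh (Gh ij).
  by rewrite (meets_eqmx _ e) /meets G_skew // eq_sym.
- have eF : (F a b == F i j)%MS.
    move: MEi MEj; rewrite !(meets_eqmx _ e) !F_meets_E //.
    case/orP=> /eqP ia; case/orP=> /eqP jb; move: ij ab; rewrite ia jb ?eqxx //.
      by move=> _ _; apply/eqmxP.
    by move=> _ ab; apply: FC.
  have /eqmxP e1 := e; have /eqmxP e2 := eF.
  by apply/sub_kermxP; rewrite -e2 -e1; apply/sub_kermxP.
Qed.

Lemma Fh' i j : i != j -> F i j *m h j i = 0.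
Proof.
move=> ij; have ji : j != i by rewrite eq_sym.
by apply/sub_kermxP; have /eqmxP-> := FC ij; apply/sub_kermxP/Fh.
Qed.

Lemma F_eqs i j : i != j -> (kermx (row_mx (h i j) (h j i)) == F i j)%MS.
Proof.
move=> ij; have ji : j != i by rewrite eq_sym.
apply: line_eqs; rewrite ?Fh ?Fh' ?rF //.
by apply: rank_planes (h_neq0 ij) (Gh ij) _; rewrite Gh_neq0.
Qed.

(** The plane H_ij meets S in G_i, E_j and F_ij, and the planes H_ik, H_kj and
    H_ji meet H_ij in these lines. *)
Lemma section_H i j k : i != j -> i != k -> j != k -> exists c,
  vanish_on (kermx (h i j)) (f - c *: (mlin (h i k) * (mlin (h k j) * mlin (h j i)))).
Proof.
move=> ij ik jk; have ki : k != i by rewrite eq_sym.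
have ji : j != i by rewrite eq_sym.
have kj : k != j by rewrite eq_sym.
have /eqmxP eG := G_eqs ij ik jk; have /eqmxP eE := E_eqs ij kj ik.
have /eqmxP eF := F_eqs ij.
have [|||||m3 em3] := @plane_section (h i j) (h i k) (h k j) _ (E j).
- move=> x xP xm; apply: (@vanG i); rewrite -eG.
  by apply/sub_kermxP/mul_row_mx_eq0.
- by move=> x xP xm; rewrite -eE; apply/sub_kermxP/mul_row_mx_eq0.
- exact: vanE.
- exact: Eh.
- by apply: Eh_neq0.
have van3 : vanish_on (F i j) (mlin m3).
  have : vanish_on (F i j) (mlin (h i k) * (mlin (h k j) * mlin m3)).
    move=> x xF; have := em3 x; rewrite mevalB (vanF ij xF) sub0r.
    move=> e; apply/eqP; rewrite -oppr_eq0 e // (submx_trans xF) //.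
    by apply/sub_kermxP; rewrite Fh.
  case/(vanish_prime charK) => [/vanish_mlin z|].
    have e : (F i j == G i)%MS.
      rewrite -(mxrank_leqif_eq _).2 ?rF ?rG //.
      by rewrite -eG; apply/sub_kermxP/mul_row_mx_eq0; rewrite Fh.
    by have := meets_eqmx (E i) e; rewrite F_meets_E // G_meets_E eqxx.
  case/(vanish_prime charK) => [/vanish_mlin z|//].
  have e : (F i j == E j)%MS.
    rewrite -(mxrank_leqif_eq _).2 ?rF ?rE //.
    by rewrite -eE; apply/sub_kermxP/mul_row_mx_eq0; rewrite Fh.
  have := meets_eqmx (E i) e; rewrite F_meets_E // eqxx /=.
  by rewrite /meets (E_skew ji).
have [|Q hQ eQ] := plane_dvd_on (h := h i j) (m := h j i) charK (dhomog_mlin m3).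
  by move=> x xh xh'; apply: van3; rewrite -eF; apply/sub_kermxP/mul_row_mx_eq0.
exists (Q@_0%MM) => x xh; have := em3 x xh; have := eQ x xh.
rewrite (dhomog0_const hQ) mcoeffC eqxx mulr1 !mevalB !mevalZ !mevalM mevalC.
by move=> /subr0_eq -> /subr0_eq ->; ring.
Qed.

(** The product of the three forms does not vanish identically on the line where
    the two planes meet, and there f is its multiple by either constant. *)
Lemma section_const_eq i j k c c' : i != j -> i != k -> j != k ->
  vanish_on (kermx (h i j)) (f - c *: (mlin (h i k) * (mlin (h k j) * mlin (h j i)))) ->
  vanish_on (kermx (h j k)) (f - c' *: (mlin (h i k) * (mlin (h k j) * mlin (h j i)))) ->
  c = c'.
Proof.
move=> ij ik jk; have ki : k != i by rewrite eq_sym.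
have ji : j != i by rewrite eq_sym.
have kj : k != j by rewrite eq_sym.
set B := _ * _ => v1 v2; apply/eqP; apply: contraT => cc'.
pose Z := kermx (row_mx (h i j) (h j k)).
have [Z1 Z2] : Z *m h i j = 0 /\ Z *m h j k = 0 by apply/mul_row_mx_eq0; apply: mulmx_ker.
have line_sub (l : 'M[K]_(2, 4)) (a b : 'cV[K]_4) : \rank l = 2%N -> (kermx (row_mx a b) == l)%MS ->
    Z *m a = 0 -> Z *m b = 0 -> l *m h i j = 0 /\ l *m h j k = 0.
  move=> rl /eqmxP e za zb.
  have sub : (Z <= l)%MS by rewrite -e; apply/sub_kermxP/mul_row_mx_eq0.
  have e' : (Z == l)%MS.
    rewrite -(mxrank_leqif_eq sub).2 eqn_leq mxrankS //= rl; exact: rank_ker_le.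
  by split; apply/sub_kermxP; have /eqmxP<- := e'; apply/sub_kermxP.
have : vanish_on Z B.
  move=> x xZ; have h1 := v1 x; have h2 := v2 x.
  have e1 := h1 (submx_trans xZ (introT sub_kermxP Z1)).
  have e2 := h2 (submx_trans xZ (introT sub_kermxP Z2)).
  move: e1 e2; rewrite !mevalB !mevalZ => /subr0_eq-> /eqP.
  by rewrite -mulrBl mulf_eq0 subr_eq0 (negPf cc') /= => /eqP.
case/(vanish_prime charK) => [/vanish_mlin z|].
  have [_ /eqP] := line_sub _ _ _ (rG i) (G_eqs ij ik jk) Z1 z.
  by rewrite (negPf (Gh_neq0 jk ij)).
case/(vanish_prime charK) => /vanish_mlin z.
  have [_ /eqP] := line_sub _ _ _ (rE j) (E_eqs ij kj ik) Z1 z.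
  by rewrite (negPf (Eh_neq0 jk jk)).
have [/eqP + _] := line_sub _ _ _ (rG j) (G_eqs ji jk ik) z Z2.
by rewrite (negPf (Gh_neq0 ij ji)).
Qed.

(** The trihedra H_ij, H_jk, H_ki and H_ik, H_kj, H_ji meet in nine lines of S
    and form a Steiner pair.  By section_H, subtracting from f a multiple of the
    product of one of them leaves a cubic that vanishes on the planes of the
    other. *)
Lemma cayley_salmon i j k : i != j -> i != k -> j != k -> exists a b,
  [/\ a != 0, b != 0 &
   f = a *: (mlin (h i j) * (mlin (h j k) * mlin (h k i)))
     + b *: (mlin (h i k) * (mlin (h k j) * mlin (h j i)))].
Proof.
move=> ij ik jk; have ki : k != i by rewrite eq_sym.
have ji : j != i by rewrite eq_sym.
have kj : k != j by rewrite eq_sym.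
have [c v1] := section_H ij ik jk.
have [c2 v2] := section_H jk ji ki.
have [c3 v3] := section_H ki kj ij.
have BC1 : mlin (h j i) * (mlin (h i k) * mlin (h k j))
         = mlin (h i k) * (mlin (h k j) * mlin (h j i)) by ring.
have BC2 : mlin (h k j) * (mlin (h j i) * mlin (h i k))
         = mlin (h i k) * (mlin (h k j) * mlin (h j i)) by ring.
have e3 : c2 = c3.
  by apply: (section_const_eq jk ji ki v2); rewrite BC1 -BC2.
rewrite BC1 in v2; rewrite BC2 -{}e3 in v3.
have e2 := section_const_eq ij ik jk v1 v2.
rewrite -{}e2 in v2 v3; set B := mlin (h i k) * _ in v1 v2 v3 *.
have hB : B \is 3.-homog by apply: (@dhomogM _ _ _ 1 _ 2); rewrite ?dhomog_mlin //;
   apply: (@dhomogM _ _ _ 1 _ 1); rewrite dhomog_mlin.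
have hd : f - c *: B \is 3.-homog by rewrite rpredB ?rpredZ.
have [Q1 hQ1 eQ1] := plane_dvd charK hd v1.
have step (P P' : 'cV[K]_4) Q : vanish_on (kermx P') (mlin P * Q) -> kermx P' *m P != 0 ->
    vanish_on (kermx P') Q.
  by move=> /(vanish_prime charK)[/vanish_mlin ->|//]; rewrite eqxx.
have kerG a b (P : 'cV[K]_4) : a != b -> G a *m P != 0 -> kermx (h a b) *m P != 0.
  move=> ab; apply: contra => /eqP z.
  by have /sub_kermxP/submxP[D ->] := Gh ab; rewrite -mulmxA z mulmx0.
have [Q2 hQ2 eQ2] : exists2 Q2, Q2 \is 1.-homog & Q1 = mlin (h j k) * Q2.
  apply: (plane_dvd charK hQ1); apply: (step (h i j)); first by rewrite -eQ1.
  by apply: kerG => //; apply: Gh_neq0.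
have [Q3 hQ3 eQ3] : exists2 Q3, Q3 \is 0.-homog & Q2 = mlin (h k i) * Q3.
  apply: (plane_dvd charK hQ2); apply: (step (h j k)).
    by apply: (step (h i j)); rewrite -?eQ2 -?eQ1 //; apply: kerG => //; apply: Gh_neq0.
  by apply: kerG => //; apply: Gh_neq0.
have ef : f = Q3@_0%MM *: (mlin (h i j) * (mlin (h j k) * mlin (h k i))) + c *: B.
  rewrite -[LHS](subrK (c *: B)) eQ1 eQ2 eQ3 {1}(dhomog0_const hQ3) -mul_mpolyC.
  by congr (_ + _); ring.
exists Q3@_0%MM, c; split=> //.
  apply: contraT; rewrite negbK => /eqP z; case: (no_plane (h_neq0 ji)) => x /sub_kermxP xh.
  by rewrite ef z scale0r add0r mevalZ !mevalM !meval_mlin xh mx11_0 !mulr0.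
apply: contraT; rewrite negbK => /eqP z; case: (no_plane (h_neq0 ij)) => x /sub_kermxP xh.
by rewrite ef z scale0r addr0 mevalZ mevalM !meval_mlin xh mx11_0 mul0r mulr0.
Qed.

(** A line G_i disjoint from the indices of F_jk meets H_jk only on E_k and H_kj
    only on E_j. *)
Lemma GF_skew i j k : i != j -> i != k -> j != k -> skew (G i) (F j k).
Proof.
move=> ij ik jk; apply: contraT => /meetsP[x [x0 xi xF]].
have key a b : i != a -> i != b -> a != b -> x *m h a b = 0 -> (x <= E b)%MS.
  move=> ia ib ab xh.
  have /meetsP[z [z0 zi zb]] : meets (G i) (E b) by rewrite G_meets_E eq_sym.
  have zh : z *m h a b = 0 by have /submxP[D ->] := zb; rewrite -mulmxA Eh // mulmx0.
  have [xz|xz] := boolP (x <= z)%MS; first exact: submx_trans xz zb.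
  have /eqmxP e := line_through (rG i) z0 xz zi xi.
  case/eqP: (Gh_neq0 ab ia); apply/sub_kermxP; rewrite -e addsmx_sub.
  by apply/andP; split; apply/sub_kermxP.
have kj : k != j by rewrite eq_sym.
have xk : (x <= E k)%MS.
  by apply: (key j k) => //; have /submxP[D ->] := xF; rewrite -mulmxA Fh // mulmx0.
have xj : (x <= E j)%MS.
  by apply: (key k j) => //; have /submxP[D ->] := xF; rewrite -mulmxA Fh' // mulmx0.
by case/eqP: x0; apply: skewP (E_skew jk) xj xk.
Qed.

(** A common point would lie on the planes H_ij, H_ik and H_ji, H_ki, hence on
    both G_i and E_i. *)
Lemma FF_skew i j k : i != j -> i != k -> j != k -> skew (F i j) (F i k).
Proof.
move=> ij ik jk; apply: contraT => /meetsP[x [x0 xj xk]].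
have xh a b : i != a -> (x <= F i a)%MS -> b = h i a \/ b = h a i -> x *m b = 0.
  by move=> ia /submxP[D ->] [->|->]; rewrite -mulmxA ?Fh ?Fh' // mulmx0.
have xG : (x <= G i)%MS.
  have /eqmxP<- := G_eqs ij ik jk; apply/sub_kermxP/mul_row_mx_eq0.
  by split; [apply: (xh j) | apply: (xh k)]; auto.
have xE : (x <= E i)%MS.
  have ji : j != i by rewrite eq_sym.
  have ki : k != i by rewrite eq_sym.
  have /eqmxP<- := E_eqs ji ki jk.
  apply/sub_kermxP/mul_row_mx_eq0.
  by split; [apply: (xh j) | apply: (xh k)]; auto.
by case/eqP: x0; apply: skewP (GE_skew i) xG xE.
Qed.

(** Both h_ij and h_ik vanish on E_l only where E_l meets G_i. *)
Lemma E_ratio i j k l : i != j -> i != k -> l != i -> l != j -> l != k ->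
  exists2 t, t != 0 & E l *m h i j = t *: (E l *m h i k).
Proof.
move=> ij ik li lj lk.
have /meetsP[x [x0 xi xl]] : meets (G i) (E l) by rewrite G_meets_E.
have xh a : i != a -> x *m h i a = 0.
  by move=> ia; have /submxP[D ->] := xi; rewrite -mulmxA Gh // mulmx0.
have [z zl zk0] := mulmx_neq0_row (Eh_neq0 ik lk).
have zx : ~~ (z <= x)%MS.
  by apply: contra zk0 => /submxP[D ->]; rewrite -mulmxA xh // mulmx0 mx11_0.
pose t := (z *m h i j) 0 0 / (z *m h i k) 0 0.
have e : E l *m h i j = t *: (E l *m h i k).
  apply/eqP; rewrite -subr_eq0 scalemxAr -mulmxBr; apply/eqP/sub_kermxP.
  have /eqmxP<- := line_through (rE l) x0 zx xl zl.
  rewrite addsmx_sub; apply/andP; split; apply/sub_kermxP; rewrite mulmxBr -scalemxAr.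
    by rewrite !xh // scaler0 subrr.
  apply/eqP; rewrite subr_eq0; apply/eqP/rowP => a.
  by rewrite !ord1 [RHS]mxE divfK.
exists t => //; apply: contraNneq (Eh_neq0 ij lj) => t0.
by rewrite e t0 scale0r.
Qed.

Let n12 : i1 != i2. Proof. by []. Qed.
Let n13 : i1 != i3. Proof. by []. Qed.
Let n23 : i2 != i3. Proof. by []. Qed.
Let n21 : i2 != i1. Proof. by []. Qed.
Let n31 : i3 != i1. Proof. by []. Qed.
Let n32 : i3 != i2. Proof. by []. Qed.

Definition trihedral1 := mlin (h i1 i2) * (mlin (h i2 i3) * mlin (h i3 i1)).
Definition trihedral2 := mlin (h i1 i3) * (mlin (h i3 i2) * mlin (h i2 i1)).

(** On E_l the six linear forms are proportional in pairs, so the two trihedra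
    take proportional values there, while f vanishes. *)
Lemma trihedral_relation l p q t u v : l != i1 -> l != i2 -> l != i3 ->
  f = p *: trihedral1 + q *: trihedral2 ->
  E l *m h i2 i1 = t *: (E l *m h i2 i3) -> E l *m h i1 i2 = u *: (E l *m h i1 i3) ->
  E l *m h i3 i1 = v *: (E l *m h i3 i2) -> p * (u * v) + q * t = 0.
Proof.
move=> l1 l2 l3 ef et eu ev.
have [||x [xE _ xh]] := @generic_point K charK _ _ (E l) [:: h i1 i3; h i2 i3; h i3 i2] 1.
- by move=> y; rewrite !inE => /or3P[] /eqP->; apply: Eh_neq0.
- by move/(_ 0); rewrite sub0mx meval1 => /(_ isT)/eqP; rewrite oner_eq0.
have nz y : y \in [:: h i1 i3; h i2 i3; h i3 i2] -> (x *m y) 0 0 != 0.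
  by move/xh; apply: contra => /eqP z; apply/eqP/rowP => k; rewrite !ord1 z mxE.
have : f.@[x 0] = 0 by apply: (@vanE l x xE).
rewrite ef mevalD !mevalZ !mevalM !meval_mlin.
rewrite (ratio_at xE et) (ratio_at xE eu) (ratio_at xE ev) => e0.
have := nz (h i1 i3); have := nz (h i2 i3); have := nz (h i3 i2).
rewrite !inE !eqxx !orbT => /(_ isT) z1 /(_ isT) z2 /(_ isT) z3.
apply: (mulIf (mulf_neq0 (mulf_neq0 z1 z2) z3)); rewrite mul0r -e0; ring.
Qed.

(** Scaling factors a, b, d for which the linear map x |-> M(x) with rows
    (h_21, 0, - a h_23), (0, h_12, - b h_13), (h_31, - d h_32, 0)
    has determinant proportional to f, and kills (1, 1, 1) along E_4. *)
Lemma determinantal_constants : exists a b d m : K,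
  [/\ [/\ a != 0, b != 0, d != 0 & m != 0],
      f = m *: (a *: trihedral1 - (b * d) *: trihedral2)
    & [/\ E i4 *m h i2 i1 = a *: (E i4 *m h i2 i3),
          E i4 *m h i1 i2 = b *: (E i4 *m h i1 i3)
        & E i4 *m h i3 i1 = d *: (E i4 *m h i3 i2)]].
Proof.
have [a a0 ea] : exists2 t, t != 0 & E i4 *m h i2 i1 = t *: (E i4 *m h i2 i3).
  exact: E_ratio.
have [b b0 eb] : exists2 t, t != 0 & E i4 *m h i1 i2 = t *: (E i4 *m h i1 i3).
  exact: E_ratio.
have [d d0 ed] : exists2 t, t != 0 & E i4 *m h i3 i1 = t *: (E i4 *m h i3 i2).
  exact: E_ratio.
have [m [n [m0 nn0 ef]]] := cayley_salmon n12 n13 n23.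
rewrite -/trihedral1 -/trihedral2 in ef.
have rel := trihedral_relation (l := i4) isT isT isT ef ea eb ed; rewrite ef.
exists a, b, d, (m / a); split=> //; first by split; rewrite // mulf_neq0 ?invr_eq0.
have -> : n = - (m * (b * d) / a).
  by apply: (mulIf a0); rewrite mulNr divfK //; apply/eqP; rewrite -addr_eq0 addrC rel.
rewrite scalerBr !scalerA divfK // scaleNr; congr (_ - _ *: _).
by field.
Qed.

(** The three charts cover S: any two of the relevant lines that could miss
    all charts together are skew. *)
Lemma charts_cover (L : fieldType) (s : {rmorphism K -> L}) q :
  surface f s q <->
  U f G F i1 i2 s q \/ U f G F i1 i3 s q \/ U f G F i2 i3 s q.
Proof.
split=> [Sq|[[]|[[]|[]]] //].
have ext l l' : skew l l' -> on_line l s q -> ~ on_line l' s q.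
  move=> sk [q0 ql] [_ ql']; case/eqP: q0; exact: skew_extension sk ql ql'.
have [g1|g1] := pselect (on_line (G i1) s q).
  right; right; split=> //; first exact: ext (G_skew n12) g1.
    exact: ext (G_skew n13) g1.
  by apply: ext g1; apply: GF_skew.
have [g2|g2] := pselect (on_line (G i2) s q).
  right; left; split=> //; first exact: ext (G_skew n23) g2.
  by apply: ext g2; apply: GF_skew.
have [g3|g3] := pselect (on_line (G i3) s q).
  by left; split=> //; apply: ext g3; apply: GF_skew.
have [f12|f12] := pselect (on_line (F i1 i2) s q).
  by right; left; split=> //; apply: ext f12; apply: FF_skew.
by left.
Qed.

(** * The contraction *)

Section Contraction.

Variables a b d m : K.
Hypotheses (a0 : a != 0) (b0 : b != 0) (d0 : d != 0) (m0 : m != 0).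
Hypothesis f_det : f = m *: (a *: trihedral1 - (b * d) *: trihedral2).
Hypothesis E4_21 : E i4 *m h i2 i1 = a *: (E i4 *m h i2 i3).
Hypothesis E4_12 : E i4 *m h i1 i2 = b *: (E i4 *m h i1 i3).
Hypothesis E4_31 : E i4 *m h i3 i1 = d *: (E i4 *m h i3 i2).

Let o2 : 'I_3 := inord 2.

(** The incidence variety of the contraction: y is in the kernel of the matrix
    M(x); equivalently x is in the kernel of the matrix N(y) below. *)
Definition incident (L : fieldType) (s : {rmorphism K -> L}) (x : 'rV[L]_4) (y : 'rV[L]_3) :=
  [/\ lin (h i2 i1) s x * y 0 0 = s a * lin (h i2 i3) s x * y 0 o2,
      lin (h i1 i2) s x * y 0 1 = s b * lin (h i1 i3) s x * y 0 o2
    & lin (h i3 i1) s x * y 0 0 = s d * lin (h i3 i2) s x * y 0 1].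

Definition N_mx (R : nzRingType) (s : K -> R) (y : 'I_3 -> R) : 'M[R]_(4, 3) :=
  \matrix_(i, j) [:: s (h i2 i1 i 0) * y 0 - s (a * h i2 i3 i 0) * y o2;
                     s (h i1 i2 i 0) * y 1 - s (b * h i1 i3 i 0) * y o2;
                     s (h i3 i1 i 0) * y 0 - s (d * h i3 i2 i 0) * y 1]`_j.

Section OverExtension.

Variables (L : fieldType) (s : {rmorphism K -> L}).
Implicit Types (x : 'rV[L]_4) (y : 'rV[L]_3).

Let sa0 : s a != 0. Proof. by rewrite fmorph_eq0. Qed.
Let sb0 : s b != 0. Proof. by rewrite fmorph_eq0. Qed.
Let sd0 : s d != 0. Proof. by rewrite fmorph_eq0. Qed.

Lemma N_mxP x y : incident s x y <-> x *m N_mx s (y 0) = 0.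
Proof.
have lin_comb (c c' : 'cV[K]_4) (k : K) z z' :
    \sum_i x 0 i * (s (c i 0) * z - s (k * c' i 0) * z') =
    lin c s x * z - s k * lin c' s x * z'.
  rewrite /lin !mxE !mulr_suml -mulrA mulr_suml mulr_sumr -sumrB.
  by apply: eq_bigr => i _; rewrite !mxE rmorphM /=; ring.
have comp j : (x *m N_mx s (y 0)) 0 j = \sum_i x 0 i * N_mx s (y 0) i j by rewrite mxE.
have c0 : (x *m N_mx s (y 0)) 0 0 =
    lin (h i2 i1) s x * y 0 0 - s a * lin (h i2 i3) s x * y 0 o2.
  by rewrite comp -lin_comb; apply: eq_bigr => i _; rewrite mxE.
have c1 : (x *m N_mx s (y 0)) 0 1 =
    lin (h i1 i2) s x * y 0 1 - s b * lin (h i1 i3) s x * y 0 o2.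
  by rewrite comp -lin_comb; apply: eq_bigr => i _; rewrite mxE.
have c2 : (x *m N_mx s (y 0)) 0 o2 =
    lin (h i3 i1) s x * y 0 0 - s d * lin (h i3 i2) s x * y 0 1.
  by rewrite comp -lin_comb; apply: eq_bigr => i _; rewrite mxE inordK.
split=> [[e0 e1 e2]|z].
  by apply/rowP; apply: ord3P; rewrite [RHS]mxE ?c0 ?c1 ?c2 ?e0 ?e1 ?e2 subrr.
have z' j : (x *m N_mx s (y 0)) 0 j = 0 by rewrite z mxE.
by split; apply: subr0_eq; rewrite -?c0 -?c1 -?c2 z'.
Qed.

(** The determinant of M(x), as a monomial identity. *)
Lemma surface_det x : surface f s x ->
  s a * (lin (h i1 i2) s x * (lin (h i2 i3) s x * lin (h i3 i1) s x)) =
  s b * s d * (lin (h i1 i3) s x * (lin (h i3 i2) s x * lin (h i2 i1) s x)).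
Proof.
case=> _; rewrite f_det evalpZ => /eqP; rewrite mulf_eq0 fmorph_eq0 (negPf m0) /=.
by rewrite !evalpE !evalp_mlin rmorphM subr_eq0 => /eqP.
Qed.

Lemma incident_surface x y : x != 0 -> y != 0 -> incident s x y -> surface f s x.
Proof.
move=> x0 y0 [e0 e1 e2]; split=> //.
rewrite f_det !evalpE !evalp_mlin rmorphM -!/(lin _ _ _).
set h12 := lin (h i1 i2) _ _ in e1 *; set h23 := lin (h i2 i3) _ _ in e0 *.
set h31 := lin (h i3 i1) _ _ in e2 *; set h13 := lin (h i1 i3) _ _ in e1 *.
set h32 := lin (h i3 i2) _ _ in e2 *; set h21 := lin (h i2 i1) _ _ in e0 *.
set D := _ - _; suff -> : D = 0 by rewrite mulr0.
have De i : y 0 i * D = 0.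
  move: i; apply: ord3P; rewrite /D.
  - transitivity (s a * h12 * h23 * (h31 * y 0 0) - s b * s d * h13 * h32 * (h21 * y 0 0)).
      by ring.
    rewrite e0 e2; transitivity (s a * s d * h23 * h32 * (h12 * y 0 1 - s b * h13 * y 0 o2)).
      by ring.
    by rewrite e1 subrr mulr0.
  - transitivity (s a * h23 * h31 * (h12 * y 0 1) - s b * h13 * h21 * (s d * h32 * y 0 1)).
      by ring.
    rewrite -e2 e1; transitivity (s b * h13 * h31 * (s a * h23 * y 0 o2 - h21 * y 0 0)).
      by ring.
    by rewrite e0 subrr mulr0.
  - transitivity (h12 * h31 * (s a * h23 * y 0 o2) - s d * h32 * h21 * (s b * h13 * y 0 o2)).
      by rewrite /o2; ring.
    rewrite -e0 -e1; transitivity (h12 * h21 * (h31 * y 0 0 - s d * h32 * y 0 1)).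
      by ring.
    by rewrite e2 subrr mulr0.
have /rV0Pn[i yi] := y0; apply: (mulfI yi); by rewrite De mulr0.
Qed.

Lemma par_vec3 (p q r : L) y : p * y 0 1 = q * y 0 0 -> p * y 0 o2 = r * y 0 0 ->
  q * y 0 o2 = r * y 0 1 -> par (vec3 p q r 0) (y 0).
Proof.
move=> e1 e2 e3; apply: ord3P; apply: ord3P; rewrite !vec3E -/o2 //; exact: mulrC.
Qed.

(** A vector in the kernel of M(x) is proportional to the vector product of any
    two rows of M(x); the three charts are these products. *)
Lemma chart12_par x y : incident s x y -> par (chart12 h a b 1 s x 0) (y 0).
Proof.
move=> [e0 e1 e2]; rewrite /chart12 rmorph1 mul1r.
move: e0 e1 e2; move: (lin _ s x) (lin (h i1 i2) s x) => h21 h12.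
move: (lin _ s x) (lin (h i1 i3) s x) => h23 h13.
move=> e0 e1 e2; apply: par_vec3.
- transitivity (s a * h23 * (h12 * y 0 1)); first by ring.
  transitivity (s b * h13 * (h21 * y 0 0)); last by ring.
  by rewrite e0 e1; ring.
- transitivity (h12 * (s a * h23 * y 0 o2)); first by ring.
  by rewrite -e0; ring.
- transitivity (h21 * (s b * h13 * y 0 o2)); first by ring.
  by rewrite -e1; ring.
Qed.

Lemma chart13_par x y : incident s x y -> par (chart13 h (b * d) b 1 s x 0) (y 0).
Proof.
move=> [e0 e1 e2]; rewrite /chart13 rmorph1 mul1r rmorphM.
move: e1 e2; move: (lin _ s x) (lin (h i1 i3) s x) => h12 h13.
move: (lin _ s x) (lin (h i3 i2) s x) => h31 h32.
move=> e1 e2; apply: par_vec3.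
- transitivity (s b * h13 * (s d * h32 * y 0 1)); first by ring.
  by rewrite -e2; ring.
- transitivity (s d * h32 * (s b * h13 * y 0 o2)); first by ring.
  rewrite -e1; transitivity (h12 * (s d * h32 * y 0 1)); first by ring.
  by rewrite -e2; ring.
- transitivity (h31 * (s b * h13 * y 0 o2)); first by ring.
  by rewrite -e1; ring.
Qed.

Lemma chart23_par x y : incident s x y -> par (chart23 h a (a / d) 1 s x 0) (y 0).
Proof.
move=> [e0 e1 e2]; rewrite /chart23 rmorph1 mul1r fmorph_div.
move: e0 e2; move: (lin _ s x) (lin (h i2 i3) s x) => h21 h23.
move: (lin _ s x) (lin (h i3 i2) s x) => h31 h32.
move=> e0 e2; apply: par_vec3.
- transitivity (s a / s d * h23 * (s d * h32 * y 0 1)); first by field.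
  by rewrite -e2; field.
- transitivity (h32 * (s a * h23 * y 0 o2)); first by ring.
  by rewrite -e0; ring.
- transitivity (h31 / s d * (s a * h23 * y 0 o2)); first by field.
  rewrite -e0; transitivity (h21 / s d * (h31 * y 0 0)); first by field.
  by rewrite e2; field.
Qed.

Lemma chart12_incident x : surface f s x -> incident s x (chart12 h a b 1 s x).
Proof.
move=> /surface_det; rewrite /incident /chart12 !vec3E rmorph1 mul1r => e.
split; [by ring | by ring |].
transitivity (s a * (lin (h i1 i2) s x * (lin (h i2 i3) s x * lin (h i3 i1) s x))).
  by ring.
by rewrite e; ring.
Qed.

Lemma chart13_incident x : surface f s x -> incident s x (chart13 h (b * d) b 1 s x).
Proof.
move=> /surface_det; rewrite /incident /chart13 !vec3E rmorph1 mul1r rmorphM => e.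
split; [| by ring | by ring].
transitivity (s b * s d * (lin (h i1 i3) s x * (lin (h i3 i2) s x * lin (h i2 i1) s x))).
  by ring.
by rewrite -e; ring.
Qed.

Lemma chart23_incident x : surface f s x -> incident s x (chart23 h a (a / d) 1 s x).
Proof.
move=> /surface_det; rewrite /incident /chart23 !vec3E rmorph1 mul1r fmorph_div => e.
split; [by ring | | by field].
transitivity (s a * (lin (h i1 i2) s x * (lin (h i2 i3) s x * lin (h i3 i1) s x)) / s d).
  by field.
by rewrite e; field.
Qed.

Let vec3_eq0 (p q r : L) : vec3 p q r = 0 -> [/\ p = 0, q = 0 & r = 0].
Proof.
move=> e; have := congr1 (fun v : 'rV[L]_3 => v 0 0) e.
have := congr1 (fun v : 'rV[L]_3 => v 0 1) e.
have := congr1 (fun v : 'rV[L]_3 => v 0 o2) e.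
by rewrite /= !vec3E !mxE.
Qed.

Lemma chart12_neq0 x : U f G F i1 i2 s x -> chart12 h a b 1 s x != 0.
Proof.
case=> -[x0 _] g1 g2 f12; apply/negP => /eqP/vec3_eq0[].
rewrite rmorph1 mul1r => /eqP + /eqP + /eqP; rewrite !mulf_eq0 (negPf sa0) (negPf sb0) /=.
have [h12|h12] := eqVneq (lin (h i1 i2) s x) 0 => /=.
  move=> _ /orP[] /eqP z _; first by apply: f12; split=> //; apply/(on_line_eqs _ _ (F_eqs n12)).
  by apply: g1; split=> //; apply/(on_line_eqs _ _ (G_eqs n12 n13 n23)).
move=> /eqP h23 _ /eqP h21.
by apply: g2; split=> //; apply/(on_line_eqs _ _ (G_eqs n21 n23 n13)).
Qed.

Lemma chart13_neq0 x : U f G F i1 i3 s x -> chart13 h (b * d) b 1 s x != 0.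
Proof.
case=> -[x0 _] g1 g3 f13; apply/negP => /eqP/vec3_eq0[].
rewrite rmorph1 mul1r rmorphM => /eqP + /eqP + /eqP.
rewrite !mulf_eq0 (negPf sd0) (negPf sb0) /=.
have [h13|h13] := eqVneq (lin (h i1 i3) s x) 0 => /=.
  move=> _ _ /orP[] /eqP z; first by apply: f13; split=> //; apply/(on_line_eqs _ _ (F_eqs n13)).
  by apply: g1; split=> //; apply/(on_line_eqs _ _ (G_eqs n12 n13 n23)).
move=> /eqP h32 /eqP h31 _.
by apply: g3; split=> //; apply/(on_line_eqs _ _ (G_eqs n31 n32 n12)).
Qed.

Lemma chart23_neq0 x : U f G F i2 i3 s x -> chart23 h a (a / d) 1 s x != 0.
Proof.
case=> -[x0 _] g2 g3 f23; apply/negP => /eqP/vec3_eq0[].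
rewrite rmorph1 mul1r => /eqP + /eqP + /eqP.
rewrite !mulf_eq0 (negPf sa0) fmorph_div mulf_eq0 invr_eq0 (negPf sd0) (negPf sa0) /=.
have [h23|h23] := eqVneq (lin (h i2 i3) s x) 0 => /=.
  move=> _ _ /orP[] /eqP z; first by apply: f23; split=> //; apply/(on_line_eqs _ _ (F_eqs n23)).
  by apply: g2; split=> //; apply/(on_line_eqs _ _ (G_eqs n21 n23 n13)).
move=> /eqP h32 /eqP h31 _.
by apply: g3; split=> //; apply/(on_line_eqs _ _ (G_eqs n31 n32 n12)).
Qed.

End OverExtension.

Definition contraction : proj_map K 3 2 := fun L s x =>
  if chart12 h a b 1 s x != 0 then chart12 h a b 1 s x
  else if chart13 h (b * d) b 1 s x != 0 then chart13 h (b * d) b 1 s x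
  else chart23 h a (a / d) 1 s x.

Lemma contraction_neq0 (L : fieldType) (s : {rmorphism K -> L}) x :
  surface f s x -> contraction s x != 0.
Proof.
move=> /charts_cover U123; rewrite /contraction.
case: ifP => // c12; case: ifP => // c13.
case: U123 => [/chart12_neq0|[/chart13_neq0|/chart23_neq0 //]]; last by rewrite c13.
by rewrite c12.
Qed.

Lemma contraction_incident (L : fieldType) (s : {rmorphism K -> L}) x :
  surface f s x -> incident s x (contraction s x).
Proof.
move=> Sx; rewrite /contraction; case: ifP => _; first exact: chart12_incident.
by case: ifP => _; [apply: chart13_incident | apply: chart23_incident].
Qed.

Lemma incident_contraction (L : fieldType) (s : {rmorphism K -> L}) x y :
  surface f s x -> y != 0 -> incident s x y -> proj_eq (contraction s x) y.
Proof.
move=> Sx y0 xy; apply: par_proj_eq => //; first exact: contraction_neq0.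
rewrite /contraction; case: ifP => _; first exact: chart12_par.
by case: ifP => _; [apply: chart13_par | apply: chart23_par].
Qed.

Definition form12 (u v w : K) (k : 'I_3) : {mpoly K[4]} :=
  [:: u *: (mlin (h i1 i2) * mlin (h i2 i3)); v *: (mlin (h i2 i1) * mlin (h i1 i3));
      w *: (mlin (h i1 i2) * mlin (h i2 i1))]`_k.
Definition form13 (u v w : K) (k : 'I_3) : {mpoly K[4]} :=
  [:: u *: (mlin (h i1 i3) * mlin (h i3 i2)); v *: (mlin (h i1 i3) * mlin (h i3 i1));
      w *: (mlin (h i3 i1) * mlin (h i1 i2))]`_k.
Definition form23 (u v w : K) (k : 'I_3) : {mpoly K[4]} :=
  [:: u *: (mlin (h i2 i3) * mlin (h i3 i2)); v *: (mlin (h i2 i3) * mlin (h i3 i1));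
      w *: (mlin (h i3 i2) * mlin (h i2 i1))]`_k.

Lemma evalv_forms u v w (L : fieldType) (s : {rmorphism K -> L}) x :
  [/\ evalv (form12 u v w) s x = chart12 h u v w s x,
      evalv (form13 u v w) s x = chart13 h u v w s x
    & evalv (form23 u v w) s x = chart23 h u v w s x].
Proof.
by split; apply/rowP; apply: ord3P; rewrite mxE vec3E ?/form12 ?/form13 ?/form23 ?inordK //=;
   rewrite !evalpE !evalp_mlin.
Qed.

Lemma dhomog_forms u v w k : [/\ form12 u v w k \is 2.-homog,
  form13 u v w k \is 2.-homog & form23 u v w k \is 2.-homog].
Proof.
have q t (c c' : 'cV[K]_4) : t *: (mlin c * mlin c') \is 2.-homog.
  by rewrite rpredZ //; apply: (@dhomogM _ _ _ 1 _ 1); rewrite dhomog_mlin.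
by split; move: k; apply: ord3P; rewrite ?/form12 ?/form13 ?/form23 ?inordK //=; apply: q.
Qed.

Lemma contraction_local (L : fieldType) (s : {rmorphism K -> L}) x : surface f s x ->
  exists C : 'I_3 -> {mpoly K[4]}, [/\ forall k, C k \is 2.-homog, evalv C s x != 0
    & forall (L' : fieldType) (s' : {rmorphism K -> L'}) y, surface f s' y ->
      evalv C s' y != 0 -> proj_eq (contraction s' y) (evalv C s' y)].
Proof.
move=> /charts_cover[/chart12_neq0 nz|[/chart13_neq0 nz|/chart23_neq0 nz]].
- exists (form12 a b 1); split=> [k||L' s' y Sy]; first by have [] := dhomog_forms a b 1 k.
    by have [-> _ _] := evalv_forms a b 1 s x.
  have [-> _ _] := evalv_forms a b 1 s' y => nz'.
  by apply: incident_contraction => //; apply: chart12_incident.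
- exists (form13 (b * d) b 1); split=> [k||L' s' y Sy].
    by have [] := dhomog_forms (b * d) b 1 k.
    by have [_ -> _] := evalv_forms (b * d) b 1 s x.
  have [_ -> _] := evalv_forms (b * d) b 1 s' y => nz'.
  by apply: incident_contraction => //; apply: chart13_incident.
- exists (form23 a (a / d) 1); split=> [k||L' s' y Sy].
    by have [] := dhomog_forms a (a / d) 1 k.
    by have [_ _ ->] := evalv_forms a (a / d) 1 s x.
  have [_ _ ->] := evalv_forms a (a / d) 1 s' y => nz'.
  by apply: incident_contraction => //; apply: chart23_incident.
Qed.

Lemma contraction_regular X : sub_proj X (surface f) -> regular X contraction.
Proof.
move=> sub L s x /sub/contraction_local[C [hC Cx eC]]; exists 2%N, C; split=> //.
by move=> L' s' y /sub; apply: eC.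
Qed.

Lemma incident_lineI (l : 'M[K]_(2, 4)) (y : 'rV[K]_3) :
  y 0 0 *: (l *m h i2 i1) = (a * y 0 o2) *: (l *m h i2 i3) ->
  y 0 1 *: (l *m h i1 i2) = (b * y 0 o2) *: (l *m h i1 i3) ->
  y 0 0 *: (l *m h i3 i1) = (d * y 0 1) *: (l *m h i3 i2) ->
  l *m N_mx (idm K) (y 0) = 0.
Proof.
move=> e0 e1 e2; apply/row_matrixP => r; rewrite row_mul row0; apply/N_mxP.
have at_row (c c' : 'cV[K]_4) k k' z : k *: (l *m c) = (k' * z) *: (l *m c') ->
    lin c (idm K) (row r l) * k = k' * lin c' (idm K) (row r l) * z.
  move/matrixP/(_ r 0); rewrite /lin !map_mx_idm -!row_mul !mxE => e.
  by rewrite mulrC e; ring.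
by split; apply: at_row.
Qed.

Lemma standard_centres :
  [/\ E i1 *m N_mx (idm K) (vec3 1 0 0 0) = 0, E i2 *m N_mx (idm K) (vec3 0 1 0 0) = 0,
      E i3 *m N_mx (idm K) (vec3 0 0 1 0) = 0 & E i4 *m N_mx (idm K) (vec3 1 1 1 0) = 0].
Proof.
split; apply: incident_lineI;
  by rewrite !vec3E ?Eh ?E4_21 ?E4_12 ?E4_31 // ?mulr0 ?mulr1 ?scale1r ?scale0r ?scaler0.
Qed.

(** On E_1, E_2 and E_3 a column of M(x) vanishes, and on the other E_i the rows
    of M(x) have constant directions. *)
Lemma E_centre i : exists y : 'rV[K]_3, y != 0 /\ E i *m N_mx (idm K) (y 0) = 0.
Proof.
have v0 (y : 'rV[K]_3) j : y 0 j = 1 -> y != 0.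
  by move=> y1; apply: contra (oner_neq0 K) => /eqP y0; rewrite -y1 y0 mxE.
have [ei1 ei2 ei3 _] := standard_centres.
have [->|ni1] := eqVneq i i1.
  by exists (vec3 1 0 0); split; rewrite ?ei1 //; apply: (v0 _ 0); rewrite vec3E.
have [->|ni2] := eqVneq i i2.
  by exists (vec3 0 1 0); split; rewrite ?ei2 //; apply: (v0 _ 1); rewrite vec3E.
have [->|ni3] := eqVneq i i3.
  by exists (vec3 0 0 1); split; rewrite ?ei3 //; apply: (v0 _ o2); rewrite vec3E.
have [t t0 et] := E_ratio n21 n23 ni2 ni1 ni3.
have [u u0 eu] := E_ratio n12 n13 ni1 ni2 ni3.
have [v vn0 ev] := E_ratio n31 n32 ni3 ni1 ni2.
exists (vec3 (a / t) (b / u) 1); split; first by apply: (v0 _ o2); rewrite vec3E.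
have rel : a * u * v = b * d * t.
  have ef : f = (m * a) *: trihedral1 + - (m * (b * d)) *: trihedral2.
    by rewrite f_det scalerBr !scalerA scaleNr.
  apply: (mulfI m0); apply: subr0_eq.
  by rewrite -(trihedral_relation ni1 ni2 ni3 ef et eu ev); ring.
apply: incident_lineI; rewrite !vec3E ?et ?eu ?ev !scalerA ?mulr1; congr (_ *: _).
- by rewrite divfK.
- by rewrite divfK.
- transitivity (a * u * v / (t * u)); first by field; rewrite ?t0 ?u0.
  by rewrite rel; field; rewrite ?t0 ?u0.
Qed.

(** * The inverse of the contraction *)

(** The left kernel of N(y): cubic forms, whose common zeros are the centres. *)
Definition inverse_form (k : 'I_4) : {mpoly K[3]} :=
  minors (N_mx (@mpolyC 3 K) (fun i => 'X_i)) 0 k.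

Lemma evalv_inverse_form (L : fieldType) (s : {rmorphism K -> L}) (y : 'rV[L]_3) :
  evalv inverse_form s y = minors (N_mx s (y 0)).
Proof.
pose ev : {rmorphism {mpoly K[3]} -> L} := mmap s (y 0).
have evN : map_mx ev (N_mx (@mpolyC 3 K) (fun i => 'X_i)) = N_mx s (y 0).
  apply/matrixP => i; apply: ord3P; rewrite !mxE ?inordK //=;
    by rewrite mmapB !rmorphM /= !mmapX !mmap1U !mmapC.
apply/rowP => k; rewrite !mxE -evN -map_row' det_map_mx.
have -> : (-1) ^+ k = ev ((-1) ^+ k) :> L by rewrite rmorphXn rmorphN1.
by rewrite -rmorphM /inverse_form mxE.
Qed.

Lemma dhomog_inverse_form k : inverse_form k \is 3.-homog.
Proof.
rewrite /inverse_form mxE -signr_odd mulr_sign; set D := \det _.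
have hD : D \is (\sum_(i < 3) 1)%N.-homog.
  apply: rpred_sum => p _; rewrite rpredMsign; apply: dhomog_bigprod => i.
  rewrite mxE mxE; move: (p i); apply: ord3P;
    by rewrite ?inordK //= !mul_mpolyC rpredB ?rpredZ ?dhomog_monomial ?mdeg1.
rewrite sum_nat_const card_ord muln1 in hD.
by case: ifP; rewrite ?rpredN.
Qed.

Lemma N_mxZ (L : fieldType) (s : {rmorphism K -> L}) t (y : 'rV[L]_3) :
  N_mx s ((t *: y) 0) = t *: N_mx s (y 0).
Proof.
by apply/matrixP => i; apply: ord3P; rewrite !mxE ?inordK //=; ring.
Qed.

Lemma map_N_mx (L L' : fieldType) (s : {rmorphism K -> L}) (s' : {rmorphism L -> L'})
    (y : 'rV[L]_3) :
  map_mx s' (N_mx s (y 0)) = N_mx (s' \o s) (map_mx s' y 0).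
Proof.
by apply/matrixP => i; apply: ord3P; rewrite !mxE ?inordK //= rmorphB !rmorphM.
Qed.

(** Each coordinate of y is isolated by evaluating an equation of the incidence
    variety on a line E_i on which one of its two linear forms vanishes. *)
Lemma N_mx_neq0 (y : 'rV[K]_3) : y != 0 -> N_mx (idm K) (y 0) != 0.
Proof.
move=> y0; apply/negP => /eqP N0.
have inc x : incident (idm K) x y by apply/N_mxP; rewrite N0 mulmx0.
have pick (l : 'M[K]_(2, 4)) (c : 'cV[K]_4) : l *m c != 0 ->
    exists x : 'rV[K]_4, (x <= l)%MS /\ lin c (idm K) x != 0.
  by case/mulmx_neq0_row => x xl xc; exists x; rewrite /lin map_mx_idm.
have lin0 (l : 'M[K]_(2, 4)) (c : 'cV[K]_4) x : l *m c = 0 -> (x <= l)%MS ->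
    lin c (idm K) x = 0.
  by move=> lc /submxP[D ->]; rewrite /lin map_mx_idm -mulmxA lc mulmx0 mxE.
have y2 : y 0 o2 = 0.
  have [x [xE hx]] := pick _ _ (Eh_neq0 n23 n13).
  have [+ _ _] := inc x; rewrite (lin0 (E i1)) ?Eh // mul0r => /esym/eqP.
  by rewrite !mulf_eq0 fmorph_eq0 (negPf a0) (negPf hx) => /eqP.
have y00 : y 0 0 = 0.
  have [x [xE hx]] := pick _ _ (Eh_neq0 n21 n31).
  have [+ _ _] := inc x; rewrite y2 mulr0 => /eqP.
  by rewrite mulf_eq0 (negPf hx) => /eqP.
have y1 : y 0 1 = 0.
  have [x [xE hx]] := pick _ _ (Eh_neq0 n12 n32).
  have [_ + _] := inc x; rewrite y2 mulr0 => /eqP.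
  by rewrite mulf_eq0 (negPf hx) => /eqP.
by case/eqP: y0; rewrite [y]vec3_eta y1 y00 -/o2 y2; apply/rowP; apply: ord3P; rewrite vec3E mxE.
Qed.

Lemma line_incident (l : 'M[K]_(2, 4)) (y : 'rV[K]_3) (L : fieldType)
    (s : {rmorphism K -> L}) (x : 'rV[L]_4) : l *m N_mx (idm K) (y 0) = 0 ->
  (x <= map_mx s l)%MS -> incident s x (map_mx s y).
Proof.
move=> lN /submxP[D ->]; apply/N_mxP.
have := congr1 (map_mx s) lN; rewrite map_mxM map_mx0.
rewrite (map_N_mx (idm K) s) -mulmxA => e.
have -> : N_mx s (map_mx s y 0) = N_mx (s \o idm K) (map_mx s y 0) by [].
by rewrite e mulmx0.
Qed.

Lemma contracts_incident (l : 'M[K]_(2, 4)) (y : 'rV[K]_3) : y != 0 ->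
  l *m N_mx (idm K) (y 0) = 0 -> contracts_to contraction l y.
Proof.
move=> y0 lN L s x [x0 xl]; have ys0 : map_mx s y != 0 by rewrite map_mx_eq0.
have xy := line_incident lN xl.
exact: (incident_contraction (incident_surface x0 ys0 xy)).
Qed.

Section Centres.

Variable centre : 'I_6 -> 'rV[K]_3.
Hypothesis centre_neq0 : forall i, centre i != 0.
Hypothesis centreP : forall i, E i *m N_mx (idm K) (centre i 0) = 0.

Lemma E_incident (L : fieldType) (s : {rmorphism K -> L}) i (x : 'rV[L]_4) :
  (x <= map_mx s (E i))%MS -> incident s x (map_mx s (centre i)).
Proof. exact: line_incident. Qed.

Let map_centre_neq0 (L : fieldType) (s : {rmorphism K -> L}) i :
  map_mx s (centre i) != 0.
Proof. by rewrite map_mx_eq0. Qed.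

(** A matrix N(y) killing two skew lines would vanish. *)
Lemma centre_distinct (L : fieldType) (s : {rmorphism K -> L}) i j : i != j ->
  ~ proj_eq (map_mx s (centre i)) (map_mx s (centre j)).
Proof.
move=> ij /proj_eq_par ppar.
have pK : par (centre i 0) (centre j 0).
  by move=> k l; apply: (fmorph_inj s); have := ppar k l; rewrite !mxE !rmorphM.
have [_ [t t0 et]] := par_proj_eq (centre_neq0 i) (centre_neq0 j) pK.
case/eqP: (N_mx_neq0 (centre_neq0 i)).
apply: skew_inj (rE i) (rE j) (E_skew ij) (centreP i) _.
have := centreP j; rewrite et N_mxZ -scalemxAr => /eqP.
by rewrite scalemx_eq0 (negPf t0) => /eqP.
Qed.

(** If the kernel of N(y) contains two points, it contains the line joining
    them, which therefore lies on S and is contracted to y; among the 27 lines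
    the G_k and F_kl meet two of the E_i, which have different images. *)
Lemma incident_two_points (L : fieldType) (s : {rmorphism K -> L})
    (z1 z2 : 'rV[L]_4) (y : 'rV[L]_3) :
  y != 0 -> z1 != 0 -> ~~ (z2 <= z1)%MS -> incident s z1 y -> incident s z2 y ->
  exists i, [/\ proj_eq (map_mx s (centre i)) y, (z1 <= map_mx s (E i))%MS
    & (z2 <= map_mx s (E i))%MS].
Proof.
move=> y0 z10 z21 inc1 inc2.
have [l [rl /eqmxP el]] := line_of_rank (rank_points z10 z21).
have lN : l *m N_mx s (y 0) = 0.
  apply/sub_kermxP; rewrite el addsmx_sub.
  by apply/andP; split; apply/sub_kermxP/N_mxP.
have z1l : (z1 <= l)%MS by rewrite el addsmxSl.
have z2l : (z2 <= l)%MS by rewrite el addsmxSr.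
have inc (x : 'rV[L]_4) : (x <= l)%MS -> incident s x y.
  by case/submxP => D ->; apply/N_mxP; rewrite -mulmxA lN mulmx0.
have lf : line_on (map_mpoly s f) l.
  split=> // L' s' x [x0 /submxP[D ex]]; split=> //; rewrite evalp_map_mpoly.
  have [] := @incident_surface L' (s' \o s) x (map_mx s' y) => //.
    by rewrite map_mx_eq0.
  by apply/N_mxP; rewrite -map_N_mx ex -mulmxA -map_mxM lN map_mx0 mulmx0.
have onE i (x : 'rV[L]_4) : x != 0 -> (x <= l)%MS -> (x <= map_mx s (E i))%MS ->
    proj_eq (map_mx s (centre i)) y.
  move=> x0 xl xE; have Sx := incident_surface x0 y0 (inc x xl).
  apply: (proj_eq_trans (y := contraction s x)).
    exact/proj_eq_sym/(incident_contraction Sx (map_centre_neq0 s i))/E_incident.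
  by apply: incident_contraction => //; apply: inc.
have two (l' : 'M[K]_(2, 4)) i j : i != j -> meets l' (E i) -> meets l' (E j) ->
    ~ (l == map_mx s l')%MS.
  move=> ij /meetsP[x [x0 xl xi]] /meetsP[x' [x0' xl' xj]] /eqmxP e.
  apply: (@centre_distinct _ s _ _ ij); apply: (proj_eq_trans (y := y)).
    by apply: (onE i (map_mx s x)); rewrite ?map_mx_eq0 ?map_submx // e map_submx.
  apply: proj_eq_sym.
  by apply: (onE j (map_mx s x')); rewrite ?map_mx_eq0 ?map_submx // e map_submx.
case: f_lines => _ _ _ _ /(_ L s l lf)[[i e]|[i e]|[i [j [ij e]]]].
- have /eqmxP e' := e; exists i; split; rewrite -?e' //.
  by apply: (onE i z1) => //; rewrite -e'.
- have [k1 [k2 [_ [[/andP[n1 _] /andP[n2 _] _] [k12 _ _]]]]] := three_others i i.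
  by case: (two (G i) _ _ k12 _ _ e); rewrite G_meets_E.
- by case: (two (F i j) _ _ ij _ _ e); rewrite F_meets_E // eqxx ?orbT.
Qed.

Lemma incident_unique (L : fieldType) (s : {rmorphism K -> L}) (z1 z2 : 'rV[L]_4) y :
  plane_minus centre s y -> z1 != 0 -> incident s z1 y -> incident s z2 y -> (z2 <= z1)%MS.
Proof.
move=> [y0 yc] z10 inc1 inc2; apply: contraT => z21.
by have [i [/yc]] := incident_two_points y0 z10 z21 inc1 inc2.
Qed.

Lemma inverse_incident (L : fieldType) (s : {rmorphism K -> L}) y :
  plane_minus centre s y ->
  evalv inverse_form s y != 0 /\ incident s (evalv inverse_form s y) y.
Proof.
move=> gy; rewrite evalv_inverse_form; split; last by apply/N_mxP/minors_ker.
by apply: minors_neq0 => z z' z0 /N_mxP iz /N_mxP iz'; apply: incident_unique gy z0 iz iz'.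
Qed.

Lemma inverse_surface (L : fieldType) (s : {rmorphism K -> L}) y :
  plane_minus centre s y -> surface_minus_E f E s (evalv inverse_form s y).
Proof.
move=> gy; have [z0 iz] := inverse_incident gy; have [y0 yc] := gy.
have Sz := incident_surface z0 y0 iz; split=> // i [_ zE].
apply: (yc i); apply: (proj_eq_trans (y := contraction s (evalv inverse_form s y))).
  exact/proj_eq_sym/(incident_contraction Sz (map_centre_neq0 s i))/E_incident.
exact: incident_contraction.
Qed.

Lemma contraction_inverse (L : fieldType) (s : {rmorphism K -> L}) y :
  plane_minus centre s y -> proj_eq (contraction s (evalv inverse_form s y)) y.
Proof.
move=> gy; have [z0 iz] := inverse_incident gy; have [y0 _] := gy.
exact: incident_contraction (incident_surface z0 y0 iz) y0 iz.
Qed.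

(** If x had the image of E_i, then incident_two_points applied to x and a point
    of E_i would put x on one of the contracted lines. *)
Lemma contraction_outside (L : fieldType) (s : {rmorphism K -> L}) x :
  surface_minus_E f E s x -> plane_minus centre s (contraction s x).
Proof.
move=> [Sx xE]; have y0 := contraction_neq0 Sx; split=> // i ci.
have [x0 _] := Sx; have rEs : \rank (map_mx s (E i)) = 2%N by rewrite mxrank_map rE.
pose e := nz_row (map_mx s (E i)).
have eE : (e <= map_mx s (E i))%MS := nz_row_sub _.
have e0 : e != 0 by rewrite nz_row_eq0 -mxrank_eq0 rEs.
have [xe|xe] := boolP (x <= e)%MS.
  by apply: (xE i); split=> //; apply: submx_trans xe eE.
have [_ [t t0 et]] := ci.
have inc_e : incident s e (contraction s x).
  apply/N_mxP; rewrite et N_mxZ -scalemxAr.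
  by have /N_mxP -> := E_incident eE; rewrite scaler0.
have [j [_ _ xj]] := incident_two_points y0 e0 xe inc_e (contraction_incident Sx).
by apply: (xE j).
Qed.

Lemma inverse_contraction (L : fieldType) (s : {rmorphism K -> L}) x :
  surface_minus_E f E s x -> proj_eq (evalv inverse_form s (contraction s x)) x.
Proof.
move=> /[dup] Xx [Sx xE]; have gy := contraction_outside Xx.
have [z0 iz] := inverse_incident gy; have [x0 _] := Sx.
have /sub_rVP[t et] := incident_unique gy z0 iz (contraction_incident Sx).
split=> //; exists t => //.
by apply: contra x0 => /eqP t0; rewrite et t0 scale0r.
Qed.

Lemma contraction_contracts i : contracts_to contraction (E i) (centre i).
Proof. exact: contracts_incident. Qed.

Lemma contraction_blow_down : blow_down f E contraction.
Proof.
split.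
  split; first exact: contraction_regular.
  by move=> L s x; apply: contraction_neq0.
exists centre; split; first exact: contraction_contracts.
split.
  split; first by apply: contraction_regular => L s x [].
  by move=> L s x; apply: contraction_outside.
exists (evalv inverse_form); split.
- split; last by move=> L s y; apply: inverse_surface.
  move=> L s y gy; exists 3%N, inverse_form; split; first exact: dhomog_inverse_form.
    by have [] := inverse_incident gy.
  by move=> L' s' y' _ nz; apply: proj_eq_refl.
- by move=> L s x; apply: inverse_contraction.
- by move=> L s y; apply: contraction_inverse.
Qed.

Lemma contraction_normalized : normalized_blow_down f E contraction.
Proof.
have [e1 e2 e3 e4] := standard_centres; have o := oner_neq0 K.
by split; [apply: contraction_blow_down | apply: contracts_incident.. ] => //;
  apply: vec3_neq0; auto.
Qed.

(** * Uniqueness of the contraction *)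

Section Uniqueness.

Variable phi : proj_map K 3 2.
Hypothesis phi_regular : regular (surface f) phi.
Variable c : 'I_6 -> 'rV[K]_3.
Hypothesis phi_contracts : forall i, contracts_to phi (E i) (c i).
Hypothesis phi_maps : forall (L : fieldType) (s : {rmorphism K -> L}) x,
  surface_minus_E f E s x -> plane_minus c s (phi s x).
Variable rho : proj_map K 2 3.
Hypothesis rho_regular : regular (plane_minus c) rho.
Hypothesis rho_phi : eq_on (surface_minus_E f E)
  (fun L s x => rho s (phi s x)) (fun L s x => x).

Let tau : proj_map K 2 2 := fun L s y => phi s (evalv inverse_form s y).

(** Local forms of phi compose with the cubics that invert the contraction, and
    local forms of the inverse of phi compose with the charts. *)
Lemma transition_local (L : fieldType) (s : {rmorphism K -> L}) y :
  plane_minus centre s y -> exists d1 P e1 Q,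
  [/\ local_rep centre tau d1 P e1 Q, evalv P s y != 0 & evalv Q s (evalv P s y) != 0].
Proof.
move=> gy; have Xx := inverse_surface gy; set x := evalv _ _ _ in Xx.
have [Sx _] := Xx.
have [d1 [P [hP Px eP]]] := phi_regular Sx.
have gz := phi_maps Xx; have phiP := eP _ _ _ Sx Px.
have gPx : plane_minus c s (evalv P s x) := plane_minus_proj_eq phiP gz.
have [e1 [Q [hQ Qz eQ]]] := rho_regular gPx.
have rho_proj (L' : fieldType) (s' : {rmorphism K -> L'}) x' : surface_minus_E f E s' x' ->
    evalv P s' x' != 0 -> evalv Q s' (evalv P s' x') != 0 ->
    proj_eq x' (evalv Q s' (evalv P s' x')).
  move=> Xx' Px' Qx'; have [Sx' _] := Xx'.
  have gz' := phi_maps Xx'; have phiP' := eP _ _ _ Sx' Px'.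
  have gP' := plane_minus_proj_eq phiP' gz'.
  apply: (proj_eq_trans (proj_eq_sym (rho_phi Xx')) _).
  exact: (proj_eq_trans (regular_proj_eq rho_regular gz' gP' phiP') (eQ _ _ _ gP' Qx')).
have [C [hC Cx eC]] := contraction_local Sx.
have C_proj (L' : fieldType) (s' : {rmorphism K -> L'}) x' x'' : proj_eq x' x'' ->
    exists2 t, t != 0 & evalv C s' x'' = t *: evalv C s' x'.
  move=> [_ [t t0 ->]]; exists (t ^+ 2); first by rewrite expf_neq0.
  by rewrite (evalv_homogZ _ _ _ hC).
exists (3 * d1)%N, (fun k => mcomp (P k) inverse_form), (e1 * 2)%N, (fun k => mcomp (C k) Q).
rewrite !evalv_mcomp -/x; split=> //; last first.
  have [t t0 ->] := C_proj L s _ _ (rho_proj _ _ _ Xx Px Qz).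
  by rewrite scaler_eq0 negb_or t0.
split=> [k|k|L' s' y' gy'].
- exact: dhomog_mcomp dhomog_inverse_form.
- exact: dhomog_mcomp hQ.
rewrite !evalv_mcomp; have Xx' := inverse_surface gy'; have [Sx' _] := Xx'.
set x' := evalv inverse_form s' y' in Xx' Sx' *; move=> Px'.
split; first exact: eP.
set z' := evalv P s' x' in Px' *; have [z0|Qz'] := eqVneq (evalv Q s' z') 0.
  by rewrite z0 (evalv0 s' _ hC) ?eqxx.
have xz := rho_proj _ _ _ Xx' Px' Qz'.
have [t t0 et] := C_proj L' s' _ _ xz; rewrite -/z' in et *; rewrite et.
rewrite scaler_eq0 negb_or => /andP[_ Cx'].
apply: (proj_eq_trans (proj_eq_sym (contraction_inverse gy'))).
by apply: (proj_eq_trans (eC _ _ _ Sx' Cx')); split=> //; exists t.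
Qed.

Variable A : 'M[K]_3.
Hypothesis uA : A \in unitmx.
Hypothesis tauA : forall (L : fieldType) (s : {rmorphism K -> L}) y,
  plane_minus centre s y -> proj_eq (tau s y) (y *m map_mx s A).

Lemma phi_linear (L : fieldType) (s : {rmorphism K -> L}) x : surface_minus_E f E s x ->
  proj_eq (phi s x) (contraction s x *m map_mx s A).
Proof.
move=> Xx; have gy := contraction_outside Xx; have xx := inverse_contraction Xx.
have [Sx _] := Xx; have [Sx' _] := inverse_surface gy.
apply: proj_eq_trans (tauA gy); apply: proj_eq_sym.
exact: regular_proj_eq phi_regular Sx' Sx xx.
Qed.

(** Both maps are regular at the point where E_i meets a line G_j, and they
    agree at the general point of G_j, hence also there. *)
Lemma centre_linear i : proj_eq (c i) (centre i *m A).
Proof.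
have [j [_ [_ [[/andP[ji _] _ _] _]]]] := three_others i i.
have ij : i != j by rewrite eq_sym.
have /meetsP[x [x0 xG xE]] : meets (G j) (E i) by rewrite G_meets_E.
have Sx : surface f (idm K) x.
  by split=> //; rewrite -meval_evalp; apply: (@vanE i x xE).
have [e [P [hP Px eP]]] := phi_regular Sx.
have [C [hC Cx eC]] := contraction_local Sx.
pose CA k := \sum_l A l k *: C l.
have evCA (L : fieldType) (s : {rmorphism K -> L}) z :
    evalv CA s z = evalv C s z *m map_mx s A.
  apply/rowP => k; rewrite !mxE evalp_sum; apply: eq_bigr => l _.
  by rewrite evalpZ !mxE mulrC.
have /choice[k' hk'] : forall k : 'I_6, exists k' : 'I_6, k' != k /\ k' != j.
  by move=> k; have [k' [_ [_ [[/andP[a1 a2] _ _] _]]]] := three_others k j; exists k'.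
have van k l : vanish_on (G j) (P k * CA l - P l * CA k).
  have : vanish_on (G j) ((P k * CA l - P l * CA k) * \prod_(i' < 6) mlin (h (k' i') i')).
    move=> z zG; rewrite mevalM; apply/eqP; rewrite mulf_eq0 orbC.
    have [//|/= nz] := boolP ((\prod_(i' < 6) mlin (h (k' i') i')).@[z 0] == 0).
    move: nz; rewrite rmorph_prod => /prodf_neq0 nz0.
    have nz i' : (mlin (h (k' i') i')).@[z 0] != 0 by apply: nz0.
    have z0 : z != 0 by apply: contraTneq (nz i1) => ->; rewrite negbK meval_mlin mul0mx mxE.
    have Sz : surface f (idm K) z.
      by split=> //; rewrite -meval_evalp; apply: (@vanG j z zG).
    have Xz : surface_minus_E f E (idm K) z.
      split=> // i' [_ /submxP[D eD]]; case/eqP: (nz i'); rewrite meval_mlin eD map_mx_idm.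
      by rewrite -mulmxA Eh ?mulmx0 ?mxE //; have [] := hk' i'.
    rewrite mevalB !mevalM !meval_evalp.
    have [Pz|Pz] := eqVneq (evalv P (idm K) z) 0.
      have z' r : evalp (P r) (idm K) z = 0 by have /rowP/(_ r) := Pz; rewrite !mxE.
      by rewrite !z' !mul0r subrr.
    have [Cz|Cz] := eqVneq (evalv C (idm K) z) 0.
      have z' r : evalp (CA r) (idm K) z = 0.
        by have := evCA _ (idm K) z; rewrite Cz mul0mx => /rowP/(_ r); rewrite !mxE.
      by rewrite !z' !mulr0 subrr.
    have e1 := proj_eq_sym (eP _ _ _ Sz Pz).
    have uA' : map_mx (idm K) A \in unitmx by rewrite map_unitmx.
    have e2 := proj_eq_mulmx uA' (eC _ _ _ Sz Cz).
    have := proj_eq_trans e1 (proj_eq_trans (phi_linear Xz) e2).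
    rewrite -evCA => /proj_eq_par/(_ k l).
    by rewrite !mxE => ->; rewrite subrr.
  case/(vanish_prime charK) => // vp; have {vp} : exists i', vanish_on (G j) (mlin (h (k' i') i')).
    move: vp; elim/big_ind: _ => [/(_ 0)|p q IHp IHq /(vanish_prime charK)[]|i' _] //.
    - by rewrite sub0mx meval1 => /(_ isT)/eqP; rewrite oner_eq0.
    - by exists i'.
  case=> i' /vanish_mlin z; have [n1 n2] := hk' i'.
  by have := @Gh_neq0 (k' i') i' j n1; rewrite z eqxx eq_sym n2 => /(_ isT).
have PC : proj_eq (evalv P (idm K) x) (evalv CA (idm K) x).
  apply: par_proj_eq => //.
    rewrite evCA map_mx_idm; apply: contra Cx => /eqP z.
    by rewrite -(mulmxK uA (evalv C _ x)) z mul0mx.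
  move=> k l; have := van k l x xG; rewrite mevalB !mevalM !meval_evalp !mxE.
  exact: subr0_eq.
have onE : on_line (E i) (idm K) x by split; rewrite ?map_mx_idm.
have ci := phi_contracts onE; have c0i := contraction_contracts onE.
rewrite !map_mx_idm in ci c0i.
apply: (proj_eq_trans (proj_eq_sym ci) (proj_eq_trans (eP _ _ _ Sx Px) _)).
apply: (proj_eq_trans PC); rewrite evCA map_mx_idm; apply: proj_eq_mulmx => //.
exact: (proj_eq_trans (proj_eq_sym (eC _ _ _ Sx Cx)) c0i).
Qed.

Hypotheses (n1 : contracts_to phi (E i1) (vec3 1 0 0))
  (n2 : contracts_to phi (E i2) (vec3 0 1 0)) (n3 : contracts_to phi (E i3) (vec3 0 0 1))
  (n4 : contracts_to phi (E i4) (vec3 1 1 1)).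

Lemma contracts_to_unique (psi : proj_map K 3 2) i (y y' : 'rV[K]_3) :
  contracts_to psi (E i) y -> contracts_to psi (E i) y' -> proj_eq y y'.
Proof.
move=> ey ey'; pose x := nz_row (E i).
have onE : on_line (E i) (idm K) x.
  by split; rewrite ?map_mx_idm ?nz_row_sub // nz_row_eq0 -mxrank_eq0 rE.
have := ey _ _ _ onE; have := ey' _ _ _ onE; rewrite !map_mx_idm => e' e.
exact: (proj_eq_trans (proj_eq_sym e) e').
Qed.

(** A fixes four points in general position. *)
Lemma linear_scalar : exists2 t, t != 0 & A = t%:M.
Proof.
have [_ m1 m2 m3 m4] := contraction_normalized.
have fixed i v : contracts_to phi (E i) v -> contracts_to contraction (E i) v ->
    proj_eq v (v *m A).
  move=> hp hc; have e1 := contracts_to_unique hp (@phi_contracts i).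
  have e2 := contracts_to_unique (@contraction_contracts i) hc.
  apply: (proj_eq_trans e1); apply: (proj_eq_trans (centre_linear i)).
  exact: proj_eq_mulmx.
have [_ [t1 _ e1]] := fixed _ _ n1 m1; have [_ [t2 _ e2]] := fixed _ _ n2 m2.
have [_ [t3 _ e3]] := fixed _ _ n3 m3; have [_ [t t0 e4]] := fixed _ _ n4 m4.
exists t => //.
have sum1 : vec3 1 1 1 = vec3 1 0 0 + vec3 0 1 0 + vec3 0 0 1 :> 'rV[K]_3.
  by apply/rowP; apply: ord3P; rewrite [RHS]mxE [X in _ = X + _]mxE !vec3E ?addr0 ?add0r.
have ets : t *: vec3 1 1 1 = vec3 t1 t2 t3.
  rewrite -e4 sum1 !mulmxDl e1 e2 e3; apply/rowP; apply: ord3P;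
  by rewrite !mxE ?inordK //= ?mulr0 ?mulr1 ?addr0 ?add0r.
have [et1 et2 et3] : [/\ t = t1, t = t2 & t = t3].
  have e j := congr1 (fun v : 'rV[K]_3 => v 0 j) ets.
  have := e 0; have := e 1; have := e (inord 2); rewrite /= !vec3E.
  by rewrite !mxE ?inordK //= !mulr1.
apply/row_matrixP; apply: ord3P; rewrite rowE [RHS]rowE mul_mx_scalar.
- rewrite (_ : delta_mx 0 0 = vec3 1 0 0) ?e1 ?et1 //.
  by apply/rowP; apply: ord3P; rewrite vec3E mxE -?val_eqE /= ?inordK.
- rewrite (_ : delta_mx 0 1 = vec3 0 1 0) ?e2 ?et2 //.
  by apply/rowP; apply: ord3P; rewrite vec3E mxE -?val_eqE /= ?inordK.
- rewrite (_ : delta_mx 0 (inord 2) = vec3 0 0 1) ?e3 ?et3 //.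
  by apply/rowP; apply: ord3P; rewrite vec3E mxE -?val_eqE /= ?inordK.
Qed.

Lemma phi_contraction : eq_on (surface f) phi contraction.
Proof.
have [t t0 eA] := linear_scalar; move=> L s x Sx.
have scal (v : 'rV[L]_3) : v != 0 -> proj_eq (v *m map_mx s A) v.
  move=> v0; apply: proj_eq_sym; split=> //; exists (s t); first by rewrite fmorph_eq0.
  by rewrite eA map_scalar_mx mul_mx_scalar.
have [[i xE]|nE] := pselect (exists i, on_line (E i) s x); last first.
  have Xx : surface_minus_E f E s x by split=> // i xE; apply: nE; exists i.
  by apply: proj_eq_trans (phi_linear Xx) (scal _ _); apply: contraction_neq0.
have [ci0 [u u0 eu]] := centre_linear i.
apply: proj_eq_trans (phi_contracts xE) _; apply: proj_eq_sym.
apply: proj_eq_trans (contraction_contracts xE) _; apply: proj_eq_sym.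
apply: (proj_eq_trans (y := map_mx s (centre i) *m map_mx s A)).
  split; first by rewrite map_mx_eq0.
  exists (s u); first by rewrite fmorph_eq0.
  by rewrite -map_mxM eu map_mxZ.
by apply: scal; rewrite map_mx_eq0.
Qed.

End Uniqueness.

Lemma normalized_blow_down_unique phi : normalized_blow_down f E phi ->
  eq_on (surface f) phi contraction.
Proof.
case=> -[[reg _] [c [ctr [[_ maps] [rho [[rreg rmaps] rphi _]]]]]] n1 n2 n3 n4.
have tloc := transition_local reg maps rreg rphi.
have [A [uA tauA]] := plane_iso_linear charK centre_neq0 tloc.
exact: (phi_contraction reg ctr uA tauA n1 n2 n3 n4).
Qed.

(** A point of E_4 on neither H_ij nor H_ji: these planes contain G_i, G_j and
    F_ij. *)
Lemma E4_chart_point i j : i != j -> i4 != i -> i4 != j -> exists q : 'rV[K]_4,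
  on_line (E i4) (idm K) q /\ U f G F i j (idm K) q.
Proof.
move=> ij n4i n4j; have ji : j != i by rewrite eq_sym.
have [||x [xE _ xh]] := @generic_point K charK _ _ (E i4) [:: h i j; h j i] 1.
- by move=> y; rewrite !inE => /orP[] /eqP->; apply: Eh_neq0.
- by move/(_ 0); rewrite sub0mx meval1 => /(_ isT)/eqP; rewrite oner_eq0.
have xij : x *m h i j != 0 by apply: xh; rewrite mem_head.
have xji : x *m h j i != 0 by apply: xh; rewrite !inE eqxx orbT.
have x0 : x != 0 by apply: contraNneq xij => ->; rewrite mul0mx.
have off l (y : 'cV[K]_4) : x *m y != 0 -> l *m y = 0 -> ~ on_line l (idm K) x.
  by move=> xy ly [_ /submxP[D e]]; case/eqP: xy; rewrite e map_mx_idm -mulmxA ly mulmx0.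
exists x; split; first by split; rewrite ?map_mx_idm.
split; [|apply: off xij _|apply: off xji _|apply: off xij _]; rewrite ?Gh ?Fh //.
by split=> //; rewrite -meval_evalp; apply: (@vanE i4 x xE).
Qed.

Lemma given_on_charts phi : eq_on (surface f) phi contraction ->
  [/\ given_on f E G F phi i1 i2 (chart12 h),
      given_on f E G F phi i1 i3 (chart13 h)
    & given_on f E G F phi i2 i3 (chart23 h)].
Proof.
move=> phic; have [_ _ _ _ c4] := contraction_normalized.
have one0 := oner_neq0 K.
have vec1 (s : {rmorphism K -> K}) : map_mx s (vec3 1 1 1) = vec3 1 1 1 :> 'rV[K]_3.
  by apply/rowP; apply: ord3P; rewrite mxE !vec3E rmorph1.
split.
- exists a, b, 1; split=> // [L s x Ux|u v w uvw].
    have Sx : surface f s x by case: Ux.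
    apply: proj_eq_trans (phic _ _ _ Sx) _; apply: incident_contraction => //.
      exact: chart12_neq0. exact: chart12_incident.
  have [q [qE qU]] := E4_chart_point n12 isT isT; have Sq : surface f (idm K) q by case: qU.
  have := c4 _ _ _ qE; rewrite vec1 => c4q.
  apply: constants_unique (uvw _ _ _ (conj qE qU)).
  apply: proj_eq_trans c4q; apply: proj_eq_sym.
  exact: (incident_contraction Sq (chart12_neq0 qU) (chart12_incident Sq)).
- exists (b * d), b, 1; split=> // [|L s x Ux|u v w uvw]; first by split; rewrite ?mulf_neq0.
    have Sx : surface f s x by case: Ux.
    apply: proj_eq_trans (phic _ _ _ Sx) _; apply: incident_contraction => //.
      exact: chart13_neq0. exact: chart13_incident.
  have [q [qE qU]] := E4_chart_point n13 isT isT; have Sq : surface f (idm K) q by case: qU.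
  have := c4 _ _ _ qE; rewrite vec1 => c4q.
  apply: constants_unique (uvw _ _ _ (conj qE qU)).
  apply: proj_eq_trans c4q; apply: proj_eq_sym.
  exact: (incident_contraction Sq (chart13_neq0 qU) (chart13_incident Sq)).
- exists a, (a / d), 1; split=> // [|L s x Ux|u v w uvw].
  + by split; rewrite ?mulf_neq0 ?invr_eq0.
  + have Sx : surface f s x by case: Ux.
    apply: proj_eq_trans (phic _ _ _ Sx) _; apply: incident_contraction => //.
      exact: chart23_neq0. exact: chart23_incident.
  have [q [qE qU]] := E4_chart_point n23 isT isT; have Sq : surface f (idm K) q by case: qU.
  have := c4 _ _ _ qE; rewrite vec1 => c4q.
  apply: constants_unique (uvw _ _ _ (conj qE qU)).
  apply: proj_eq_trans c4q; apply: proj_eq_sym.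
  exact: (incident_contraction Sq (chart23_neq0 qU) (chart23_incident Sq)).
Qed.

End Centres.
End Contraction.

End Configuration.

(** * The blow-down of a smooth cubic surface *)

(** Characteristic zero enters through Euler's relation and the existence of
    general rational points. *)
Theorem smooth_cubic_blow_down (K : fieldType) (charK : [pchar K] =i pred0)
    (f : {mpoly K[4]}) (E G : 'I_6 -> 'M[K]_(2, 4)) (F : 'I_6 -> 'I_6 -> 'M[K]_(2, 4))
    (h : 'I_6 -> 'I_6 -> 'cV[K]_4) :
  f \is 3.-homog -> smooth f -> lines27 f E G F ->
  (forall i j, i != j -> defines_plane (h i j) (G i + E j)%MS) ->
  [/\ forall (L : fieldType) (s : {rmorphism K -> L}) q,
        surface f s q <->
        U f G F i1 i2 s q \/ U f G F i1 i3 s q \/ U f G F i2 i3 s q,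
      exists pi, normalized_blow_down f E pi,
      forall pi pi', normalized_blow_down f E pi ->
        normalized_blow_down f E pi' -> eq_on (surface f) pi pi'
    & forall pi, normalized_blow_down f E pi ->
        [/\ given_on f E G F pi i1 i2 (chart12 h),
            given_on f E G F pi i1 i3 (chart13 h)
          & given_on f E G F pi i2 i3 (chart23 h)]].
Proof.
move=> f_cubic f_smooth f_lines h_def.
have [a [b [d [m [[a0 b0 d0 m0] f_det [e21 e12 e31]]]]]] :=
  determinantal_constants charK f_cubic f_smooth f_lines h_def.
have /choice[centre centreP] :=
  E_centre charK f_cubic f_lines h_def m0 f_det e21 e12 e31.
have centre0 i : centre i != 0 by have [] := centreP i.
have centreN i : E i *m N_mx h a b d (idm K) (centre i 0) = 0 by have [] := centreP i.
have unique := normalized_blow_down_unique charK f_cubic f_smooth f_lines h_def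
  a0 b0 d0 m0 f_det e21 e12 e31 centre0 centreN.
split.
- exact: (charts_cover charK f_cubic f_smooth f_lines h_def).
- exists (contraction h a b d).
  exact: (contraction_normalized charK f_cubic f_smooth f_lines h_def
            a0 b0 d0 m0 f_det e21 e12 e31 centre0 centreN).
- move=> phi phi' /unique e1 /unique e2 L s x Sx.
  exact: proj_eq_trans (e1 L s x Sx) (proj_eq_sym (e2 L s x Sx)).
- move=> phi /unique e.
  exact: (given_on_charts charK f_cubic f_smooth f_lines h_def
            a0 b0 d0 m0 f_det e21 e12 e31 centre0 centreN e).
Qed.

(** * The characteristic of the p-adic numbers *)

Lemma residue_nat (p : nat) (p_pr : prime p) n k :
  residue (n%:R : padic_int p_pr) k = (n%:Z %% p%:Z ^+ k)%Z.
Proof.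
elim: n => [//|n IHn].
by rewrite mulrS -[LHS]/((_ + residue n%:R k) %% _)%Z IHn modzDm.
Qed.

(** The residue of n modulo p^n is n, as n < p^n. *)
Lemma padic_int_nat_eq0 (p : nat) (p_pr : prime p) n :
  n%:R = 0 :> padic_int p_pr -> n = 0%N.
Proof.
move/(congr1 (fun c => residue c n)); rewrite residue_nat.
rewrite -[RHS]/((0 %% _)%Z) mod0z => /dvdz_mod0P.
rewrite dvdzE abszX !absz_nat => /dvdn_leq; case: n => // n /(_ isT).
by rewrite leqNgt ltn_expl // prime_gt1.
Qed.

Lemma Qp_pchar (p : nat) (p_pr : prime p) : [pchar (Qp p_pr)] =i pred0.
Proof.
apply/pcharf0P => n; apply/idP/eqP => [|-> //].
rewrite -(rmorph_nat (@tofrac (padic_int p_pr))) tofrac_eq0 => /eqP.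
exact: padic_int_nat_eq0.
Qed.

Theorem theorem4p2 (p : nat) (p_pr : prime p) (f : {mpoly (Qp p_pr)[4]})
    (E G : 'I_6 -> 'M[Qp p_pr]_(2, 4)) (F : 'I_6 -> 'I_6 -> 'M[Qp p_pr]_(2, 4))
    (h : 'I_6 -> 'I_6 -> 'cV[Qp p_pr]_4)
    (f_cubic : f \is 3.-homog) (f_smooth : smooth f)
    (f_supp : full_support f)
    (f_lines : lines27 f E G F)
    (f_general : forall l, line_on f l -> avoids_coord_lines l)
    (h_def : forall i j, i != j -> defines_plane (h i j) (G i + E j)%MS) :
  [/\ forall (L : fieldType) (s : {rmorphism Qp p_pr -> L}) q,
        surface f s q <->
        U f G F i1 i2 s q \/ U f G F i1 i3 s q \/ U f G F i2 i3 s q,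
      exists pi, normalized_blow_down f E pi,
      forall pi pi', normalized_blow_down f E pi ->
        normalized_blow_down f E pi' -> eq_on (surface f) pi pi'
    & forall pi, normalized_blow_down f E pi ->
        [/\ given_on f E G F pi i1 i2 (chart12 h),
            given_on f E G F pi i1 i3 (chart13 h)
          & given_on f E G F pi i2 i3 (chart23 h)]].
Proof.
exact (smooth_cubic_blow_down (Qp_pchar p_pr) f_cubic f_smooth f_lines h_def).
Qed.
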